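(* Assume $0<\alpha<2$ and $0<\beta<\beta_\alpha$. Then, as $N\to\infty$, $$\frac1{b_N}\Bigl(\ln Z_N-N\ln2-\binom N2\,\mathbb E\Bigl[\ln\cosh(\beta J)\,\mathbf 1_{\{\ln\cosh(\beta J)\le\beta b_N\}}\Bigr]\Bigr)\stackrel{d}{\to}\beta Y_\alpha,$$ where $Y_\alpha$ is a random variable with characteristic function $$t\mapsto\exp\Bigl(\int_0^\infty\bigl(e^{itx}-1-itx\,\mathbf 1_{\{x\le1\}}\bigr)\,\alpha x^{-(\alpha+1)}dx\Bigr).$$
   Context: Lévy spin glass model. Let $0<\alpha<2$ and let $X$ be a symmetric real random variable with $\mathbb P(|X|>x)=L(x)/x^\alpha$ for all $x>0$, where $L:(0,\infty)\to(0,\infty)$ is slowly varying at $\infty$, i.e. $\lim_{x\to\infty}L(tx)/L(x)=1$ for every $t>0$. For $N\ge1$ set $a_N=\inf\{x>0: N\,\mathbb P(|X|>x)\le 1\}$ and $J=a_N^{-1}X$ ($a_N>0$ for all large $N$, and only large $N$ matter). Let $(J_{ij})_{1\le i<j\le N}$ be i.i.d. copies of $J$. For $\beta>0$ and $\sigma\in\{-1,1\}^N$ let $-H_N(\sigma)=\beta\sum_{1\le i<j\le N}J_{ij}\sigma_i\sigma_j$, and let $Z_N=\sum_{\sigma\in\{-1,1\}^N}e^{-H_N(\sigma)}$. Set $b_N=a_N^{-1}a_{\binom N2}$ and $\beta_\alpha=\Bigl(\alpha\int_0^\infty \frac{\tanh^2(x)}{x^{\alpha+1}}dx\Bigr)^{-1/\alpha}$.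 The symbol $\stackrel{d}{\to}$ denotes convergence in distribution. *)

(* Defs.v *)
From HB Require Import structures.
From mathcomp Require Import all_boot all_order all_algebra.
From mathcomp Require Import all_classical all_reals all_analysis.
From mathcomp Require Import complex.

Set Implicit Arguments.
Unset Strict Implicit.
Unset Printing Implicit Defensive.

Import Order.TTheory GRing.Theory Num.Theory.
Import numFieldNormedType.Exports.

Local Open Scope classical_set_scope.
Local Open Scope ring_scope.
Local Open Scope complex_scope.

Section RealFunctions.
Context {R : realType}.
Implicit Types (x : R) (L : R -> R).

Definition sinh x : R := (expR x - expR (- x)) / 2.
Definition cosh x : R := (expR x + expR (- x)) / 2.
Definition tanh x : R := sinh x / cosh x.

Definition slowly_varying L :=
  forall t : R, 0 < t -> L (t * x) / L x @[x --> +oo] --> (1 : R).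

End RealFunctions.

Section ComplexValued.
Context {R : realType}.

Definition expC (z : R[i]) : R[i] :=
  (expR (complex.Re z) * cos (complex.Im z)) +i*
  (expR (complex.Re z) * sin (complex.Im z)).

(* Only meaningful when the real and imaginary parts of f are integrable. *)
Definition integralC d (T : measurableType d) (mu : {measure set T -> \bar R})
    (D : set T) (f : T -> R[i]) : R[i] :=
  (\int[mu]_(x in D) complex.Re (f x)) +i*
  (\int[mu]_(x in D) complex.Im (f x)).

Definition charfun d (T : measurableType d) (P : probability T R)
    (Y : T -> R) (t : R) : R[i] :=
  integralC P setT (fun w => expC (0 +i* (t * Y w))).

End ComplexValued.

Section Laws.
Context {R : realType}.

(* Laws are compared on Borel sets only: [distribution P X] also has
   (arbitrary) values on non-measurable sets. *)
Definition same_law d (T : measurableType d) (P : probability T R) (X : T -> R)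
    d' (T' : measurableType d') (P' : probability T' R) (X' : T' -> R) :=
  forall B : set R, measurable B -> P (X @^-1` B) = P' (X' @^-1` B).

Definition symmetric_law d (T : measurableType d) (P : probability T R)
    (X : T -> R) := same_law P X P (fun w => - X w).

Definition mutually_independent d (T : measurableType d) (P : probability T R)
    (I : finType) (D : {set I}) (X : I -> T -> R) :=
  forall A : {set I}, A \subset D ->
  forall B : I -> set R, (forall i, measurable (B i)) ->
    P (\bigcap_(i in [set` A]) X i @^-1` B i) =
    (\prod_(i in A) P (X i @^-1` B i))%E.

(* Convergence of the expectations of bounded continuous test functions; the
   X N may live on different probability spaces. *)
Definition cvg_in_distribution (d : nat -> measure_display)
    (T : forall N, measurableType (d N)) (P : forall N, probability (T N) R)
    (X : forall N, T N -> R)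
    d' (T' : measurableType d') (P' : probability T' R) (Y : T' -> R) :=
  forall f : R -> R, continuous f -> (exists M : R, forall x, `|f x| <= M) ->
    ('E_(P N)[f \o X N] @[N --> \oo] --> 'E_P'[f \o Y])%E.

End Laws.

Section LevySpinGlass.
Context {R : realType}.

Definition tail d (T : measurableType d) (P : probability T R) (X : T -> R)
    (x : R) : \bar R := P [set w | x < `|X w|].

(* The paper's a_N.  It can be 0 for small N (e.g. a_1 = 0); since 0^-1 = 0 the
   corresponding coupling J is then 0, which does not affect the limit. *)
Definition normalizer d (T : measurableType d) (P : probability T R)
    (X : T -> R) (N : nat) : R :=
  inf [set x : R | 0 < x /\ (N%:R%:E * tail P X x <= 1)%E].

Definition coupling d (T : measurableType d) (P : probability T R) (X : T -> R)
    (N : nat) (w : T) : R := (normalizer P X N)^-1 * X w.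

Definition bscale d (T : measurableType d) (P : probability T R) (X : T -> R)
    (N : nat) : R := (normalizer P X N)^-1 * normalizer P X 'C(N, 2).

Definition beta_crit (alpha : R) : R :=
  (alpha * \int[lebesgue_measure]_(x in `]0, +oo[)
             (tanh x ^+ 2 / x `^ (alpha + 1))) `^ (- alpha^-1).

(* {-1,1}^N is encoded by boolean vectors; the spin of i is (-1) ^+ s i. *)
Definition spin N (s : {ffun 'I_N -> bool}) (i : 'I_N) : R := (-1) ^+ s i.

(* Only the entries J (i, j) with i < j are used. *)
Definition upper_pairs N : {set 'I_N * 'I_N} :=
  [set e : 'I_N * 'I_N | (e.1 < e.2)%N]%SET.

Definition hamiltonian N (beta : R) (J : 'I_N * 'I_N -> R)
    (s : {ffun 'I_N -> bool}) : R :=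
  - (beta * \sum_(e in upper_pairs N) J e * spin s e.1 * spin s e.2).

Definition partition_function N (beta : R) (J : 'I_N * 'I_N -> R) : R :=
  \sum_(s : {ffun 'I_N -> bool}) expR (- hamiltonian beta J s).

Definition truncated_lncosh_mean d (T : measurableType d)
    (P : probability T R) (X : T -> R) (beta : R) (N : nat) : R :=
  let g w := ln (cosh (beta * coupling P X N w)) in
  fine 'E_P[fun w => (g w * \1_[set w' | g w' <= beta * bscale P X N] w)%R]%E.

Definition free_energy_fluctuation d (T : measurableType d)
    (P : probability T R) (X : T -> R) (beta : R) (N : nat)
    (J : 'I_N * 'I_N -> R) : R :=
  (bscale P X N)^-1 *
  (ln (partition_function beta J) - N%:R * ln 2
   - 'C(N, 2)%:R * truncated_lncosh_mean P X beta N).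

Definition limit_charfun (alpha t : R) : R[i] :=
  expC (integralC lebesgue_measure `]0, +oo[
    (fun x : R =>
       (expC (0 +i* (t * x)) - 1
        - (0 +i* (t * x * \1_[set y : R | y <= 1] x)))
       * (alpha * x `^ (- (alpha + 1)))%:C)).

End LevySpinGlass.

(* Main.v *)
Require Import Defs.
From HB Require Import structures.
From mathcomp Require Import all_boot all_order all_algebra.
From mathcomp Require Import all_classical all_reals all_analysis.
From mathcomp Require Import complex ring lra zify measurable_realfun.
Import Order.TTheory GRing.Theory Num.Theory.
Import numFieldNormedType.Exports.
Local Open Scope classical_set_scope.
Local Open Scope ring_scope.

(** Expanding each factor exp (beta J_e sigma_i sigma_j) as
    cosh (beta J_e) (1 + tanh (beta J_e) sigma_i sigma_j), the partition function
    is 2^N times the product of the cosh (beta J_e) over the n = 'C(N, 2) edges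
    times the reduced partition function, the average over uniform spins of the
    product of the factors 1 + tanh (beta J_e) sigma_i sigma_j
    ([ln_partition_function]).  The product of the cosh carries all fluctuations
    of order b_N, the scale of the largest coupling; the logarithm of the reduced
    partition function is o(b_N) in probability.

    The leading term.  The variable xi = ln cosh (beta J) / (beta b_N) differs
    from |J| / b_N by at most ln 2 / (beta b_N), so that n P(xi > x) tends to
    x^-alpha.  Together with a bound on truncated second moments (Karamata), tail
    convergence gives n E h(xi) -> integral of h against alpha x^(-alpha-1) dx for
    regular h of order min (x^2, 1) ([levy_functional_cvg], [stable_limit]).
    With h = cos (u x) - 1 and h = sin (u x) - u x 1(x <= 1) this is convergence
    of the exponent of the limiting law; the n-th power of a characteristic
    function then converges as in the compound Poisson case, the error being
    n E[xi; xi <= 1]^2 -> 0 ([compound_cvg], [leading_term_cvg]).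

    The reduced partition function.  Its mean is 1, hence the upper tail by
    Markov's inequality.  Its second moment is an average over two replicas of
    the product of 1 + E[tanh^2 (beta J)] tau_i tau_j, bounded as soon as
    N E[tanh^2 (beta J)] <= r < 1; by [stable_limit] with h = tanh^2 this is the
    condition beta < beta_crit.  Paley-Zygmund then makes the reduced partition
    function at least 1/2 with probability bounded below, and a small variance of
    its logarithm would lift this to a lower bound with probability close to 1.
    The increments of the logarithm are controlled by the couplings themselves,
    which are not square integrable, so one conditions on the couplings larger
    than eta b_N.  With probability close to 1 their
    edges are pairwise disjoint, and the conditional mean is then still 1, since
    symmetry removes the other edges and the spin products along a matching are
    independent and centred ([resample_random_partition]).  Given the large
    couplings, changing a coupling J_e to J'_e moves the logarithm by at most
    2 beta (|J_e| + |J'_e|), and the Efron-Stein inequality bounds the conditional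
    variance by a multiple of n E[J^2; |J| <= eta b_N], which is of order
    eta^(2 - alpha) b_N^2 ([random_partition_lower_tail], [log_remainder_small]).

    Conditional expectations are finite sums: for fixed N the couplings are
    rounded to a finite grid, odd so as to keep the symmetry, and fine enough to
    make the error as small as desired ([mean_rounded]).  The passage from
    characteristic functions to bounded continuous test functions is
    [levy_continuity]. *)

Set Implicit Arguments.
Unset Strict Implicit.
Unset Printing Implicit Defensive.

(** * Hyperbolic functions *)

Section Hyperbolic.
Context {R : realType}.
Implicit Types x y : R.

Lemma ge0_of_derive (f f' : R -> R) :
  (forall x, is_derive x 1 f (f' x)) -> (forall x, 0 <= x -> 0 <= f' x) ->
  forall x, 0 <= x -> f 0 <= f x.
Proof.
move=> df f'0 x x0; apply: (@ger0_derive1_ndecry R f 0) => // [y|].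
- by rewrite in_itv/= andbT => y0; rewrite derive1E (@derive_val _ _ _ _ _ _ _ (df y)) f'0 ?ltW.
- apply: continuous_subspaceT => y; apply: differentiable_continuous.
  by apply/derivable1_diffP; have [] := df y.
Qed.

Lemma cosh_gt0 x : 0 < cosh x.
Proof. by rewrite /cosh divr_gt0// addr_gt0 ?expR_gt0. Qed.

Lemma cosh_ge1 x : 1 <= cosh x.
Proof.
rewrite /cosh ler_pdivlMr// mul1r.
by have := expR_ge1Dx x; have := expR_ge1Dx (- x); lra.
Qed.

Lemma cosh0 : cosh 0 = 1 :> R.
Proof. by rewrite /cosh oppr0 expR0; field. Qed.

Lemma coshN x : cosh (- x) = cosh x.
Proof. by rewrite /cosh opprK addrC. Qed.

Lemma sinhN x : sinh (- x) = - sinh x.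
Proof. by rewrite /sinh opprK -mulNr opprB. Qed.

Lemma tanhN x : tanh (- x) = - tanh x.
Proof. by rewrite /tanh sinhN coshN mulNr. Qed.

Lemma tanh0 : tanh 0 = 0 :> R.
Proof. by rewrite /tanh /sinh oppr0 subrr !mul0r. Qed.

Lemma expR_cosh_sinh x : expR x = cosh x + sinh x.
Proof. by rewrite /cosh /sinh; field. Qed.

Lemma is_derive_expRN x : is_derive x 1 (fun y => expR (- y)) (- expR (- x)).
Proof.
by apply: is_derive_eq; rewrite mulrN1.
Qed.

Lemma is_derive_cosh x : is_derive x 1 (@cosh R) (sinh x).
Proof.
have h := is_derive_expRN x.
have -> : @cosh R = 2^-1 *: (expR + (fun y : R => expR (- y))).
  by apply/funext => y; rewrite /cosh [RHS]mulrC.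
by apply: is_derive_eq; rewrite /sinh mulrC.
Qed.

Lemma is_derive_sinh x : is_derive x 1 (@sinh R) (cosh x).
Proof.
have h := is_derive_expRN x.
have -> : @sinh R = 2^-1 *: (expR - (fun y : R => expR (- y))).
  by apply/funext => y; rewrite /sinh [RHS]mulrC.
by apply: is_derive_eq; rewrite /cosh opprK mulrC.
Qed.

Lemma sinh_ge0 x : 0 <= x -> 0 <= sinh x.
Proof.
by move=> x0; rewrite /sinh divr_ge0// subr_ge0 ler_expR; lra.
Qed.

Lemma sinh_le_cosh x : 0 <= x -> sinh x <= x * cosh x.
Proof.
move=> x0; rewrite -subr_ge0.
have := @ge0_of_derive (fun x => x * cosh x - sinh x) (fun x => x * sinh x).
rewrite /= mul0r sub0r /sinh oppr0 subrr mul0r oppr0; apply => //.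
  move=> y; have dc := is_derive_cosh y; have ds := is_derive_sinh y.
  apply: (@is_derive_eq _ _ _ _ _ _ _ _
    (is_deriveB (is_deriveM (is_derive_id y 1) dc) ds)).
  by rewrite /GRing.scale/= mulr1 addrK.
by move=> y y0; rewrite mulr_ge0 ?sinh_ge0.
Qed.

(** The sharp Gaussian bound: the factor 1/2 is what makes the second moment
    of the partition function finite in the whole subcritical region. *)
Lemma cosh_le_expR x : cosh x <= expR (x ^+ 2 / 2).
Proof.
wlog x0 : x / 0 <= x.
  move=> h; have [/h//|xlt0] := leP 0 x.
  by rewrite -coshN -(sqrrN x) h// oppr_ge0 ltW.
have E0 y : 0 < expR (- (y ^+ 2 / 2)) by exact: expR_gt0.
rewrite -[leRHS]mul1r -ler_pdivrMr ?expR_gt0// -expRN.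
have de y : is_derive y 1 (fun z : R => expR (- (z ^+ 2 / 2)))
    (- y * expR (- (y ^+ 2 / 2))).
  have hg : is_derive y 1 (fun z : R => - (z ^+ 2 / 2)) (- y).
    have -> : (fun z : R => - (z ^+ 2 / 2)) = - (2^-1 *: ((id : R -> R) ^+ 2)).
      by apply/funext => z; rewrite !fctE [X in - X]mulrC.
    by apply: is_derive_eq; rewrite /GRing.scale/= expr1 mulr1; field.
  have h := @is_derive1_comp R expR (fun z => - (z ^+ 2 / 2)) y _ (- y)
    (is_derive_expR _) hg.
  by apply: is_derive_eq; rewrite mulrC.
have := @ge0_of_derive (fun x => - (cosh x * expR (- (x ^+ 2 / 2))))
  (fun x => (x * cosh x - sinh x) * expR (- (x ^+ 2 / 2))) _ _ x x0.
rewrite /= expr0n/= mul0r oppr0 expR0 mulr1 cosh0 lerN2; apply.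
  move=> y; have dc := is_derive_cosh y; have dey := de y.
  apply: (@is_derive_eq _ _ _ _ _ _ _ _ (is_deriveN (is_deriveM dc dey))).
  by rewrite /GRing.scale/=; ring.
by move=> y y0; rewrite mulr_ge0 ?expR_ge0// subr_ge0 sinh_le_cosh.
Qed.

Lemma cosh_le_shift x y : cosh x <= expR `|x - y| * cosh y.
Proof.
rewrite /cosh mulrA ler_pM2r ?invr_gt0// mulrDr -!expRD lerD// ler_expR.
  by rewrite -lerBlDr ler_norm.
by rewrite -lerBlDr opprK addrC -normrN opprB ler_norm.
Qed.

Lemma ln_cosh_ge0 x : 0 <= ln (cosh x).
Proof. by rewrite ln_ge0// cosh_ge1. Qed.

Lemma ln_cosh_lip x y : `|ln (cosh x) - ln (cosh y)| <= `|x - y|.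
Proof.
wlog : x y / ln (cosh y) <= ln (cosh x) => [h|le].
  have [/h//|/ltW/h] := leP (ln (cosh y)) (ln (cosh x)).
  by rewrite distrC (distrC y).
rewrite ger0_norm ?subr_ge0// lerBlDr -[X in _ <= X + _](expRK `|x - y|).
have cy := cosh_gt0 y; have e0 := expR_gt0 `|x - y|.
have ey := mulr_gt0 e0 cy; have cx := cosh_gt0 x.
by rewrite -lnM ?posrE// ler_ln ?posrE// cosh_le_shift.
Qed.

Lemma ln_cosh_le x : ln (cosh x) <= `|x|.
Proof.
have := ln_cosh_lip x 0; rewrite subr0 cosh0.
by rewrite ln1 subr0 ger0_norm ?ln_cosh_ge0.
Qed.

Lemma ln_cosh_ge x : `|x| - ln 2 <= ln (cosh x).
Proof.
rewrite -[X in X - _](expRK `|x|) -ln_div ?posrE ?expR_gt0//.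
rewrite ler_ln ?posrE ?cosh_gt0 ?divr_gt0 ?expR_gt0//.
rewrite /cosh.
rewrite ler_pM2r ?invr_gt0//.
have [_|_] := ler0P x; first by rewrite lerDr expR_ge0.
by rewrite lerDl expR_ge0.
Qed.

Lemma tanh_lt1 x : `|tanh x| < 1.
Proof.
rewrite /tanh normrM normfV (ger0_norm (ltW (cosh_gt0 x))).
rewrite ltr_pdivrMr ?cosh_gt0// mul1r /sinh /cosh.
rewrite ltr_norml; have := expR_gt0 x; have := expR_gt0 (- x); lra.
Qed.

Lemma ge0_tanh x : 0 <= x -> 0 <= tanh x.
Proof. by move=> x0; rewrite /tanh; apply: divr_ge0; [exact: sinh_ge0|exact/ltW/cosh_gt0]. Qed.

Lemma tanh_le x : `|tanh x| <= `|x|.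
Proof.
wlog x0 : x / 0 <= x.
  move=> h; have [/h//|/ltW xlt0] := leP 0 x.
  by rewrite -(normrN x) -(normrN (tanh x)) -tanhN h// oppr_ge0.
rewrite !ger0_norm ?ge0_tanh// /tanh ler_pdivrMr ?cosh_gt0//.
exact: sinh_le_cosh.
Qed.

Lemma tanhB x y : tanh x - tanh y = tanh (x - y) * (1 - tanh x * tanh y).
Proof.
have sE : sinh (x - y) = sinh x * cosh y - cosh x * sinh y.
  by rewrite /sinh /cosh opprB !expRD; field.
have cE : cosh (x - y) = cosh x * cosh y - sinh x * sinh y.
  by rewrite /sinh /cosh opprB !expRD; field.
have c0 (z : R) : cosh z != 0 by rewrite gt_eqF//; exact: cosh_gt0.
rewrite {3}/tanh sE cE /tanh; field.
by rewrite -cE !c0.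
Qed.

(** From the addition formula: the factor 1 - tanh x tanh y lies between 0 and 2. *)
Lemma tanh_lip x y : `|tanh x - tanh y| <= 2 * `|x - y|.
Proof.
rewrite tanhB mulrC normrM ler_pM// ?tanh_le//.
rewrite (le_trans (ler_normB _ _))// normr1 normrM.
have -> : 2 = 1 + 1 * 1 :> R by ring.
by rewrite lerD2l ler_pM// ltW// tanh_lt1.
Qed.

Lemma tanh_homo x y : x <= y -> tanh x <= tanh y.
Proof.
move=> xy; rewrite -subr_ge0 tanhB mulr_ge0 ?ge0_tanh ?subr_ge0//.
rewrite (le_trans (ler_norm _))// normrM -[leRHS]mulr1.
by rewrite ler_pM// ltW// tanh_lt1.
Qed.

Lemma expR_pm1 (b : bool) x :
  expR ((-1) ^+ b * x) = cosh x * (1 + (-1) ^+ b * tanh x).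
Proof.
have c0 : cosh x != 0 by rewrite gt_eqF//; exact: cosh_gt0.
rewrite expR_cosh_sinh; case: b; rewrite ?expr1 ?expr0 /tanh.
  by rewrite !mulN1r coshN sinhN; field.
by rewrite !mul1r; field.
Qed.

Lemma measurable_cosh : measurable_fun setT (@cosh R).
Proof.
apply: continuous_measurable_fun => x; apply: differentiable_continuous.
by apply/derivable1_diffP; have [] := is_derive_cosh x.
Qed.

Lemma measurable_ln_cosh : measurable_fun setT (fun x => ln (cosh x : R)).
Proof.
exact: measurableT_comp (@measurable_ln R) measurable_cosh.
Qed.

Lemma measurable_tanh : measurable_fun setT (@tanh R).
Proof.
by apply: nondecreasing_measurable => // x y; exact: tanh_homo.
Qed.

End Hyperbolic.

(** * Expectations on finite products, and conditional averaging *)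

Section PositiveFunctional.
Context {R : realType} {A : Type}.
Implicit Types (phi : (A -> R) -> R) (f g : A -> R).

Definition expectation_like phi :=
  [/\ phi (fun=> 1) = 1,
      forall f g, phi (fun a => f a + g a) = phi f + phi g,
      forall c f, phi (fun a => c * f a) = c * phi f
    & forall f g, (forall a, f a <= g a) -> phi f <= phi g].

Context (phi : (A -> R) -> R) (Hphi : expectation_like phi).

Lemma expectation_cst c : phi (fun=> c) = c.
Proof.
have [h1 _ hZ _] := Hphi.
by rewrite -[RHS]mulr1 -h1 -hZ; congr phi; apply/funext => a; rewrite mulr1.
Qed.

Lemma variance_le f a :
  phi (fun x => f x ^+ 2) - phi f ^+ 2 <= phi (fun x => (f x - a) ^+ 2).
Proof.
have [_ hD hZ _] := Hphi.
have -> : (fun x => (f x - a) ^+ 2) =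
    (fun x => f x ^+ 2 + ((- (2 * a)) * f x + a ^+ 2)).
  by apply/funext => x; ring.
rewrite hD (hD (fun x => - (2 * a) * f x)) hZ expectation_cst.
have := sqr_ge0 (phi f - a); nra.
Qed.

(** Paley-Zygmund, in the form that needs no Cauchy-Schwarz: weigh Z by
    Z <= 1/2 + Z 1(1/2 <= Z) and split the product by u v <= (u^2 + v^2)/2
    with the optimal weights. *)
Lemma paley_zygmund (Z : A -> R) (C : R) : (forall a, 0 <= Z a) -> 0 < C ->
  phi Z = 1 -> phi (fun a => Z a ^+ 2) <= C ->
  (4 * C)^-1 <= phi (fun a => ((2^-1 : R) <= Z a)%R%:R).
Proof.
move=> Z0 C0 Z1 Z2; have [_ hD hZ hle] := Hphi.
have key : phi Z <= 2^-1 + ((4 * C)^-1 * phi (fun a => Z a ^+ 2) +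
    C * phi (fun a => ((2^-1 : R) <= Z a)%R%:R)).
  rewrite -[X in X + _]expectation_cst -!hZ -!hD; apply: hle => a.
  have Ci : C * C^-1 = 1 by rewrite divff// gt_eqF.
  rewrite invfM; set i := C^-1 in Ci *.
  have i0 : 0 < i by rewrite invr_gt0.
  have z0 := Z0 a; case: (leP 2^-1 (Z a)) => /= h; last by nra.
  have : 0 <= i * (Z a / 2 - C) ^+ 2 by rewrite mulr_ge0 ?sqr_ge0// ltW.
  have -> : i * (Z a / 2 - C) ^+ 2 =
     (4^-1 * i) * Z a ^+ 2 - (C * i) * Z a + (C * i) * C by field.
  by rewrite Ci; lra.
move: key; rewrite Z1; set w := phi (fun a => _%:R) => key.
have {}key : 4^-1 <= C * w.
  have h : (4 * C)^-1 * phi (fun a => Z a ^+ 2) <= 4^-1.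
    by rewrite invfM -mulrA ler_piMr ?invr_ge0// ler_pdivrMl// mulr1.
  lra.
by rewrite invfM ler_pdivrMr 1?mulrC// ler_pdivrMr.
Qed.

(** A positive variable with mean one, bounded second moment and a
    logarithm of small variance is not exponentially small: Paley-Zygmund
    keeps the mean of the logarithm from being very negative, and Chebyshev
    keeps the logarithm close to its mean. *)
Lemma ln_lower_tail (Z : A -> R) (C V x : R) :
  (forall a, 0 < Z a) -> 0 < C -> 0 < x -> 4 * C * V < x ^+ 2 ->
  phi Z = 1 -> phi (fun a => Z a ^+ 2) <= C ->
  phi (fun a => ln (Z a) ^+ 2) - phi (fun a => ln (Z a)) ^+ 2 <= V ->
  phi (fun a => (ln (Z a) < - ln 2 - 2 * x)%R%:R) <= V / x ^+ 2.
Proof.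
move=> Z0 C0 x0 CVx Z1 Z2 ZV; have [_ hD hZ hle] := Hphi.
set m := phi (fun a => ln (Z a)) in ZV *.
have var_m : phi (fun a => (ln (Z a) - m) ^+ 2) <= V.
  apply: le_trans ZV.
  have -> : (fun x => (ln (Z x) - m) ^+ 2) =
      (fun x => ln (Z x) ^+ 2 + ((- (2 * m)) * ln (Z x) + m ^+ 2)).
    by apply/funext => y; ring.
  rewrite hD (hD (fun x => - (2 * m) * ln (Z x))) hZ expectation_cst -/m.
  by lra.
have cheb (B : A -> bool) : (forall a, B a -> x ^+ 2 <= (ln (Z a) - m) ^+ 2) ->
    x ^+ 2 * phi (fun a => (B a)%:R) <= V.
  move=> hB; apply: le_trans var_m; rewrite -hZ; apply: hle => a.
  by case: (boolP (B a)) => [/hB|_]; rewrite ?mulr1 ?mulr0 ?sqr_ge0.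
have m_ge : - ln 2 - x <= m.
  rewrite leNgt; apply/negP => m_lt.
  have := paley_zygmund (fun a => ltW (Z0 a)) C0 Z1 Z2.
  have : x ^+ 2 * phi (fun a => ((2^-1 : R) <= Z a)%R%:R) <= V.
    apply: cheb => a h.
    have : - ln 2 <= ln (Z a) by rewrite -lnV ?posrE// ler_ln ?posrE.
    by nra.
  set w := phi _ => hx hw.
  have x20 : 0 < x ^+ 2 by rewrite exprn_gt0.
  have : x ^+ 2 / (4 * C) <= V.
    by apply: le_trans hx; rewrite ler_pM2l.
  by rewrite ler_pdivrMr ?mulr_gt0// mulrC leNgt CVx.
rewrite ler_pdivlMr ?exprn_gt0// mulrC; apply: cheb => a h; nra.
Qed.

End PositiveFunctional.

Section FiniteProduct.
Context {R : realType} {E S : finType} (p : S -> R).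
Context (p_ge0 : forall x, 0 <= p x) (p_sum : \sum_x p x = 1).
Implicit Types (f g : {ffun E -> S} -> R) (s : {ffun E -> S}) (e : E) (x y : S).

Definition product_weight s : R := \prod_e p (s e).

Definition product_mean f : R := \sum_s product_weight s * f s.

Definition update s e x : {ffun E -> S} :=
  [ffun e' => if e' == e then x else s e'].

Lemma product_weight_ge0 s : 0 <= product_weight s.
Proof. by apply: prodr_ge0. Qed.

Lemma product_mean_prod (F : E -> S -> R) :
  product_mean (fun s => \prod_e F e (s e)) = \prod_e \sum_x p x * F e x.
Proof.
rewrite bigA_distr_bigA/=; apply: eq_bigr => s _.
by rewrite /product_weight -big_split.
Qed.

Lemma product_mean_expectation : expectation_like product_mean.
Proof.
split=> [|f g|c f|f g le_fg].
- have := product_mean_prod (fun _ _ => 1).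
  rewrite [X in _ = X]big1 => [|e _]; last first.
    by under eq_bigr do rewrite mulr1.
  by move=> h; rewrite -[RHS]h /product_mean; apply: eq_bigr => s _; rewrite big1.
- by rewrite /product_mean -big_split/=; apply: eq_bigr => s _; rewrite mulrDr.
- by rewrite /product_mean [RHS]big_distrr; apply: eq_bigr => s _; exact: mulrCA.
- by apply: ler_sum => s _; rewrite ler_wpM2l ?product_weight_ge0.
Qed.

Lemma update_same s e x : update s e x e = x.
Proof. by rewrite ffunE eqxx. Qed.

Lemma update_neq s e e' x : e' != e -> update s e x e' = s e'.
Proof. by move=> /negPf ne; rewrite ffunE ne. Qed.

Lemma update_update s e x y : update (update s e x) e y = update s e y.
Proof. by apply/ffunP => e'; rewrite !ffunE; case: (e' == e). Qed.

Lemma update_id s e : update s e (s e) = s.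
Proof. by apply/ffunP => e'; rewrite ffunE; case: eqP => [->|]. Qed.

Lemma updateC s e e' x y : e != e' ->
  update (update s e x) e' y = update (update s e' y) e x.
Proof.
move=> ne; apply/ffunP => e''; rewrite !ffunE.
by case: (eqVneq e'' e') => // ->; rewrite eq_sym (negPf ne).
Qed.

Lemma product_weight_update s e x :
  product_weight (update s e x) * p (s e) = product_weight s * p x.
Proof.
rewrite /product_weight (bigD1 e)//= [in RHS](bigD1 e)//= update_same.
rewrite (eq_bigr (fun e' => p (s e'))) => [|e' ne]; last by rewrite update_neq.
by ring.
Qed.

(** ** Averaging over the coordinates with a small value *)

Context (sm : pred S) (sm_gt0 : 0 < \sum_(x | sm x) p x).

Definition small_mean (h : S -> R) : R :=
  (\sum_(x | sm x) p x)^-1 * \sum_(x | sm x) p x * h x.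

(** The conditional expectation given all coordinates but e, and also given
    the coordinate e when its value is not small. *)
Definition resample e f s : R :=
  if sm (s e) then small_mean (fun x => f (update s e x)) else f s.

(** The conditional expectation given the positions and the values of the
    coordinates of l that are not small, and the coordinates outside l. *)
Definition resample_seq (l : seq E) f : {ffun E -> S} -> R := foldr resample f l.

Lemma small_mean_expectation : expectation_like small_mean.
Proof.
split=> [|f g|c f|f g le_fg]; rewrite /small_mean/=.
- rewrite [X in _ * X](eq_bigr p) => [|x _]; last by rewrite mulr1.
  by rewrite mulVf// gt_eqF.
- by rewrite -mulrDr -big_split; congr (_ * _); apply: eq_bigr => s _ /=; rewrite mulrDr.
- by rewrite [RHS]mulrCA [X in _ = _ * X]big_distrr; congr (_ * _); apply: eq_bigr => s _ /=; rewrite mulrCA.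
- apply: ler_wpM2l; first by rewrite invr_ge0 ltW.
  by apply: ler_sum => s _; rewrite ler_wpM2l.
Qed.

Lemma small_mean_le (f g : S -> R) : (forall x, sm x -> f x <= g x) ->
  small_mean f <= small_mean g.
Proof.
move=> h; apply: ler_wpM2l; first by rewrite invr_ge0 ltW.
by apply: ler_sum => s ss; rewrite ler_wpM2l// h.
Qed.

Lemma resample_expectation e s : expectation_like (fun f => resample e f s).
Proof.
have [h1 hD hZ hle] := small_mean_expectation; rewrite /resample.
by case: (sm (s e)); split=> // f g h; apply: hle => x.
Qed.

Lemma resample_seq_expectation l s : expectation_like (fun f => resample_seq l f s).
Proof.
elim: l s => [|e l IH] s; first by split=> // f g; exact.
have [h1 hD hZ hle] := resample_expectation e s.
split=> [|f g|c f|f g le_fg] /=.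
- by rewrite -[RHS]h1; congr (resample e _ s); apply/funext => s'; have [] := IH s'.
- rewrite -hD; congr (resample e _ s); apply/funext => s'.
  by have [_ + _ _] := IH s'; apply.
- rewrite -hZ; congr (resample e _ s); apply/funext => s'.
  by have [_ _ + _] := IH s'; apply.
- by apply: hle => s'; have [_ _ _] := IH s'; apply.
Qed.

(** The involution exchanging the value at e with the fresh value preserves
    the joint weight. *)
Lemma product_mean_resample e f : product_mean (resample e f) = product_mean f.
Proof.
set Q := \sum_(x | sm x) p x.
have swap : \sum_(s : {ffun E -> S} | sm (s e)) \sum_(x | sm x)
      product_weight s * p x * f (update s e x) =
    \sum_(s : {ffun E -> S} | sm (s e)) \sum_(x | sm x) product_weight s * p x * f s.
  rewrite !pair_big /= .
  rewrite (reindex_inj (h := fun u : {ffun E -> S} * S =>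
      (update u.1 e u.2, u.1 e))) /=; last first.
    apply: can_inj (fun u : {ffun E -> S} * S => (update u.1 e u.2, u.1 e)) _.
    by case=> s x /=; rewrite update_update update_id update_same.
  apply: eq_big => [[s x]|[s x] _] /=.
    by rewrite update_same andbC.
  by rewrite update_update update_id product_weight_update.
rewrite /product_mean (bigID (fun s => sm (s e)))/= [RHS](bigID (fun s => sm (s e)))/=.
congr (_ + _); last by apply: eq_bigr => s /negPf ns; rewrite /resample ns.
transitivity (Q^-1 * \sum_(s : {ffun E -> S} | sm (s e)) \sum_(x | sm x)
    product_weight s * p x * f (update s e x)).
  rewrite big_distrr/=; apply: eq_bigr => s ss.
  rewrite /resample ss /small_mean mulrCA; congr (_ * _).
  by rewrite big_distrr/=; apply: eq_bigr => x _; rewrite mulrA.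
rewrite swap big_distrr/=; apply: eq_bigr => s _.
rewrite (eq_bigr (fun x => p x * (product_weight s * f s))); last first.
  by move=> x _; ring.
by rewrite -big_distrl/= -/Q mulKf// gt_eqF.
Qed.

Lemma product_mean_resample_seq l f : product_mean (resample_seq l f) = product_mean f.
Proof. by elim: l => //= e l IH; rewrite product_mean_resample. Qed.

Lemma resample_prod e (F : E -> S -> R) s :
  resample e (fun s => \prod_e' F e' (s e')) s =
  \prod_e' (if (e' == e) && sm (s e') then small_mean (F e') else F e' (s e')).
Proof.
rewrite /resample; case: ifP => ss; last first.
  by apply: eq_bigr => e' _; case: eqP => [->|//]; rewrite ss.
rewrite (bigD1 e)//= eqxx ss/= mulrC.
have [_ _ hZ _] := small_mean_expectation.
rewrite -hZ; congr small_mean; apply/funext => x.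
rewrite (bigD1 e)//= update_same mulrC; congr (_ * _).
by apply: eq_bigr => e' ne; rewrite update_neq// (negPf ne).
Qed.

Lemma resample_seq_prod l (F : E -> S -> R) s : uniq l ->
  resample_seq l (fun s => \prod_e F e (s e)) s =
  \prod_e (if (e \in l) && sm (s e) then small_mean (F e) else F e (s e)).
Proof.
elim: l s => [|e l IH] s /=; first by move=> _; apply: eq_bigr.
move=> /andP[el ul].
pose G e' x := if (e' \in l) && sm x then small_mean (F e') else F e' x.
have -> : resample_seq l (fun s => \prod_e F e (s e)) =
    fun s => \prod_e' G e' (s e') by apply/funext => s'; rewrite IH.
rewrite resample_prod /G; apply: eq_bigr => e' _ /=.
rewrite in_cons; case: eqP => [->|//] /=.
by rewrite (negPf el).
Qed.

(** ** Efron-Stein *)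

Context (c : S -> R).

Definition increments_bounded f :=
  forall s e x, sm (s e) -> sm x -> `|f s - f (update s e x)| <= c (s e) + c x.

(** Averaging one coordinate preserves the bound: the same fresh value can be
    used in both averages. *)
Lemma increments_resample e f : increments_bounded f ->
  increments_bounded (resample e f).
Proof.
move=> hf s e' x ss sx; rewrite /resample.
have [->|ne] := eqVneq e e'.
  rewrite update_same sx ss.
  under [X in _ - small_mean X]eq_fun do rewrite update_update.
  rewrite subrr normr0.
  by rewrite (le_trans _ (hf s e' x ss sx)).
rewrite update_neq//; case: ifP => se; last exact: hf.
have [_ hD hZ _] := small_mean_expectation.
rewrite -mulN1r -hZ -hD.
have bnd z : `|f (update s e z) + -1 * f (update (update s e' x) e z)| <=
    c (s e') + c x.
  rewrite mulN1r updateC; last by rewrite eq_sym.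
  by rewrite (le_trans (hf _ _ _ _ sx)) ?update_neq// eq_sym.
have hc := expectation_cst small_mean_expectation.
rewrite ler_norml; apply/andP; split.
  rewrite -[leLHS]hc; apply: small_mean_le => z _.
  by have := bnd z; rewrite ler_norml => /andP[].
rewrite -[leRHS]hc; apply: small_mean_le => z _.
by have := bnd z; rewrite ler_norml => /andP[].
Qed.

Definition step_variance : R := 4 * small_mean (fun x => c x ^+ 2).

Lemma step_variance_ge0 : 0 <= step_variance.
Proof.
rewrite mulr_ge0//.
have -> : 0 = small_mean (fun=> 0) by rewrite (expectation_cst small_mean_expectation).
by apply: small_mean_le => x _; exact: sqr_ge0.
Qed.

Lemma resample_variance e f s : increments_bounded f ->
  resample e (fun s => f s ^+ 2) s - resample e f s ^+ 2 <= step_variance.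
Proof.
move=> hf; rewrite /resample; case: ifP => ss; last first.
  by rewrite subrr step_variance_ge0.
set M := small_mean (fun x => c x ^+ 2).
have [_ hD hZ _] := small_mean_expectation.
have hc := expectation_cst small_mean_expectation.
rewrite -[leLHS]hc.
have -> : step_variance = small_mean (fun y => 2 * M + 2 * c y ^+ 2).
  rewrite (hD (fun=> 2 * M)) (hZ 2 (fun y => c y ^+ 2)) hc /step_variance -/M.
  by ring.
apply: small_mean_le => y sy.
apply: le_trans (variance_le small_mean_expectation _ (f (update s e y))) _.
have -> : 2 * M + 2 * c y ^+ 2 = small_mean (fun x => 2 * c x ^+ 2 + 2 * c y ^+ 2).
  by rewrite (hD (fun x => 2 * c x ^+ 2)) (hZ 2 (fun y => c y ^+ 2)) hc.
apply: small_mean_le => x sx.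
have := hf (update s e x) e y; rewrite update_same update_update => /(_ sx sy) h.
rewrite -real_normK ?num_real//.
have : `|f (update s e x) - f (update s e y)| ^+ 2 <= (c x + c y) ^+ 2.
  by rewrite ler_sqr// nnegrE// (le_trans _ h).
by have := sqr_ge0 (c x - c y); nra.
Qed.

(** The law of total variance along the coordinates, each step contributing at
    most one step variance. *)
Lemma resample_seq_variance l f s : increments_bounded f ->
  resample_seq l (fun s => f s ^+ 2) s - resample_seq l f s ^+ 2 <=
  (size l)%:R * step_variance.
Proof.
move=> hf; elim: l s => [|e l IH] s /=; first by rewrite subrr mul0r.
have hg : increments_bounded (resample_seq l f).
  by elim: l {IH} => //= e' l; exact: increments_resample.
have [_ hD hZ hle] := resample_expectation e s.
have hc := expectation_cst (resample_expectation e s).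
have h1 : resample e (resample_seq l (fun s => f s ^+ 2)) s <=
    resample e (fun s => resample_seq l f s ^+ 2) s + (size l)%:R * step_variance.
  rewrite -[X in _ + X]hc -hD; apply: hle => s'.
  by rewrite -lerBlDl.
have := resample_variance e s hg.
by rewrite -(addn1 (size l)) natrD mulrDl mul1r; lra.
Qed.

End FiniteProduct.

(** Conditional second moments are controlled by Markov's inequality, so that
    the Paley-Zygmund argument applies conditionally on the large values,
    outside an event of small probability. *)
Section ConditionalLowerTail.
Context {R : realType} {E S : finType} (p : S -> R).
Context (p_ge0 : forall x, 0 <= p x) (p_sum : \sum_x p x = 1).
Context (sm : pred S) (sm_gt0 : 0 < \sum_(x | sm x) p x).

Lemma product_mean_ln_lower_tail (Z : {ffun E -> S} -> R) (good : pred {ffun E -> S})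
    (c : S -> R) (C eps x : R) :
  (forall s, 0 < Z s) -> increments_bounded sm c (fun s => ln (Z s)) ->
  (forall s, good s -> resample_seq p sm (enum E) Z s = 1) ->
  0 < C -> product_mean p (fun s => Z s ^+ 2) <= C -> 0 < eps -> 0 < x ->
  4 * (C / eps) * (#|E|%:R * step_variance p sm c) < x ^+ 2 ->
  product_mean p (fun s => (ln (Z s) < - ln 2 - 2 * x)%R%:R) <=
  #|E|%:R * step_variance p sm c / x ^+ 2
    + product_mean p (fun s => (~~ good s)%:R) + eps.
Proof.
move=> Z0 hc hgood C0 Z2 e0 x0 hx.
have V0 : 0 <= #|E|%:R * step_variance p sm c.
  by rewrite mulr_ge0// step_variance_ge0.
set V := _ * step_variance _ _ _ in hx V0 *.
have [_ hD hZ hle] := product_mean_expectation p_ge0 p_sum (E := E).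
have hcst := expectation_cst (product_mean_expectation p_ge0 p_sum (E := E)).
pose T := resample_seq p sm (enum E).
rewrite -(product_mean_resample_seq sm_gt0 (enum E)) -/T.
have bnd s : T (fun s => (ln (Z s) < - ln 2 - 2 * x)%R%:R) s <=
    (V / x ^+ 2 + (~~ good s)%:R) + (eps / C) * T (fun s => Z s ^+ 2) s.
  have ep := resample_seq_expectation p_ge0 sm_gt0 (enum E) s.
  have [_ _ _ thle] := ep.
  have T2 : 0 <= T (fun s => Z s ^+ 2) s.
    by rewrite -[leLHS](expectation_cst ep); apply: thle => s'; exact: sqr_ge0.
  have T1 : T (fun s => (ln (Z s) < - ln 2 - 2 * x)%R%:R) s <= 1.
    by rewrite -[leRHS](expectation_cst ep); apply: thle => s'; case: (_ < _).
  have Vx : 0 <= V / x ^+ 2 by rewrite divr_ge0// sqr_ge0.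
  have eC : 0 < eps / C by rewrite divr_gt0.
  have eT : 0 <= eps / C * T (fun s => Z s ^+ 2) s by rewrite mulr_ge0// ltW.
  case: (boolP (good s)) => gs /=; last by rewrite (le_trans T1)//; lra.
  have [le_T|lt_T] := leP (T (fun s => Z s ^+ 2) s) (C / eps).
    rewrite addr0 (le_trans _ (_ : V / x ^+ 2 <= _))//; last by rewrite lerDl.
    apply: (ln_lower_tail ep Z0 _ x0 hx (hgood s gs) le_T); first by rewrite divr_gt0.
    rewrite (le_trans (resample_seq_variance p_ge0 sm_gt0 (enum E) s hc))//.
    by rewrite -cardE.
  apply: (le_trans T1); rewrite (le_trans (_ : 1 <= eps / C * T (fun s => Z s ^+ 2) s))//.
    by rewrite -ler_pdivrMl// invf_div mulr1 ltW.
  by rewrite lerDr addr0.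
apply: (le_trans (hle _ _ bnd)).
rewrite hD hD hcst hZ product_mean_resample_seq//.
by rewrite lerD2l -ler_pdivlMl ?divr_gt0// invf_div divfK// gt_eqF.
Qed.

End ConditionalLowerTail.

(** * Spin systems *)

Section Spins.
Context {R : realType} {N : nat}.
Implicit Types (sigma tau : {ffun 'I_N -> bool}) (i : 'I_N).

Local Notation fair := (fun _ : bool => 2^-1 : R).
Local Notation Esp := (@product_mean R 'I_N bool fair).
Local Notation sp := (@spin R N).

Lemma fair_ge0 (b : bool) : 0 <= fair b. Proof. by rewrite invr_ge0. Qed.
Lemma fair_sum : \sum_b fair b = 1.
Proof. by rewrite big_bool/=; field. Qed.

Lemma spin_mean_expectation : expectation_like Esp.
Proof. exact: product_mean_expectation fair_ge0 fair_sum. Qed.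

Lemma spin_meanE (f : {ffun 'I_N -> bool} -> R) :
  Esp f = (2 ^+ N)^-1 * \sum_sigma f sigma.
Proof.
rewrite /product_mean big_distrr/=; apply: eq_bigr => s _; congr (_ * _).
by rewrite /product_weight prodr_const card_ord exprVn.
Qed.

Lemma spin_sqr sigma i : sp sigma i * sp sigma i = 1.
Proof. by rewrite /spin -expr2 sqrr_sign. Qed.

Lemma normr_spin sigma i : `|sp sigma i| = 1.
Proof. exact: normr_sign. Qed.

Lemma spin_update_same sigma i b : sp (update sigma i b) i = (-1) ^+ b.
Proof. by rewrite /spin update_same. Qed.

Lemma spin_update_neq sigma i j b : j != i -> sp (update sigma i b) j = sp sigma j.
Proof. by move=> ne; rewrite /spin update_neq. Qed.

Lemma spin_mean_average i (f : {ffun 'I_N -> bool} -> R) :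
  Esp f = Esp (fun sigma => 2^-1 * (f (update sigma i true) + f (update sigma i false))).
Proof.
have s1 : \sum_(x | predT x) fair x = 1 by exact: fair_sum.
rewrite -(@product_mean_resample R _ bool fair predT _ i f) ?s1//.
congr product_mean; apply/funext => sigma.
by rewrite /resample /= /small_mean s1 invr1 mul1r big_bool/= -mulrDr.
Qed.

(** Only vanishing averages contribute: flipping one spin changes the sign. *)
Lemma spin_mean_odd i (f : {ffun 'I_N -> bool} -> R) :
  (forall sigma b, f (update sigma i b) = f sigma) ->
  Esp (fun sigma => sp sigma i * f sigma) = 0.
Proof.
move=> hf; rewrite (spin_mean_average i).
rewrite (_ : (fun sigma => _) = fun=> 0) ?(expectation_cst spin_mean_expectation)//.
by apply/funext => sigma; rewrite !hf !spin_update_same expr1 expr0 mulN1r mul1r addNr mulr0.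
Qed.

Context {E : finType} (a b : E -> 'I_N) (ab : forall e, a e != b e).

Definition edge_spin sigma (e : E) : R := sp sigma (a e) * sp sigma (b e).

(** The partition function divided by its mean when the couplings enter
    through t = tanh. *)
Definition reduced_partition (t : E -> R) : R :=
  Esp (fun sigma => \prod_e (1 + t e * edge_spin sigma e)).

Lemma norm_edge_spin sigma e : `|edge_spin sigma e| = 1.
Proof. by rewrite normrM !normr_spin mulr1. Qed.

Definition disjoint_edges (e e' : E) :=
  [&& a e != a e', a e != b e', b e != a e' & b e != b e'].

(** In a matching the edge spins are independent and symmetric. *)
Lemma reduced_partition_matching (t : E -> R) :
  (forall e e', e != e' -> t e != 0 -> t e' != 0 -> disjoint_edges e e') ->
  reduced_partition t = 1.
Proof.
move=> dis; rewrite /reduced_partition.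
have [_ hD hZ _] := spin_mean_expectation.
suff H l : uniq l -> Esp (fun sigma => \prod_(e <- l) (1 + t e * edge_spin sigma e)) = 1.
  by rewrite -[RHS](H _ (enum_uniq E)); congr product_mean; apply/funext => s; rewrite big_enum.
elim: l => [_|e l IH /= /andP[el ul]].
  rewrite -[RHS](expectation_cst spin_mean_expectation).
  by congr product_mean; apply/funext => s; rewrite big_nil.
have -> : (fun sigma => \prod_(e0 <- e :: l) (1 + t e0 * edge_spin sigma e0)) =
  (fun sigma => \prod_(e0 <- l) (1 + t e0 * edge_spin sigma e0) +
     t e * (sp sigma (a e) * (sp sigma (b e) *
        \prod_(e0 <- l) (1 + t e0 * edge_spin sigma e0)))).
  by apply/funext => s; rewrite big_cons /edge_spin; ring.
rewrite hD IH// hZ.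
have [->|te] := eqVneq (t e) 0; first by rewrite mul0r addr0.
rewrite (@spin_mean_odd (a e)) ?mulr0 ?addr0// => s c.
rewrite spin_update_neq 1?eq_sym//; congr (_ * _).
rewrite big_seq [RHS]big_seq; apply: eq_bigr => e' e'l.
have [->|te'] := eqVneq (t e') 0; first by rewrite !mul0r.
have ne : e != e' by apply: contraNneq el => ->.
have /and4P[h1 h2 _ _] := dis _ _ ne te te'.
by rewrite /edge_spin !spin_update_neq 1?eq_sym.
Qed.

(** Integrating out one spin turns lambda into lambda + lambda^2, that is,
    it lowers 1/lambda by at most one. *)
Lemma spin_mean_expR_sqr (l : seq 'I_N) (lambda : R) : uniq l -> 0 <= lambda ->
  (size l)%:R * lambda < 1 ->
  Esp (fun sigma => expR (lambda / 2 * (\sum_(i <- l) sp sigma i) ^+ 2)) <=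
  expR (2^-1 * ((size l)%:R * lambda / (1 - (size l)%:R * lambda))).
Proof.
have [_ hD hZ hle] := spin_mean_expectation.
have hc := expectation_cst spin_mean_expectation.
elim: l lambda => [|i l IH] lambda /=.
  move=> _ _ _; rewrite !mul0r mulr0 expR0 -[leRHS]hc; apply: hle => s.
  by rewrite big_nil expr0n/= mulr0 expR0.
move=> /andP[il ul] l0; set k := (size l)%:R : R.
rewrite -(addn1 (size l)) natrD -/k => kl1.
have k0 : 0 <= k by rewrite ler0n.
set mu := lambda + lambda ^+ 2.
have mu0 : 0 <= mu by rewrite addr_ge0// sqr_ge0.
have lt1 : lambda < 1 by nra.
have mul : mu * (1 - lambda) <= lambda.
  have -> : mu * (1 - lambda) = lambda - lambda * lambda ^+ 2 by rewrite /mu; ring.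
  by rewrite lerBlDr lerDl mulr_ge0// sqr_ge0.
have kmu : k * mu < 1.
  rewrite -(ltr_pM2r (_ : 0 < 1 - lambda)); last by rewrite subr_gt0.
  by rewrite mul1r -mulrA (le_lt_trans (ler_wpM2l k0 mul))//; nra.
apply: (@le_trans _ _ (Esp (fun sigma => expR (lambda / 2) *
    expR (mu / 2 * (\sum_(j <- l) sp sigma j) ^+ 2)))).
  rewrite (spin_mean_average i); apply: hle => s.
  rewrite !big_cons !spin_update_same expr1 expr0.
  set Y := \sum_(j <- l) sp s j.
  have hY c : \sum_(j <- l) sp (update s i c) j = Y.
    rewrite /Y big_seq [RHS]big_seq; apply: eq_bigr => j jl.
    by rewrite spin_update_neq//; apply: contraNneq il => <-.
  rewrite !hY.
  have -> : 2^-1 * (expR (lambda / 2 * (-1 + Y) ^+ 2) + expR (lambda / 2 * (1 + Y) ^+ 2))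
     = expR (lambda / 2) * expR (lambda / 2 * Y ^+ 2) * cosh (lambda * Y).
    have -> : lambda / 2 * (-1 + Y) ^+ 2 = lambda / 2 + lambda / 2 * Y ^+ 2 + (- (lambda * Y)).
      by field.
    have -> : lambda / 2 * (1 + Y) ^+ 2 = lambda / 2 + lambda / 2 * Y ^+ 2 + lambda * Y.
      by field.
    by rewrite !expRD /cosh; field.
  rewrite -mulrA ler_pM2l ?expR_gt0//.
  apply: (le_trans (ler_wpM2l (expR_ge0 _) (cosh_le_expR _))).
  by rewrite -expRD ler_expR /mu le_eqVlt; apply/orP; left; apply/eqP; field.
rewrite hZ (le_trans (ler_wpM2l (expR_ge0 _) (IH mu ul mu0 kmu)))//.
rewrite -expRD ler_expR -/k -lerBrDl.
have d1 : 0 < 1 - (k + 1) * lambda by rewrite subr_gt0.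
have d2 : 0 < 1 - k * mu by rewrite subr_gt0.
rewrite mulrC ler_pdivrMr//.
have : k * mu / (1 - k * mu) <= k * lambda / (1 - (k + 1) * lambda).
  rewrite ler_pdivrMr// mulrAC ler_pdivlMr//.
  have := ler_wpM2l k0 mul; nra.
have : lambda <= lambda / (1 - (k + 1) * lambda).
  by rewrite ler_pdivlMr// ler_piMr// lerBlDr lerDl mulr_ge0// addr_ge0.
have -> : (k + 1) * lambda / (1 - (k + 1) * lambda) =
  k * lambda / (1 - (k + 1) * lambda) + lambda / (1 - (k + 1) * lambda).
  by rewrite -mulrDl; congr (_ / _); ring.
by lra.
Qed.

Context (complete : forall sigma,
  \sum_e edge_spin sigma e <= (\sum_i sp sigma i) ^+ 2 / 2).

(** The product is at most exp (q (sum of the edge spins)), and on the complete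
    graph the exponent is quadratic in the magnetization, whose exponential moment
    is Gaussian-like. *)
Lemma overlap_mean_le (q r : R) : 0 <= q -> N%:R * q <= r -> r < 1 -> q <= 1 ->
  Esp (fun tau => \prod_e (1 + q * edge_spin tau e)) <= expR (2^-1 * (r / (1 - r))).
Proof.
move=> q0 qr r1 q1; have [_ hD hZ hle] := spin_mean_expectation.
have r0 : 0 <= r by rewrite (le_trans _ qr)// mulr_ge0.
apply: (@le_trans _ _ (Esp (fun tau => expR (q / 2 * (\sum_(i <- enum 'I_N) sp tau i) ^+ 2)))).
  apply: hle => tau; rewrite big_enum/=.
  have h : q / 2 * (\sum_i sp tau i) ^+ 2 = q * ((\sum_i sp tau i) ^+ 2 / 2).
    by rewrite mulrAC mulrA.
  apply: (@le_trans _ _ (expR (\sum_e q * edge_spin tau e))).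
    rewrite expR_sum; apply: ler_prod => e _; rewrite expR_ge1Dx andbT.
    have := norm_edge_spin tau e; rewrite -lerBlDl sub0r => h1.
    by rewrite lerNl (le_trans (ler_norm _))// normrN normrM h1 mulr1 ger0_norm.
  by rewrite ler_expR h -big_distrr/= ler_wpM2l.
apply: (le_trans (spin_mean_expR_sqr _ _ _)); rewrite ?enum_uniq//.
  by rewrite size_enum_ord (le_lt_trans qr).
rewrite size_enum_ord ler_expR ler_pM2l ?invr_gt0//.
rewrite ler_pdivrMr; last by rewrite subr_gt0 (le_lt_trans qr).
have d1 : 0 < 1 - r by rewrite subr_gt0.
rewrite mulrAC ler_pdivlMr//; nra.
Qed.

(** Two replicas of the spins only interact through their product. *)
Lemma replica_mean (q : R) :
  Esp (fun sigma => Esp (fun sigma' =>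
     \prod_e (1 + q * (edge_spin sigma e * edge_spin sigma' e)))) =
  Esp (fun tau => \prod_e (1 + q * edge_spin tau e)).
Proof.
rewrite -[RHS](expectation_cst spin_mean_expectation).
congr product_mean; apply/funext => sigma; rewrite !spin_meanE; congr (_ * _).
rewrite (reindex_inj (h := fun tau : {ffun 'I_N -> bool} =>
   [ffun i => sigma i (+) tau i])) /=; last first.
  apply: can_inj (fun tau : {ffun 'I_N -> bool} => [ffun i => sigma i (+) tau i]) _.
  by move=> tau; apply/ffunP => i; rewrite !ffunE addKb.
apply: eq_bigr => tau _; apply: eq_bigr => e _; congr (1 + q * _).
have h i : sp [ffun i => sigma i (+) tau i] i = sp sigma i * sp tau i.
  by rewrite /spin ffunE signr_addb.
rewrite /edge_spin !h.
transitivity ((sp sigma (a e) * sp sigma (a e)) * (sp sigma (b e) * sp sigma (b e)) *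
  (sp tau (a e) * sp tau (b e))); first by ring.
by rewrite !spin_sqr !mul1r.
Qed.

End Spins.

Lemma product_mean_exchange {R : realType} {E S E' S' : finType}
    (p : S -> R) (p' : S' -> R) (F : {ffun E -> S} -> {ffun E' -> S'} -> R) :
  product_mean p (fun s => product_mean p' (F s)) =
  product_mean p' (fun s' => product_mean p (fun s => F s s')).
Proof.
rewrite /product_mean; under eq_bigr do rewrite big_distrr/=.
rewrite exchange_big/=; apply: eq_bigr => s' _; rewrite big_distrr/=.
by apply: eq_bigr => s _; rewrite mulrCA.
Qed.

(** * The reduced partition function with finitely many coupling values *)

Section FiniteModel.
Context {R : realType} {N : nat} {E S : finType} (a b : E -> 'I_N).
Context (ab : forall e, a e != b e).
Context (complete : forall sigma : {ffun 'I_N -> bool},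
  \sum_e edge_spin a b sigma e <= (\sum_i @spin R N sigma i) ^+ 2 / 2).
Context (p : S -> R) (p_ge0 : forall x, 0 <= p x) (p_sum : \sum_x p x = 1).
Context (v : S -> R).
Context (odd_mean : \sum_x p x * tanh (v x) = 0).

Local Notation Esp := (@product_mean R 'I_N bool (fun=> 2^-1)).

Definition random_partition (s : {ffun E -> S}) : R :=
  reduced_partition a b (fun e => tanh (v (s e))).

Lemma one_add_tanh_gt0 (x eps : R) : `|eps| = 1 -> 0 < 1 + tanh x * eps.
Proof.
move=> he; rewrite -ltrBlDl sub0r ltrNl (le_lt_trans (ler_norm _))//.
by rewrite normrN normrM he mulr1 tanh_lt1.
Qed.

Lemma one_add_tanh_le (x y : R) (c : bool) :
  1 + tanh x * (-1) ^+ c <= expR (2 * `|x - y|) * (1 + tanh y * (-1) ^+ c).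
Proof.
have cx := cosh_gt0 x; have cy := cosh_gt0 y.
rewrite ![tanh _ * _]mulrC.
have h z : 1 + (-1) ^+ c * tanh z = expR ((-1) ^+ c * z) / cosh z :> R.
  by rewrite expR_pm1 mulrAC divff ?mul1r// gt_eqF//; exact: cosh_gt0.
rewrite !h mulrA ler_pdivrMr// mulrAC ler_pdivlMr//.
have -> : expR (2 * `|x - y|) * expR ((-1) ^+ c * y) * cosh x =
    expR `|x - y| * expR ((-1) ^+ c * y) * (expR `|y - x| * cosh x).
  have -> : 2 * `|x - y| = `|x - y| + `|y - x| by rewrite (distrC y); ring.
  by rewrite expRD; ring.
apply: ler_pM; [exact: expR_ge0|exact: ltW| |exact: cosh_le_shift].
rewrite -expRD ler_expR -lerBlDr -mulrBr (le_trans (ler_norm _))//.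
by rewrite normrM normr_sign mul1r.
Qed.

Lemma spin_mean_gt0 (f : {ffun 'I_N -> bool} -> R) :
  (forall s, 0 < f s) -> 0 < Esp f.
Proof.
move=> f0; rewrite spin_meanE mulr_gt0 ?invr_gt0 ?exprn_gt0//.
rewrite (bigD1 [ffun=> true])//= ltr_pwDl//.
by apply: sumr_ge0 => s _; rewrite ltW.
Qed.

Lemma random_partition_gt0 s : 0 < random_partition s.
Proof.
apply: spin_mean_gt0 => sigma; apply: prodr_gt0 => e _.
by apply: one_add_tanh_gt0; exact: norm_edge_spin.
Qed.

(** Changing the argument of tanh from x to y multiplies the factor
    1 + tanh x eps by at most exp (2 |x - y|), for either sign eps. *)
Lemma random_partition_update_le s e x :
  random_partition s <= expR (2 * `|v (s e) - v x|) * random_partition (update s e x).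
Proof.
have [_ _ hZ hle] := @spin_mean_expectation R N.
rewrite /random_partition /reduced_partition -hZ; apply: hle => sigma.
rewrite (bigD1 e)//= [in leRHS](bigD1 e)//= update_same [leRHS]mulrA.
rewrite (eq_bigr (fun e' => 1 + tanh (v (update s e x e')) * edge_spin a b sigma e')); last first.
  by move=> e' ne; rewrite update_neq.
apply: ler_wpM2r.
  apply: prodr_ge0 => e' _; apply: ltW; apply: one_add_tanh_gt0.
  exact: norm_edge_spin.
by rewrite /edge_spin /spin -signr_addb one_add_tanh_le.
Qed.

Lemma ln_random_partition_increments (sm : pred S) :
  increments_bounded sm (fun x => 2 * `|v x|) (fun s => ln (random_partition s)).
Proof.
move=> s e x _ _.
have bnd s1 s2 x1 : s2 = update s1 e x1 ->
    ln (random_partition s1) - ln (random_partition s2) <=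
    2 * `|v (s1 e) - v x1|.
  move=> ->; rewrite lerBlDr -[X in _ <= X + _]expRK.
  have h1 := random_partition_gt0 (update s1 e x1).
  have h2 := random_partition_gt0 s1.
  have h3 : 0 < expR (2 * `|v (s1 e) - v x1|) * random_partition (update s1 e x1).
    by rewrite mulr_gt0// expR_gt0.
  by rewrite -lnM ?posrE ?expR_gt0// ler_ln ?posrE// random_partition_update_le.
have tri : 2 * `|v (s e) - v x| <= 2 * `|v (s e)| + 2 * `|v x|.
  by rewrite -mulrDr ler_wpM2l// ler_normB.
rewrite ler_norml; apply/andP; split.
  rewrite lerNl opprB (le_trans (bnd _ s (s e) _))//.
    by rewrite update_update update_id.
  by rewrite update_same distrC.
exact: le_trans (bnd _ _ x erefl) tri.
Qed.

Lemma random_partition_mean : product_mean p random_partition = 1.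
Proof.
rewrite /random_partition /reduced_partition product_mean_exchange.
rewrite -[RHS](expectation_cst (@spin_mean_expectation R N)).
congr product_mean; apply/funext => sigma.
rewrite (product_mean_prod p (fun e x => 1 + tanh (v x) * edge_spin a b sigma e)).
rewrite big1// => e _; under eq_bigr do rewrite mulrDr mulr1 mulrA.
by rewrite big_split/= p_sum -big_distrl/= odd_mean mul0r addr0.
Qed.

(** Being odd kills the terms of degree one in each coupling, so that the
    second moment only sees the mean of tanh^2. *)
Lemma random_partition_second_moment (r : R) :
  N%:R * (\sum_x p x * tanh (v x) ^+ 2) <= r -> r < 1 ->
  product_mean p (fun s => random_partition s ^+ 2) <= expR (2^-1 * (r / (1 - r))).
Proof.
move=> qr r1; set q := \sum_x p x * tanh (v x) ^+ 2 in qr.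
have q0 : 0 <= q by apply: sumr_ge0 => x _; rewrite mulr_ge0// sqr_ge0.
have q1 : q <= 1.
  rewrite -p_sum; apply: ler_sum => x _; rewrite ler_piMr//.
  by rewrite -real_normK ?num_real// expr_le1// ltW// tanh_lt1.
apply: le_trans (overlap_mean_le complete q0 qr r1 q1).
have [_ _ hZ _] := @spin_mean_expectation R N.
have -> : (fun s => random_partition s ^+ 2) = (fun s =>
    Esp (fun sigma => Esp (fun sigma' =>
     \prod_e ((1 + tanh (v (s e)) * edge_spin a b sigma e) *
             (1 + tanh (v (s e)) * edge_spin a b sigma' e))))).
  apply/funext => s; rewrite expr2 {1}/random_partition /reduced_partition mulrC -hZ.
  congr product_mean; apply/funext => sigma; rewrite mulrC -hZ.
  by congr product_mean; apply/funext => sigma'; rewrite big_split.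
rewrite product_mean_exchange -replica_mean le_eqVlt; apply/orP; left; apply/eqP.
congr product_mean; apply/funext => sigma; rewrite product_mean_exchange.
congr product_mean; apply/funext => sigma'.
rewrite (product_mean_prod p (fun e x => (1 + tanh (v x) * edge_spin a b sigma e) *
             (1 + tanh (v x) * edge_spin a b sigma' e))).
apply: eq_bigr => e _.
transitivity (\sum_x p x + (\sum_x p x * tanh (v x)) *
    (edge_spin a b sigma e + edge_spin a b sigma' e) +
   q * (edge_spin a b sigma e * edge_spin a b sigma' e)).
  by rewrite /q !big_distrl/= -!big_split/=; apply: eq_bigr => x _; ring.
by rewrite p_sum odd_mean mul0r addr0.
Qed.

(** Markov's inequality, the mean being 1. *)
Lemma random_partition_upper_tail (y : R) :
  product_mean p (fun s => (y < ln (random_partition s))%R%:R) <= expR (- y).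
Proof.
have [_ _ hZ hle] := product_mean_expectation p_ge0 p_sum (E := E).
rewrite -[leRHS]mulr1 -[X in _ <= _ * X]random_partition_mean -hZ; apply: hle => s.
have z0 := random_partition_gt0 s.
case: ltP => h; last by rewrite mulr_ge0// ?expR_ge0// ltW.
rewrite -[X in _ * X]lnK ?posrE// -expRD -expR0 ler_expR; lra.
Qed.

Context (sm : pred S) (sm_gt0 : 0 < \sum_(x | sm x) p x).
Context (odd_small : \sum_(x | sm x) p x * tanh (v x) = 0).

(** The favourable configurations: the large couplings sit on pairwise disjoint
    edges. *)
Definition large_matching : pred {ffun E -> S} := [pred s : {ffun E -> S} |
  [forall e, forall e', [&& e != e', ~~ sm (s e) & ~~ sm (s e')] ==>
     disjoint_edges a b e e']].

(** Averaging the small couplings erases their edges by oddness, and what is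
    left lives on a matching. *)
Lemma resample_random_partition s : large_matching s ->
  resample_seq p sm (enum E) random_partition s = 1.
Proof.
move=> /forallP ms.
have ep := resample_seq_expectation p_ge0 sm_gt0 (enum E) s.
have -> : resample_seq p sm (enum E) random_partition s = reduced_partition a b
    (fun e => if sm (s e) then 0 else tanh (v (s e))).
  transitivity (Esp (fun sigma => resample_seq p sm (enum E)
      (fun s => \prod_e (1 + tanh (v (s e)) * edge_spin a b sigma e)) s)).
    have [_ hD hZ _] := ep.
    have lin (I : Type) (r : seq I) (F : I -> {ffun E -> S} -> R) :
        resample_seq p sm (enum E) (fun s => \sum_(i <- r) F i s) s =
        \sum_(i <- r) resample_seq p sm (enum E) (F i) s.
      elim: r => [|i r IH].
        rewrite big_nil -[RHS](expectation_cst ep); congr (resample_seq _ _ _ _ s).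
        by apply/funext => s'; rewrite big_nil.
      rewrite big_cons -IH -hD; congr (resample_seq _ _ _ _ s).
      by apply/funext => s'; rewrite big_cons.
    rewrite /random_partition /reduced_partition /product_mean lin.
    by apply: eq_bigr => sigma _; rewrite hZ.
  congr product_mean; apply/funext => sigma.
  rewrite (resample_seq_prod p_ge0 sm_gt0 (fun e x => 1 + tanh (v x) * edge_spin a b sigma e)) ?enum_uniq//.
  apply: eq_bigr => e _; rewrite mem_enum/=; case: ifP => // _.
  rewrite mul0r addr0 /small_mean [X in _ * X](eq_bigr (fun x => p x + (p x * tanh (v x)) * edge_spin a b sigma e)).
    by rewrite big_split/= -big_distrl/= odd_small mul0r addr0 mulVf// gt_eqF.
  by move=> x _; ring.
apply: reduced_partition_matching => // e e' ne.
case: ifP => [|/negbT h1]; first by rewrite eqxx.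
case: ifP => [|/negbT h2 _ _]; first by rewrite eqxx.
by have /forallP/(_ e')/implyP := ms e; apply; rewrite ne h1.
Qed.

(** Two given edges are both large with the square of the probability of one
    being large, and few pairs of edges share a vertex. *)
Lemma large_matching_prob (K : R) :
  \sum_e \sum_e' (~~ disjoint_edges a b e e')%:R <= K ->
  product_mean p (fun s => (~~ large_matching s)%:R) <=
  K * (\sum_(x | ~~ sm x) p x) ^+ 2.
Proof.
move=> hK; set rho := \sum_(x | ~~ sm x) p x.
have [_ hD hZ hle] := product_mean_expectation p_ge0 p_sum (E := E).
pose B e e' s : R := (~~ disjoint_edges a b e e')%:R *
  ((e != e')%:R * ((~~ sm (s e))%:R * (~~ sm (s e'))%:R)).
have B0 e e' s : 0 <= B e e' s by rewrite !mulr_ge0.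
apply: (@le_trans _ _ (product_mean p (fun s => \sum_e \sum_e' B e e' s))).
  apply: hle => s; case: (boolP (large_matching s)) => /= [_|].
    by apply: sumr_ge0 => e _; apply: sumr_ge0.
  rewrite negb_forall => /existsP[e]; rewrite negb_forall => /existsP[e'].
  rewrite negb_imply => /andP[/and3P[ne h1 h2] h3].
  rewrite (bigD1 e)//= (bigD1 e')//= /B ne h1 h2 h3 !mul1r -addrA lerDl addr_ge0//.
    by apply: sumr_ge0 => i _; rewrite !mulr_ge0.
  by apply: sumr_ge0 => e1 _; apply: sumr_ge0 => e2 _; rewrite !mulr_ge0.
have rho0 : 0 <= rho by apply: sumr_ge0.
have -> : product_mean p (fun s => \sum_e \sum_e' B e e' s) =
   \sum_e \sum_e' product_mean p (B e e').
  rewrite /product_mean; under eq_bigr do rewrite big_distrr/=.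
  rewrite exchange_big/=; apply: eq_bigr => e _.
  under eq_bigr do rewrite big_distrr/=.
  by rewrite exchange_big.
apply: (@le_trans _ _ (\sum_e \sum_e' (~~ disjoint_edges a b e e')%:R * rho ^+ 2)); last first.
  under eq_bigr do rewrite -big_distrl/=.
  by rewrite -big_distrl/= ler_wpM2r// sqr_ge0.
apply: ler_sum => e _; apply: ler_sum => e' _; rewrite hZ ler_wpM2l//.
have [->|ne] := eqVneq e e'.
  rewrite (_ : (fun a => _) = fun=> 0) ?(expectation_cst (product_mean_expectation p_ge0 p_sum))//.
    exact: sqr_ge0.
  by apply/funext => s; rewrite mul0r.
pose F e0 x : R := if (e0 == e) || (e0 == e') then (~~ sm x)%:R else 1.
rewrite (_ : (fun s : {ffun E -> S} => _) = fun s : {ffun E -> S} => \prod_e0 F e0 (s e0)); last first.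
  apply/funext => s; rewrite mul1r (bigD1 e)//= (bigD1 e')/= 1?eq_sym//.
  rewrite big1 ?mulr1; last by move=> e0 /andP[/negPf h1 /negPf h2]; rewrite /F h1 h2.
  by rewrite /F !eqxx orbT.
rewrite product_mean_prod (bigD1 e)//= (bigD1 e')/= 1?eq_sym//.
rewrite [X in _ * (_ * X)]big1 ?mulr1; last first.
  move=> e0 /andP[/negPf h1 /negPf h2]; rewrite /F h1 h2/=.
  by under eq_bigr do rewrite mulr1.
rewrite expr2 /F !eqxx orbT /= ler_pM// ?sumr_ge0//;
  try by move=> x _; rewrite mulr_ge0.
all: by rewrite /rho [leRHS]big_mkcond/=; apply: ler_sum => x _; case: (sm x); rewrite ?mulr0 ?mulr1.
Qed.

(** V bounds the conditional variance of the logarithm given the large values;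
    the three errors are its Chebyshev bound, the probability that two large
    values share a vertex, and that of a large conditional second moment. *)
Lemma random_partition_lower_tail (K r eps x : R) :
  \sum_e \sum_e' (~~ disjoint_edges a b e e')%:R <= K ->
  N%:R * (\sum_x p x * tanh (v x) ^+ 2) <= r -> r < 1 -> 0 < eps -> 0 < x ->
  let V := #|E|%:R * (16 * small_mean p sm (fun y => v y ^+ 2)) in
  4 * (expR (2^-1 * (r / (1 - r))) / eps) * V < x ^+ 2 ->
  product_mean p (fun s => (ln (random_partition s) < - ln 2 - 2 * x)%R%:R) <=
  V / x ^+ 2 + K * (\sum_(x | ~~ sm x) p x) ^+ 2 + eps.
Proof.
move=> hK qr r1 e0 x0 V hV.
have sv : step_variance p sm (fun y => 2 * `|v y|) =
    16 * small_mean p sm (fun y => v y ^+ 2).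
  have [_ _ hZ _] := small_mean_expectation p_ge0 sm_gt0.
  rewrite /step_variance (_ : (fun y => _) = fun y => 4 * v y ^+ 2).
    by rewrite hZ; ring.
  by apply/funext => y; rewrite exprMn real_normK ?num_real//; ring.
rewrite /V -sv in hV *.
apply: (le_trans (product_mean_ln_lower_tail p_ge0 p_sum sm_gt0
  random_partition_gt0 (ln_random_partition_increments (sm := sm))
  resample_random_partition (expR_gt0 _) (random_partition_second_moment qr r1)
  e0 x0 hV)).
by rewrite lerD2r lerD2l large_matching_prob.
Qed.

End FiniteModel.

(** * Means of bounded measurable functions *)

Section Mean.
Context {R : realType} {d : measure_display} {T : measurableType d}.
Context (P : probability T R).
Implicit Types f g : T -> R.

Definition bounded_measurable f :=
  measurable_fun setT f /\ exists M : R, forall x, `|f x| <= M.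

Definition mean f : R := \int[P]_w f w.

Lemma bounded_measurable_integrable f : bounded_measurable f ->
  P.-integrable setT (EFin \o f).
Proof.
move=> [mf [M hM]].
apply: (le_integrable measurableT (g := EFin \o cst M)) => //.
- exact/measurable_EFinP.
- move=> x _ /=; rewrite lee_fin (le_trans (hM x))// ler_norm//.
- exact: finite_measure_integrable_cst.
Qed.

Lemma bounded_measurable_cst (c : R) : bounded_measurable (fun=> c).
Proof. by split=> //; exists `|c|. Qed.

Lemma bounded_measurableD f g : bounded_measurable f -> bounded_measurable g ->
  bounded_measurable (fun x => f x + g x).
Proof.
move=> [mf [M hM]] [mg [M' hM']]; split; first exact: measurable_funD.
by exists (M + M') => x; rewrite (le_trans (ler_normD _ _))// lerD.
Qed.

Lemma bounded_measurableM f g : bounded_measurable f -> bounded_measurable g ->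
  bounded_measurable (fun x => f x * g x).
Proof.
move=> [mf [M hM]] [mg [M' hM']]; split; first exact: measurable_funM.
by exists (M * M') => x; rewrite normrM ler_pM.
Qed.

Lemma bounded_measurableZ c f : bounded_measurable f ->
  bounded_measurable (fun x => c * f x).
Proof. by apply: bounded_measurableM; exact: bounded_measurable_cst. Qed.

Lemma bounded_measurableN f : bounded_measurable f ->
  bounded_measurable (fun x => - f x).
Proof.
move=> /(bounded_measurableZ (-1)); congr bounded_measurable.
by apply/funext => x; rewrite mulN1r.
Qed.

Lemma bounded_measurableB f g : bounded_measurable f -> bounded_measurable g ->
  bounded_measurable (fun x => f x - g x).
Proof. by move=> bf /bounded_measurableN; exact: bounded_measurableD. Qed.

Lemma bounded_measurable_indic (A : set T) : measurable A -> bounded_measurable \1_A.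
Proof.
move=> mA; split; first exact: measurable_indic.
by exists 1 => x; rewrite indicE; case: (_ \in _); rewrite ?normr1 ?normr0.
Qed.

Lemma bounded_measurable_pred (B : T -> bool) : measurable_fun setT B ->
  bounded_measurable (fun x => (B x)%:R).
Proof.
move=> mB; rewrite (_ : (fun x => _) = \1_([set x | B x])).
  apply: bounded_measurable_indic; rewrite -[X in measurable X]setTI.
  exact: (mB measurableT [set true]).
by apply/funext => x; rewrite indicE mem_setE.
Qed.

Lemma bounded_measurable_sum (I : Type) (r : seq I) (F : I -> T -> R) :
  (forall i, bounded_measurable (F i)) ->
  bounded_measurable (fun x => \sum_(i <- r) F i x).
Proof.
move=> bF; elim: r => [|i r IH].
  rewrite (_ : (fun x => _) = fun=> 0); first exact: bounded_measurable_cst.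
  by apply/funext => x; rewrite big_nil.
rewrite (_ : (fun x => _) = fun x => F i x + \sum_(i <- r) F i x).
  exact: bounded_measurableD.
by apply/funext => x; rewrite big_cons.
Qed.

Lemma mean_cst c : mean (fun=> c) = c.
Proof.
rewrite /mean Rintegral_cst// -[RHS]mulr1; congr (_ * _).
by rewrite -[RHS]/(fine 1%E); congr fine; exact: probability_setT.
Qed.

Lemma meanD f g : bounded_measurable f -> bounded_measurable g ->
  mean (fun x => f x + g x) = mean f + mean g.
Proof. by move=> bf bg; rewrite /mean RintegralD//; exact: bounded_measurable_integrable. Qed.

Lemma meanB f g : bounded_measurable f -> bounded_measurable g ->
  mean (fun x => f x - g x) = mean f - mean g.
Proof. by move=> bf bg; rewrite /mean RintegralB//; exact: bounded_measurable_integrable. Qed.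

Lemma meanZ c f : bounded_measurable f -> mean (fun x => c * f x) = c * mean f.
Proof. by move=> bf; rewrite /mean RintegralZl//; exact: bounded_measurable_integrable. Qed.

Lemma le_mean f g : bounded_measurable f -> bounded_measurable g ->
  (forall x, f x <= g x) -> mean f <= mean g.
Proof.
by move=> bf bg fg; apply: le_Rintegral => //; exact: bounded_measurable_integrable.
Qed.

Lemma mean_ge0 f : (forall x, 0 <= f x) -> 0 <= mean f.
Proof. by move=> f0; apply: Rintegral_ge0 => x _. Qed.

Lemma mean_dist f g h : bounded_measurable f -> bounded_measurable g ->
  bounded_measurable h -> (forall x, `|f x - g x| <= h x) ->
  `|mean f - mean g| <= mean h.
Proof.
move=> bf bg bh fgh; rewrite -meanB// ler_norml; apply/andP; split.
  rewrite lerNl -[leLHS]mulN1r -meanZ; last exact: bounded_measurableB.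
  apply: le_mean => // [|x]; first exact/bounded_measurableZ/bounded_measurableB.
  by rewrite mulN1r (le_trans _ (fgh x))// -normrN ler_norm.
apply: le_mean => // [|x]; first exact: bounded_measurableB.
by rewrite (le_trans _ (fgh x))// ler_norm.
Qed.

Lemma mean_norm_le f (M : R) : bounded_measurable f -> (forall x, `|f x| <= M) ->
  `|mean f| <= M.
Proof.
move=> bf hM; rewrite -[mean f]subr0 -(mean_cst 0) -[leRHS]mean_cst.
by apply: mean_dist => // [||x]; rewrite ?subr0//; exact: bounded_measurable_cst.
Qed.

Lemma mean_sum (I : Type) (r : seq I) (F : I -> T -> R) :
  (forall i, bounded_measurable (F i)) ->
  mean (fun x => \sum_(i <- r) F i x) = \sum_(i <- r) mean (F i).
Proof.
move=> bF; elim: r => [|i r IH].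
  rewrite big_nil -[RHS]mean_cst; congr mean.
  by apply/funext => x; rewrite big_nil.
rewrite big_cons -IH -meanD//; last exact: bounded_measurable_sum.
by congr mean; apply/funext => x; rewrite big_cons.
Qed.

Lemma mean_indic (A : set T) : measurable A -> mean \1_A = fine (P A).
Proof. by move=> mA; rewrite /mean /Rintegral integral_indic// setIT. Qed.

Lemma mean_pred (B : T -> bool) : measurable [set x | B x] ->
  mean (fun x => (B x)%:R) = fine (P [set x | B x]).
Proof.
move=> mB; rewrite -mean_indic//; congr mean.
by apply/funext => x; rewrite indicE mem_setE.
Qed.

End Mean.

Section MeanLaw.
Context {R : realType}.

Lemma bounded_measurable_comp {d : measure_display} {T : measurableType d}
    (X : T -> R) (h : R -> R) :
  measurable_fun setT X -> bounded_measurable h -> bounded_measurable (h \o X).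
Proof. by move=> mX [mh [M hM]]; split; [exact: measurableT_comp|exists M => x /=]. Qed.

Lemma mean_same_law {d d' : measure_display} {T : measurableType d}
    {T' : measurableType d'} (P : probability T R) (P' : probability T' R)
    (X : T -> R) (X' : T' -> R) (h : R -> R) :
  measurable_fun setT X -> measurable_fun setT X' -> same_law P X P' X' ->
  bounded_measurable h -> mean P (h \o X) = mean P' (h \o X').
Proof.
move=> mX mX' XX' bh.
have bX := bounded_measurable_integrable P (bounded_measurable_comp mX bh).
have bX' := bounded_measurable_integrable P' (bounded_measurable_comp mX' bh).
have mh : measurable_fun setT (EFin \o h) by apply/measurable_EFinP; have [] := bh.
rewrite /mean /Rintegral; congr fine.
have := @integral_pushforward _ _ _ _ _ X mX P setT (EFin \o h) mh.
rewrite preimage_setT => /(_ bX measurableT) <-.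
have := @integral_pushforward _ _ _ _ _ X' mX' P' setT (EFin \o h) mh.
rewrite preimage_setT => /(_ bX' measurableT) <-.
apply: eq_measure_integral => A mA _; exact: XX'.
Qed.

Lemma mean_fubini {d d' : measure_display} {T : measurableType d}
    {T' : measurableType d'} (P : probability T R) (P' : probability T' R)
    (f : T * T' -> R) (M : R) :
  measurable_fun setT f -> (forall z, 0 <= f z) -> (forall z, f z <= M) ->
  bounded_measurable (fun x => mean P' (fun y => f (x, y))) /\
  mean P (fun x => mean P' (fun y => f (x, y))) =
  mean P' (fun y => mean P (fun x => f (x, y))).
Proof.
move=> mf f0 fM.
have mF : measurable_fun setT (EFin \o f) by exact/measurable_EFinP.
have F0 z : (0 <= (EFin \o f) z)%E by rewrite lee_fin.
have bx x : bounded_measurable (fun y => f (x, y)).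
  by split; [exact: measurableT_comp|exists M => y; rewrite ger0_norm].
have by_ y : bounded_measurable (fun x => f (x, y)).
  by split; [exact: measurableT_comp|exists M => x; rewrite ger0_norm].
have h1 x : (\int[P']_y (f (x, y))%:E)%E = (mean P' (fun y => f (x, y)))%:E.
  by rewrite /mean /Rintegral fineK//; exact/integrable_fin_num/bounded_measurable_integrable.
have h2 y : (\int[P]_x (f (x, y))%:E)%E = (mean P (fun x => f (x, y)))%:E.
  by rewrite /mean /Rintegral fineK//; exact/integrable_fin_num/bounded_measurable_integrable.
split.
  split; last first.
    exists M => x; apply: mean_norm_le => // y; first by rewrite ger0_norm.
  have := @measurable_fun_fubini_tonelli_F _ _ _ _ _ P' _ mF F0.
  rewrite (_ : fubini_F _ _ = EFin \o (fun x => mean P' (fun y => f (x, y)))).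
    by move/measurable_EFinP.
  by apply/funext => x; rewrite /fubini_F h1.
rewrite {1}/mean /Rintegral [in RHS]/mean /Rintegral; congr fine.
under eq_integral do rewrite -h1.
under [RHS]eq_integral do rewrite -h2.
exact: (@fubini_tonelli _ _ _ _ _ P P' _ mF F0).
Qed.

End MeanLaw.

(** * Polynomial approximation *)

Section Bernstein.
Context {R : realType}.

Lemma heine_segment (F : R -> R) (eps : R) : continuous F -> 0 < eps ->
  exists2 delta, 0 < delta & forall x y, 0 <= x <= 1 -> `|x - y| <= delta ->
    `|F x - F y| <= eps.
Proof.
move=> cF e0; have := @segment_compact R 0 1.
rewrite compact_near_coveringP => /(_ R (0 : R)^'+
  (fun delta x => forall y, `|x - y| <= delta -> `|F x - F y| <= eps)) h.
have {h} : \forall delta \near (0 : R)^'+, `[0, 1]%classic `<=`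
    (fun x => forall y, `|x - y| <= delta -> `|F x - F y| <= eps).
  apply: h => x _.
  have e2 : 0 < eps / 2 by rewrite divr_gt0.
  have [r /= r0 hr] := (iffLR (cvgrPdist_lt _ _) (cF x)) _ e2.
  have r2 : 0 < r / 2 by rewrite divr_gt0.
  exists (ball x (r / 2), [set delta | delta < r / 2]).
    by split; [exact: nbhsx_ballx|exact: nbhs_right_lt].
  move=> [x' delta] /= [xx' dr] y x'y.
  have h1 : `|F x - F x'| < eps / 2.
    by apply: hr; rewrite /ball_ /= (lt_le_trans xx')// ler_piMr// ?ltW//; lra.
  have h2 : `|F x - F y| < eps / 2.
    apply: hr; rewrite /= -(subrKA x') (le_lt_trans (ler_normD _ _))//.
    by move: xx'; rewrite /ball/= /ball_ => xx'; have := le_lt_trans x'y dr; lra.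
  rewrite -(subrKA (F x)) (le_trans (ler_normD _ _))// (distrC _ (F x)).
  by lra.
move=> near0; have [r /= r0 hr] := near0.
exists (r / 2) => [|x y x01 xy]; first by rewrite divr_gt0.
have rr : ball_ (fun x : R => `|x|) 0 r (r / 2).
  by rewrite /ball_ /= sub0r normrN ger0_norm ?ltW//; lra.
have r2 : 0 < r / 2 by rewrite divr_gt0.
apply: (hr _ rr r2 x _ _ xy).
by rewrite /= in_itv.
Qed.

Lemma product_mean_sum_sqr {E S : finType} (p h : S -> R) :
  \sum_x p x = 1 -> \sum_x p x * h x = 0 ->
  product_mean p (fun s : {ffun E -> S} => (\sum_e h (s e)) ^+ 2) =
  #|E|%:R * \sum_x p x * h x ^+ 2.
Proof.
move=> p1 h0.
have -> : (fun s : {ffun E -> S} => (\sum_e h (s e)) ^+ 2) =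
    (fun s => \sum_e \sum_e' \prod_e0 ((if e0 == e then h (s e0) else 1) *
       (if e0 == e' then h (s e0) else 1))).
  apply/funext => s; rewrite expr2 big_distrl/=; apply: eq_bigr => e _.
  rewrite big_distrr/=; apply: eq_bigr => e' _.
  rewrite big_split/= -!big_mkcond/= !big_pred1_eq//.
rewrite /product_mean; under eq_bigr do rewrite big_distrr/=.
rewrite exchange_big/=.
transitivity (\sum_(e : E) \sum_x p x * h x ^+ 2); last first.
  by rewrite sumr_const mulr_natl.
apply: eq_bigr => e _.
under eq_bigr do rewrite big_distrr/=.
rewrite exchange_big/= (bigD1 e)//= [X in _ + X]big1 ?addr0 => [|e' ne].
  rewrite -/(product_mean p _) (product_mean_prod p (fun e0 x =>
    (if e0 == e then h x else 1) * (if e0 == e then h x else 1))).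
  rewrite (bigD1 e)//= eqxx [X in _ * X]big1 ?mulr1 => [|e0 /negPf ->].
    by apply: eq_bigr => x _; rewrite expr2.
  by under eq_bigr do rewrite !mulr1.
rewrite -/(product_mean p _) (product_mean_prod p (fun e0 x =>
    (if e0 == e then h x else 1) * (if e0 == e' then h x else 1))).
rewrite (bigD1 e)//= eqxx eq_sym (negPf ne).
by under eq_bigr do rewrite mulr1; rewrite h0 mul0r.
Qed.

Definition bernoulli_weight (x : R) (b : bool) : R := if b then x else 1 - x.

(** The Bernstein polynomial of F at x: the mean of F at the frequency of
    successes in n Bernoulli trials of parameter x. *)
Definition bernstein (F : R -> R) (n : nat) (x : R) : R :=
  product_mean (bernoulli_weight x)
    (fun s : {ffun 'I_n -> bool} => F ((\sum_i (s i)%:R) / n%:R)).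

Lemma bernstein_approx (F : R -> R) (M eps : R) : continuous F ->
  (forall x, `|F x| <= M) -> 0 < eps ->
  exists n, forall x, 0 <= x <= 1 -> `|F x - bernstein F n x| <= eps.
Proof.
move=> cF FM e0; have e2 : 0 < eps / 2 by rewrite divr_gt0.
have [delta d0 hd] := heine_segment cF e2.
have M0 : 0 <= M by rewrite (le_trans _ (FM 0)).
pose c := 2 * M / delta ^+ 2.
have c0 : 0 <= c by rewrite divr_ge0 ?sqr_ge0// mulr_ge0.
have [n hn] : exists n : nat, c / (eps / 2) < n.+1%:R.
  exists (Num.bound (c / (eps / 2))).
  apply: (lt_trans (archi_boundP _)); last by rewrite ltr_nat.
  by rewrite divr_ge0// ltW.
exists n.+1 => x /andP[x0 x1].
set w := bernoulli_weight x.
have w0 b : 0 <= w b by rewrite /w /bernoulli_weight; case: b; rewrite ?subr_ge0.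
have w1 : \sum_b w b = 1 by rewrite big_bool/= addrC subrK.
have [_ hD hZ hle] := product_mean_expectation w0 w1 (E := 'I_n.+1).
have hc := expectation_cst (product_mean_expectation w0 w1 (E := 'I_n.+1)).
have nn : n.+1%:R != 0 :> R by rewrite pnatr_eq0.
pose f (s : {ffun 'I_n.+1 -> bool}) : R := (\sum_i (s i)%:R) / n.+1%:R.
have var : product_mean w (fun s => (x - f s) ^+ 2) <= n.+1%:R^-1.
  have -> : (fun s => (x - f s) ^+ 2) = (fun s : {ffun 'I_n.+1 -> bool} =>
      n.+1%:R^-1 ^+ 2 * (\sum_i (fun b : bool => x - b%:R) (s i)) ^+ 2).
    apply/funext => s; rewrite -exprMn; congr (_ ^+ 2).
    rewrite big_split/= sumr_const card_ord sumrN /f mulrBr -[x *+ _]mulr_natl mulrA mulVf//.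
    by rewrite mul1r mulrC.
  rewrite hZ (product_mean_sum_sqr (h := fun b : bool => x - b%:R))//; last first.
    by rewrite big_bool/= /w/=; ring.
  rewrite card_ord expr2 -!mulrA [X in _ * X](mulrA) mulVf// mul1r.
  rewrite ler_piMr ?invr_ge0//.
  by rewrite big_bool/= /w/=; nra.
have key : product_mean w (fun s => `|F x - F (f s)|) <= eps.
  apply: (@le_trans _ _ (product_mean w (fun s => eps / 2 + c * (x - f s) ^+ 2))).
    apply: hle => s.
    have [close|far] := leP `|x - f s| delta.
      rewrite (le_trans (hd _ _ _ close)) ?x0//.
      by rewrite lerDl mulr_ge0// sqr_ge0.
    rewrite (le_trans (ler_normB _ _))// -lerBlDl.
    apply: (@le_trans _ _ (2 * M)); first by have := FM x; have := FM (f s); lra.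
    rewrite /c mulrAC ler_pdivlMr ?exprn_gt0//.
    rewrite ler_wpM2l ?mulr_ge0// -[leRHS]real_normK ?num_real//.
    by rewrite ler_sqr ?nnegrE ?ltW// (lt_trans d0).
  rewrite hD hc hZ.
  have : c * product_mean w (fun s => (x - f s) ^+ 2) <= eps / 2.
    rewrite (le_trans (ler_wpM2l c0 var))// ler_pdivrMr//.
    by rewrite mulrC -ler_pdivrMr// ltW.
  lra.
apply: le_trans key.
have -> : F x - bernstein F n.+1 x = product_mean w (fun s => F x + -1 * F (f s)).
  by rewrite hD hc hZ mulN1r.
rewrite ler_norml; apply/andP; split.
  rewrite lerNl -[leLHS]mulN1r -hZ; apply: hle => s; rewrite !mulN1r.
  by rewrite -[leRHS]normrN ler_norm.
by apply: hle => s; rewrite mulN1r ler_norm.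
Qed.

End Bernstein.

(** * Lévy's continuity theorem *)

Section Dominated.
Context {R : realType} {d : measure_display} {T : measurableType d}.
Context (P : probability T R).

Lemma mean_dominated (f_ : nat -> T -> R) (f : T -> R) (M : R) :
  (forall n, bounded_measurable (f_ n)) -> bounded_measurable f ->
  (forall n x, `|f_ n x| <= M) -> (forall x, f_ n x @[n --> \oo] --> f x) ->
  mean P (f_ n) @[n --> \oo] --> mean P f.
Proof.
move=> mf_ mf fM ff.
have [|||||_ _] := @dominated_convergence _ T R P setT measurableT
    (fun n => EFin \o f_ n) (EFin \o f) (EFin \o cst M).
- by move=> n; apply/measurable_EFinP; have [] := mf_ n.
- by apply/measurable_EFinP; have [] := mf.
- by apply: aeW => x _; apply: cvg_EFin; [exact: nearW|exact: ff].
- exact: finite_measure_integrable_cst.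
- by apply: aeW => x n _ /=; rewrite lee_fin.
move=> h; apply: fine_cvg.
rewrite fineK; first exact: h.
by apply/integrable_fin_num => //; exact: bounded_measurable_integrable.
Qed.

End Dominated.

Section Trigonometric.
Context {R : realType}.

Lemma measurable_cos : measurable_fun setT (@cos R).
Proof. apply: continuous_measurable_fun; exact: continuous_cos. Qed.

Lemma measurable_sin : measurable_fun setT (@sin R).
Proof. apply: continuous_measurable_fun; exact: continuous_sin. Qed.

Lemma bounded_measurable_cos (t : R) : bounded_measurable (fun x => cos (t * x) : R).
Proof.
split; last by exists 1 => x; rewrite ler_norml cos_geN1 cos_le1.
by apply: measurableT_comp measurable_cos _; exact: measurable_funM.
Qed.

Lemma bounded_measurable_sin (t : R) : bounded_measurable (fun x => sin (t * x) : R).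
Proof.
split; last by exists 1 => x; rewrite ler_norml sin_geN1 sin_le1.
by apply: measurableT_comp measurable_sin _; exact: measurable_funM.
Qed.

Definition uniform01 : probability _ R := uniform_prob (@ltr01 R).

(** Averaging over the frequency separates infinity from zero. *)
Lemma mean_uniform_cos (x : R) : x != 0 ->
  mean uniform01 (fun t => 1 - cos (t * x)) = 1 - sin x / x.
Proof.
move=> x0; rewrite /mean /Rintegral integral_uniform; last 2 first.
- apply/measurable_EFinP; apply: measurable_funB => //.
  by apply: measurableT_comp measurable_cos _; exact: measurable_funM.
- by move=> t; rewrite lee_fin subr_ge0 cos_le1.
have dF (t : R) : is_derive t 1 (fun t => t - sin (t * x) / x) (1 - cos (t * x)).
  have hg : is_derive t 1 (fun t : R => t * x) x.
    rewrite (_ : (fun t : R => t * x) = x *: (id : R -> R)).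
      by apply: is_derive_eq; rewrite /GRing.scale/= mulr1.
    by apply/funext => z; rewrite /GRing.scale/= mulrC.
  have h := @is_derive1_comp R sin (fun t => t * x) t _ _ (is_derive_sin _) hg.
  rewrite (_ : (fun t => _) = (id : R -> R) - x^-1 *: (sin \o (fun t => t * x))); last first.
    by apply/funext => z; rewrite !fctE/= [in RHS]/GRing.scale/= [in RHS]mulrC.
  apply: is_derive_eq; rewrite /GRing.scale/= mulrC mulrK//.
  by rewrite unitfE.
have cF : continuous (fun t : R => t - sin (t * x) / x).
  move=> t; apply: differentiable_continuous; apply/derivable1_diffP.
  by have [] := dF t.
have cf : continuous (fun t : R => 1 - cos (t * x)).
  move=> t; apply: cvgB; first exact: cvg_cst.
  apply: continuous_comp; last exact: continuous_cos.
  by apply: cvgM; [exact: cvg_id|exact: cvg_cst].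
rewrite (@continuous_FTC2 _ _ (fun t => t - sin (t * x) / x)) ?ltr01//.
- by rewrite /= !mul0r !mul1r sin0 mul0r !subr0 invr1 mul1r.
- exact: continuous_subspaceT.
- split=> [t _||].
  + by have [] := dF t.
  + by apply: cvg_at_right_filter; exact: cF.
  + by apply: cvg_at_left_filter; exact: cF.
- by move=> t _; rewrite derive1E (@derive_val _ _ _ _ _ _ _ (dF t)).
Qed.

Lemma mean_uniform_cos_ge (x : R) : 2 <= `|x| ->
  2^-1 <= mean uniform01 (fun t => 1 - cos (t * x)).
Proof.
move=> x2; have x0 : x != 0 by rewrite -normr_gt0 (lt_le_trans _ x2).
rewrite mean_uniform_cos// lerBrDl -lerBrDr (le_trans (ler_norm _))//.
rewrite normrM normfV.
have -> : 1 - 2^-1 = 2^-1 :> R by field.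
rewrite -[leRHS]mul1r ler_pM ?invr_ge0//; first by rewrite ler_norml sin_geN1 sin_le1.
by rewrite lef_pV2 ?posrE ?normr_gt0.
Qed.

End Trigonometric.

Section Continuity.
Context {R : realType}.
Context (d : nat -> measure_display) (T : forall N, measurableType (d N)).
Context (P : forall N, probability (T N) R) (X : forall N, T N -> R).
Arguments X : clear implicits.
Context (d' : measure_display) (T' : measurableType d') (P' : probability T' R).
Context (Y : T' -> R).
Context (mX : forall N, measurable_fun setT (X N)) (mY : measurable_fun setT Y).
Arguments mX : clear implicits.

Definition mean_cvg (g : R -> R) :=
  mean (P N) (g \o X N) @[N --> \oo] --> mean P' (g \o Y).

Context (cvg_cos : forall t, mean_cvg (fun x => cos (t * x))).
Context (cvg_sin : forall t, mean_cvg (fun x => sin (t * x))).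

Lemma mean_cvgD g h : bounded_measurable g -> bounded_measurable h ->
  mean_cvg g -> mean_cvg h -> mean_cvg (fun x => g x + h x).
Proof.
move=> bg bh cg ch; rewrite /mean_cvg.
have -> : mean P' ((fun x => g x + h x) \o Y) = mean P' (g \o Y) + mean P' (h \o Y).
  by rewrite -meanD//; exact: bounded_measurable_comp.
rewrite (_ : (fun N => _) = fun N => mean (P N) (g \o X N) + mean (P N) (h \o X N)).
  exact: cvgD.
by apply/funext => N; rewrite -meanD//; exact: bounded_measurable_comp.
Qed.

Lemma mean_cvgZ c g : bounded_measurable g -> mean_cvg g ->
  mean_cvg (fun x => c * g x).
Proof.
move=> bg cg; rewrite /mean_cvg.
have -> : mean P' ((fun x => c * g x) \o Y) = c * mean P' (g \o Y).
  by rewrite -meanZ//; exact: bounded_measurable_comp.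
rewrite (_ : (fun N => _) = fun N => c * mean (P N) (g \o X N)).
  by apply: cvgM => //; exact: cvg_cst.
by apply/funext => N; rewrite -meanZ//; exact: bounded_measurable_comp.
Qed.

(** Functions whose modulations by all frequencies have converging means; by
    the addition formulas this class absorbs multiplication by a sine. *)
Definition modulated_cvg (g : R -> R) := bounded_measurable g /\
  forall t, mean_cvg (fun x => g x * cos (t * x)) /\ mean_cvg (fun x => g x * sin (t * x)).

Lemma modulated_cvg1 : modulated_cvg (fun=> 1).
Proof.
split; first exact: bounded_measurable_cst.
move=> t; split.
  by rewrite (_ : (fun x => _) = fun x => cos (t * x))//; apply/funext => x; rewrite mul1r.
by rewrite (_ : (fun x => _) = fun x => sin (t * x))//; apply/funext => x; rewrite mul1r.
Qed.

Lemma modulated_cvgD g h : modulated_cvg g -> modulated_cvg h ->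
  modulated_cvg (fun x => g x + h x).
Proof.
move=> [bg cg] [bh ch]; split; first exact: bounded_measurableD.
move=> t; have [gc gs] := cg t; have [hc hs] := ch t.
have bc := bounded_measurable_cos t; have bs := bounded_measurable_sin t.
split.
- rewrite (_ : (fun x => _) = fun x => g x * cos (t * x) + h x * cos (t * x)).
    by apply: mean_cvgD => //; exact: bounded_measurableM.
  by apply/funext => x; rewrite mulrDl.
- rewrite (_ : (fun x => _) = fun x => g x * sin (t * x) + h x * sin (t * x)).
    by apply: mean_cvgD => //; exact: bounded_measurableM.
  by apply/funext => x; rewrite mulrDl.
Qed.

Lemma modulated_cvgZ c g : modulated_cvg g -> modulated_cvg (fun x => c * g x).
Proof.
move=> [bg cg]; split; first exact: bounded_measurableZ.
move=> t; have [gc gs] := cg t.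
have bc := bounded_measurable_cos t; have bs := bounded_measurable_sin t.
split.
- rewrite (_ : (fun x => _) = fun x => c * (g x * cos (t * x))).
    by apply: mean_cvgZ => //; exact: bounded_measurableM.
  by apply/funext => x; rewrite mulrA.
- rewrite (_ : (fun x => _) = fun x => c * (g x * sin (t * x))).
    by apply: mean_cvgZ => //; exact: bounded_measurableM.
  by apply/funext => x; rewrite mulrA.
Qed.

Lemma modulated_cvg_sin c g : modulated_cvg g ->
  modulated_cvg (fun x => g x * sin (c * x)).
Proof.
move=> [bg cg]; have bs := bounded_measurable_sin c.
split; first exact: bounded_measurableM.
have bmc t := bounded_measurableM bg (bounded_measurable_cos t).
have bms t := bounded_measurableM bg (bounded_measurable_sin t).
move=> t; split.
- rewrite (_ : (fun x => _) = fun x => 2^-1 * (g x * sin ((c + t) * x)) +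
      2^-1 * (g x * sin ((c - t) * x))).
    apply: mean_cvgD; try exact: bounded_measurableZ.
      by apply: mean_cvgZ => //; exact: (cg _).2.
    by apply: mean_cvgZ => //; exact: (cg _).2.
  by apply/funext => x; rewrite (mulrDl c t x) (mulrBl x c t) (sinD (c * x) (t * x)) sinB; field.
- rewrite (_ : (fun x => _) = fun x => 2^-1 * (g x * cos ((c - t) * x)) +
      (- 2^-1) * (g x * cos ((c + t) * x))).
    apply: mean_cvgD; try exact: bounded_measurableZ.
      by apply: mean_cvgZ => //; exact: (cg _).1.
    by apply: mean_cvgZ => //; exact: (cg _).1.
  by apply/funext => x; rewrite (mulrDl c t x) (mulrBl x c t) (cosD (c * x) (t * x)) cosB; field.
Qed.

Lemma modulated_cvg_mean_cvg g : modulated_cvg g -> mean_cvg g.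
Proof.
move=> [_ /(_ 0)[+ _]]; rewrite (_ : (fun x => _) = g)//.
by apply/funext => x; rewrite mul0r cos0 mulr1.
Qed.

Lemma modulated_cvg_bernstein F n c :
  modulated_cvg (fun x => bernstein F n ((1 + sin (c * x)) / 2)).
Proof.
have hw b g : modulated_cvg g ->
    modulated_cvg (fun x => g x * bernoulli_weight ((1 + sin (c * x)) / 2) b).
  move=> cg; case: b => /=.
    rewrite (_ : (fun x => _) = fun x => 2^-1 * (g x + g x * sin (c * x))).
      by apply/modulated_cvgZ/modulated_cvgD => //; exact: modulated_cvg_sin.
    by apply/funext => x; field.
  rewrite (_ : (fun x => _) = fun x => 2^-1 * (g x + -1 * (g x * sin (c * x)))).
    by apply/modulated_cvgZ/modulated_cvgD => //; exact/modulated_cvgZ/modulated_cvg_sin.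
  by apply/funext => x; field.
have hprod (s : {ffun 'I_n -> bool}) :
    modulated_cvg (fun x => product_weight (bernoulli_weight ((1 + sin (c * x)) / 2)) s).
  rewrite /product_weight; elim: index_enum => [|i l IH].
    rewrite (_ : (fun x => _) = fun=> 1); first exact: modulated_cvg1.
    by apply/funext => x; rewrite big_nil.
  rewrite (_ : (fun x => _) = fun x => (\prod_(i <- l)
     bernoulli_weight ((1 + sin (c * x)) / 2) (s i)) *
     bernoulli_weight ((1 + sin (c * x)) / 2) (s i)); first exact: hw.
  by apply/funext => x; rewrite big_cons mulrC.
rewrite /bernstein /product_mean; elim: index_enum => [|s l IH].
  rewrite (_ : (fun x => _) = fun=> 0 * 1); first exact/modulated_cvgZ/modulated_cvg1.
  by apply/funext => x; rewrite big_nil mul0r.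
rewrite (_ : (fun x => _) = fun x =>
   F ((\sum_i (s i)%:R) / n%:R) *
     product_weight (bernoulli_weight ((1 + sin (c * x)) / 2)) s +
   \sum_(s <- l) product_weight (bernoulli_weight ((1 + sin (c * x)) / 2)) s *
     F ((\sum_i (s i)%:R) / n%:R)).
  by apply: modulated_cvgD => //; exact: modulated_cvgZ.
by apply/funext => x; rewrite big_cons mulrC.
Qed.

Lemma tail_le_mean_cos {d1 : measure_display} {T1 : measurableType d1}
    (Q : probability T1 R) (Z : T1 -> R) (c : R) : measurable_fun setT Z -> 0 < c ->
  bounded_measurable (fun t : R => mean Q (fun w => 1 - cos (t * c * Z w)) : R) /\
  mean Q (fun w => (2 / c <= `|Z w|)%R%:R) <=
  2 * mean uniform01 (fun t => mean Q (fun w => 1 - cos (t * c * Z w))).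
Proof.
move=> mZ c0.
pose f (z : R * T1) : R := 1 - cos (z.1 * c * Z z.2).
have mf : measurable_fun setT f.
  apply: measurable_funB => //; apply: measurableT_comp; first exact: measurable_cos.
  apply: measurable_funM; last by apply: measurableT_comp.
  by apply: measurable_funM.
have f0 z : 0 <= f z by rewrite subr_ge0 cos_le1.
have f2 z : f z <= 2 by rewrite lerBlDr -lerBlDl; have := cos_geN1 (z.1 * c * Z z.2); lra.
have [bf ->] := mean_fubini uniform01 Q mf f0 f2; split=> //.
have [bf' _] := @mean_fubini R _ _ _ _ Q uniform01 (fun z => f (z.2, z.1)) 2
  (measurableT_comp mf (@measurable_swap _ _ _ _)) (fun z => f0 _) (fun z => f2 _).
rewrite -meanZ//; apply: le_mean => //.
- apply: bounded_measurable_pred; apply: measurable_fun_ler => //.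
  exact: measurableT_comp.
- exact: bounded_measurableZ.
- move=> w /=; case: (leP (2 / c) `|Z w|) => h; last by rewrite mulr_ge0//; apply: mean_ge0 => t; exact: f0.
  have -> : (fun t => f (t, w)) = fun t => 1 - cos (t * (c * Z w)).
    by apply/funext => t; rewrite /f/= mulrA.
  rewrite -ler_pdivrMl// mulr1 mean_uniform_cos_ge//.
  by rewrite normrM (ger0_norm (ltW c0)) -ler_pdivrMl// mulrC.
Qed.

(** Tightness: the average over small frequencies of 1 - cos (t X) dominates
    the probability of large values, and converges to the one of the limit. *)
Lemma tight (eps : R) : 0 < eps -> exists2 L, 0 < L &
  (\forall N \near \oo, mean (P N) (fun w => (L <= `|X N w|)%R%:R) <= eps) /\
  mean P' (fun w => (L <= `|Y w|)%R%:R) <= eps.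
Proof.
move=> e0.
have norm2 x : `|1 - cos x| <= 2 :> R.
  by rewrite ler_norml; have := cos_le1 x; have := cos_geN1 x; lra.
have bq (d1 : measure_display) (T1 : measurableType d1) (Z : T1 -> R)
    (mZ : measurable_fun setT Z) t : bounded_measurable (fun w => 1 - cos (t * Z w)).
  apply: bounded_measurableB; first exact: bounded_measurable_cst.
  exact: (bounded_measurable_comp mZ (bounded_measurable_cos t)).
pose q k := mean uniform01 (fun t => mean P' (fun w => 1 - cos (t * k.+1%:R^-1 * Y w))).
have qcvg : q k @[k --> \oo] --> (0 : R).
  rewrite -(mean_cst uniform01 0).
  apply: (@mean_dominated _ _ _ _ _ _ 2).
  - by move=> k; have [] := tail_le_mean_cos P' mY (ltac:(rewrite invr_gt0//) : 0 < k.+1%:R^-1 :> R).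
  - exact: bounded_measurable_cst.
  - by move=> k t; apply: mean_norm_le => //; exact: bq.
  move=> t; rewrite -(mean_cst P' 0).
  apply: (@mean_dominated _ _ _ _ _ _ 2) => //.
  - by move=> k; exact: bq.
  - exact: bounded_measurable_cst.
  move=> w; suff : 1 - cos (t * k.+1%:R^-1 * Y w) @[k --> \oo] --> 1 - cos (t * 0 * Y w).
    by rewrite mulr0 mul0r cos0 subrr.
  apply: cvgB; first exact: cvg_cst.
  apply: (@continuous_cvg _ _ _ _ _ _ (@cos R)); first exact: continuous_cos.
  apply: cvgM; last exact: cvg_cst.
  by apply: cvgM; [exact: cvg_cst|exact: cvg_harmonic].
have e4 : 0 < eps / 4 by rewrite divr_gt0.
have [k _ /(_ k (leqnn k)) hk] := (iffLR (cvgrPdist_lt _ _) qcvg) _ e4.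
have c0 : 0 < k.+1%:R^-1 :> R by rewrite invr_gt0.
have qk : q k < eps / 4.
  by move: hk; rewrite /= sub0r normrN => /(le_lt_trans (ler_norm _)).
exists (2 / k.+1%:R^-1); first by rewrite divr_gt0.
split; last first.
  by have [_ /le_trans] := tail_le_mean_cos P' mY c0; apply; rewrite -/(q k); lra.
have : mean uniform01 (fun t => mean (P N) (fun w => 1 - cos (t * k.+1%:R^-1 * X N w)))
    @[N --> \oo] --> q k.
  apply: (@mean_dominated _ _ _ _ _ _ 2).
  - by move=> N; have [] := tail_le_mean_cos (P N) (mX N) c0.
  - by have [] := tail_le_mean_cos P' mY c0.
  - by move=> N t; apply: mean_norm_le => //; exact: bq.
  move=> t; rewrite meanB; [|exact: bounded_measurable_cst|
    exact: (bounded_measurable_comp mY (bounded_measurable_cos _))].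
  rewrite (_ : (fun N => _) = fun N => mean (P N) (fun=> 1) -
     mean (P N) (fun w => cos (t * k.+1%:R^-1 * X N w))); last first.
    apply/funext => N; rewrite meanB//; first exact: bounded_measurable_cst.
    exact: (bounded_measurable_comp (mX N) (bounded_measurable_cos _)).
  apply: cvgB; last exact: cvg_cos.
  rewrite mean_cst; under eq_fun do rewrite mean_cst.
  exact: cvg_cst.
move=> /(iffLR (cvgrPdist_lt _ _)) /(_ _ e4); apply: filterS => N hN.
have [_ /le_trans] := tail_le_mean_cos (P N) (mX N) c0; apply.
move: hN; rewrite distrC => /(le_lt_trans (ler_norm _)); lra.
Qed.

Lemma continuous_asin_clamp (r : R) : 0 <= r < 1 ->
  continuous (fun y : R => asin (Num.max (- r) (Num.min y r))).
Proof.
move=> /andP[r0 r1] y; apply: continuous_comp.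
  apply: continuous_max; first exact: cvg_cst.
  by apply: continuous_min; [exact: cvg_id|exact: cvg_cst].
apply: continuous_asin.
by rewrite lt_max ltrN2 r1/= gt_max gt_min r1 orbT andbT; lra.
Qed.

(** On a window carrying most of the mass, x is a continuous function of
    sin (x / L), hence a test function is close to a polynomial in the sine. *)
Theorem levy_continuity : cvg_in_distribution P X P' Y.
Proof.
move=> f cf [M fM].
have bf : bounded_measurable f by split; [exact: continuous_measurable_fun|exists M].
have bfX N : bounded_measurable (f \o X N) by exact: bounded_measurable_comp.
have bfY : bounded_measurable (f \o Y) by exact: bounded_measurable_comp.
suff H : mean_cvg f.
  have hE (d1 : measure_display) (T1 : measurableType d1) (Q : probability T1 R)
      (g : T1 -> R) : bounded_measurable g -> ('E_Q[g] = (mean Q g)%:E)%E.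
    move=> bg; rewrite unlock /mean /Rintegral fineK//.
    by apply: integrable_fin_num => //; exact: bounded_measurable_integrable.
  rewrite hE// (_ : (fun N => _) = fun N => (mean (P N) (f \o X N))%:E).
    by apply: cvg_EFin; [exact: nearW|exact: H].
  by apply/funext => N; rewrite hE.
apply/cvgrPdist_le => eps e0.
have M0 : 0 <= M by rewrite (le_trans _ (fM 0)).
have M1 : 0 < 2 * M + 1 by lra.
have e8 : 0 < eps / 8 by rewrite divr_gt0.
have [L L0 [tX tY]] := tight (ltac:(by rewrite !divr_gt0) : 0 < eps / 8 / (2 * M + 1)).
have pi2 : 1 <= pi / 2 :> R by rewrite ler_pdivlMr// mul1r pi_ge2.
have pi2' := @pi_ge2 R.
have s1 : 0 <= sin (2^-1 : R) < 1.
  rewrite sin_ge0_pi; last by lra.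
  rewrite lt_neqAle sin_le1 andbT; apply/eqP => h.
  have := cos2Dsin2 (2^-1 : R); rewrite h expr1n => h1.
  have /eqP : cos (2^-1 : R) ^+ 2 = 0 by lra.
  rewrite sqrf_eq0; apply/negP; rewrite gt_eqF//.
  apply: cos_gt0_pihalf; lra.
set r : R := sin 2^-1 in s1.
pose K := 2 * L; have K0 : 0 < K by rewrite mulr_gt0.
have /andP[r0 r1] := s1.
pose F y := f (K * asin (Num.max (- r) (Num.min (2 * y - 1) r))).
have cF : continuous F.
  move=> y; apply: continuous_comp; last exact: cf.
  apply: cvgM; first exact: cvg_cst.
  apply: (@continuous_comp _ _ _ (fun y : R => 2 * y - 1)
    (fun y => asin (Num.max (- r) (Num.min y r)))); last exact: continuous_asin_clamp.
  apply: cvgB; last exact: cvg_cst.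
  by apply: cvgM; [exact: cvg_cst|exact: cvg_id].
have [n hn] := bernstein_approx cF (fun y => fM _) e8.
pose h x := bernstein F n ((1 + sin (K^-1 * x)) / 2).
have mh : modulated_cvg h := modulated_cvg_bernstein F n K^-1.
have bh : bounded_measurable h := mh.1.
have sin01 x : 0 <= (1 + sin (K^-1 * x)) / 2 <= 1.
  by have := sin_geN1 (K^-1 * x); have := sin_le1 (K^-1 * x); lra.
have fh x : `|f x - h x| <= eps / 8 + 2 * M * (L <= `|x|)%R%:R.
  have hB := hn _ (sin01 x).
  case: (leP L `|x|) => /= xL.
    rewrite mulr1 -(subrKA (F ((1 + sin (K^-1 * x)) / 2))).
    rewrite (le_trans (ler_normD _ _))// addrC lerD// (le_trans (ler_normB _ _))//.
    by rewrite mulr_natl mulr2n lerD//; exact: fM.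
  rewrite mulr0 addr0 -[f x](_ : F ((1 + sin (K^-1 * x)) / 2) = _)//.
  have xL1 : - 2^-1 <= K^-1 * x <= 2^-1.
    move: xL; rewrite ltr_norml => /andP[h1 h2].
    by rewrite ler_pdivlMl// ler_pdivrMl// /K; lra.
  rewrite /F; have -> : 2 * ((1 + sin (K^-1 * x)) / 2) - 1 = sin (K^-1 * x) by field.
  have inpi (z : R) : - 2^-1 <= z <= 2^-1 -> z \in `[- (pi / 2), pi / 2].
    by rewrite in_itv/=; lra.
  have /andP[xl xu] := xL1.
  have hmono (y z : R) : - 2^-1 <= y -> y <= z -> z <= 2^-1 -> sin y <= sin z.
    by move=> y1 yz z1; rewrite leNgt ltr_sin ?inpi -?leNgt// ?y1 ?(le_trans yz)// ?(le_trans y1).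
  have -> : Num.min (sin (K^-1 * x)) r = sin (K^-1 * x).
    by apply/min_idPl; rewrite /r hmono.
  have -> : Num.max (- r) (sin (K^-1 * x)) = sin (K^-1 * x).
    by apply/max_idPr; rewrite /r -sinN hmono.
  by rewrite sinK ?inpi// mulVKf// gt_eqF.
have close (d1 : measure_display) (T1 : measurableType d1) (Q : probability T1 R)
    (Z : T1 -> R) : measurable_fun setT Z ->
    mean Q (fun w => (L <= `|Z w|)%R%:R) <= eps / 8 / (2 * M + 1) ->
    `|mean Q (f \o Z) - mean Q (h \o Z)| <= eps / 4.
  move=> mZ tZ.
  have bt : bounded_measurable (fun w => (L <= `|Z w|)%R%:R : R).
    by apply: bounded_measurable_pred; apply: measurable_fun_ler => //; exact: measurableT_comp.
  have b2 := bounded_measurableZ (2 * M) bt.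
  apply: le_trans (mean_dist Q (bounded_measurable_comp mZ bf)
    (bounded_measurable_comp mZ bh)
    (bounded_measurableD (bounded_measurable_cst (eps / 8)) b2) (fun w => fh _)) _.
  rewrite meanD//; last exact: bounded_measurable_cst.
  rewrite mean_cst meanZ//.
  have : 2 * M * mean Q (fun w => (L <= `|Z w|)%R%:R) <= eps / 8.
    rewrite (le_trans (ler_wpM2l _ tZ)) ?mulr_ge0//.
    rewrite mulrA ler_pdivrMr// mulrC ler_wpM2l ?ltW//; lra.
  lra.
have /cvgrPdist_le/(_ _ e8) hcvg := modulated_cvg_mean_cvg mh.
apply: (filterS2 _ _ tX hcvg) => N tN' hN.
have tN := close _ _ (P N) (X N) (mX N) tN'.
have tY' := close _ _ P' Y mY tY.
rewrite (_ : mean P' (f \o Y) - _ = (mean P' (f \o Y) - mean P' (h \o Y)) +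
  ((mean P' (h \o Y) - mean (P N) (h \o X N)) -
   (mean (P N) (f \o X N) - mean (P N) (h \o X N)))); last by ring.
rewrite (le_trans (ler_normD _ _))//.
have : `|mean P' (h \o Y) - mean (P N) (h \o X N) -
   (mean (P N) (f \o X N) - mean (P N) (h \o X N))| <= eps / 8 + eps / 4.
  by rewrite (le_trans (ler_normB _ _))// lerD.
lra.
Qed.

End Continuity.

(** * Vague convergence of Lévy measures *)

Section LevyFunctional.
Context {R : realType}.
Implicit Types (f g : R -> R) (nu : (R -> R) -> R).

Definition levy_weight (x : R) : R := if 0 < x then Num.min (x ^+ 2) 1 else 0.

Definition levy_class f := measurable_fun setT f /\
  exists C, forall x, `|f x| <= C * levy_weight x.

(** Integration against a measure on the positive half-line that integrates
    min (x^2, 1). *)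
Definition levy_functional nu :=
  [/\ forall f g, levy_class f -> levy_class g ->
        nu (fun x => f x + g x) = nu f + nu g,
      forall c f, levy_class f -> nu (fun x => c * f x) = c * nu f
    & forall f g, levy_class f -> levy_class g -> (forall x, f x <= g x) ->
        nu f <= nu g].

Lemma levy_weight_ge0 x : 0 <= levy_weight x.
Proof. by rewrite /levy_weight; case: ltP => // x0; rewrite le_min sqr_ge0 ler01. Qed.

Lemma levy_weight_le1 x : levy_weight x <= 1.
Proof. by rewrite /levy_weight; case: ltP => // x0; rewrite ge_min lexx orbT. Qed.

Lemma levy_class_bounded f : levy_class f -> bounded_measurable f.
Proof.
move=> [mf [C hC]]; split=> //; exists `|C| => x.
rewrite (le_trans (hC x))// (le_trans (ler_norm _))// normrM.
by rewrite ler_piMr// ger0_norm ?levy_weight_ge0 ?levy_weight_le1.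
Qed.

Lemma levy_classD f g : levy_class f -> levy_class g -> levy_class (fun x => f x + g x).
Proof.
move=> [mf [C hC]] [mg [C' hC']]; split; first exact: measurable_funD.
by exists (C + C') => x; rewrite (le_trans (ler_normD _ _))// mulrDl lerD.
Qed.

Lemma levy_classZ c f : levy_class f -> levy_class (fun x => c * f x).
Proof.
move=> [mf [C hC]]; split; first exact: measurable_funM.
by exists (`|c| * C) => x; rewrite normrM -mulrA ler_wpM2l.
Qed.

Lemma levy_class_mul f g : levy_class f -> bounded_measurable g ->
  levy_class (fun x => g x * f x).
Proof.
move=> [mf [C hC]] [mg [M hM]]; split; first exact: measurable_funM.
by exists (M * C) => x; rewrite normrM -mulrA ler_pM.
Qed.

Lemma levy_class_le f g : levy_class g -> measurable_fun setT f ->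
  (forall x, `|f x| <= g x) -> levy_class f.
Proof.
move=> [mg [C hC]] mf fg; split=> //; exists C => x.
by rewrite (le_trans (fg x))// (le_trans _ (hC x))// ler_norm.
Qed.

Lemma measurable_gt (a : R) : measurable_fun setT (fun x : R => a < x).
Proof. exact: measurable_fun_ltr. Qed.

Lemma measurable_le (a : R) : measurable_fun setT (fun x : R => x <= a).
Proof. exact: measurable_fun_ler. Qed.

Lemma levy_class_gt (a : R) : 0 < a -> levy_class (fun x => (a < x)%R%:R).
Proof.
move=> a0; have [mf _] := bounded_measurable_pred (measurable_gt a) (R := R).
split=> //; exists (1 + a ^- 2) => x.
case: (ltP a x) => ax; last first.
  by rewrite normr0 mulr_ge0 ?levy_weight_ge0// addr_ge0// invr_ge0 sqr_ge0.
rewrite normr1 /levy_weight (lt_trans a0 ax).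
have a2 : 0 < a ^+ 2 by rewrite exprn_gt0.
have ai : 0 <= a ^- 2 by rewrite invr_ge0 ltW.
have x2 : a ^+ 2 <= x ^+ 2 by rewrite ler_sqr ?nnegrE ltW// (lt_trans a0).
case: (leP (x ^+ 2) 1) => _; last by rewrite mulr1 lerDl.
rewrite mulrDl mul1r -[leLHS]add0r lerD ?sqr_ge0//.
by rewrite mulrC ler_pdivlMr// mul1r.
Qed.

Definition between (a b x : R) : R := (a < x <= b)%R%:R.

Lemma bounded_measurable_between a b : bounded_measurable (between a b).
Proof.
apply: bounded_measurable_pred; apply: measurable_and.
  exact: measurable_gt.
exact: measurable_le.
Qed.

Lemma between_ge0 a b x : 0 <= between a b x. Proof. by []. Qed.

Lemma levy_class_between (a b : R) : 0 < a -> levy_class (between a b).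
Proof.
move=> a0; apply: (levy_class_le (levy_class_gt a0)).
  by have [] := bounded_measurable_between a b.
by move=> x; rewrite /between ger0_norm//; case: (ltP a x); case: (leP x b).
Qed.

Lemma between_split a b c x : a <= b -> b <= c ->
  between a c x = between a b x + between b c x.
Proof.
move=> ab bc; rewrite /between.
case: (ltP a x) => h1; case: (leP x b) => h2; case: (leP x c) => h3;
  rewrite /= ?mulr0n ?mulr1n ?addr0 ?add0r //; exfalso; lra.
Qed.

Lemma levy_functional_dist nu f g h : levy_functional nu ->
  levy_class f -> levy_class g -> levy_class h ->
  (forall x, `|f x - g x| <= h x) -> `|nu f - nu g| <= nu h.
Proof.
move=> [hD hZ hle] lf lg lh fgh; rewrite ler_norml; apply/andP; split.
  rewrite lerNl opprB lerBlDr -hD//; apply: hle => // [|x].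
    exact: levy_classD.
  by have := fgh x; rewrite ler_norml => /andP[]; lra.
rewrite lerBlDr -hD//; apply: hle => // [|x]; first exact: levy_classD.
by have := fgh x; rewrite ler_norml => /andP[]; lra.
Qed.

Lemma levy_functional_ge0 nu f : levy_functional nu -> levy_class f ->
  (forall x, 0 <= f x) -> 0 <= nu f.
Proof.
move=> [hD hZ hle] lf f0.
by rewrite -[leLHS](mul0r (nu f)) -hZ//; apply: hle => // [|x];
  [exact: levy_classZ|rewrite mul0r].
Qed.

End LevyFunctional.

Section VagueConvergence.
Context {R : realType} (nu : nat -> (R -> R) -> R) (Lam : (R -> R) -> R).
Context (nu_levy : forall N, levy_functional (nu N)) (Lam_levy : levy_functional Lam).
Context (tails : forall a, 0 < a ->
  nu N (fun x => (a < x)%R%:R) @[N --> \oo] --> Lam (fun x => (a < x)%R%:R)).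

Lemma between_cvg a b : 0 < a -> a <= b ->
  nu N (between a b) @[N --> \oo] --> Lam (between a b).
Proof.
move=> a0 ab; have b0 := lt_le_trans a0 ab.
have hE mu : levy_functional mu -> mu (between a b) =
    mu (fun x => (a < x)%R%:R) - mu (fun x => (b < x)%R%:R).
  move=> [hD hZ _]; apply/eqP; rewrite -subr_eq opprK -hD.
  - apply/eqP; congr mu; apply/funext => x; rewrite /between.
    have [bx|xb] := ltP b x; first by rewrite (le_lt_trans ab bx)/= add0r.
    by rewrite andbT addr0.
  - exact: levy_class_between.
  - exact: levy_class_gt.
rewrite hE//; under eq_fun do rewrite hE//.
by apply: cvgB; exact: tails.
Qed.

Context (h : R -> R) (K : R) (lh : levy_class h) (K0 : 0 <= K).

Definition lipschitz_on (a b : R) :=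
  forall x y, a < x -> x <= y -> y <= b -> `|h x - h y| <= K * (y - x).

Let cut a b x := between a b x * h x.

Let levy_cut a b : levy_class (cut a b).
Proof. by apply: levy_class_mul => //; exact: bounded_measurable_between. Qed.

Let cut_dist a b mu : levy_functional mu -> 0 < a -> a <= b -> lipschitz_on a b ->
  `|mu (cut a b) - h b * mu (between a b)| <= K * (b - a) * mu (between a b).
Proof.
move=> hmu a0 ab lip; have [_ hZ _] := hmu.
have lb := levy_class_between b a0.
rewrite -!hZ//; apply: levy_functional_dist => //; try exact: levy_classZ.
move=> x; rewrite /cut mulrC -mulrBl normrM /between.
case: (ltP a x) => ax; last by rewrite /= mulr0n normr0 !mulr0.
case: (leP x b) => xb; last by rewrite /= mulr0n normr0 !mulr0.
rewrite /= mulr1n normr1 !mulr1 (le_trans (lip _ _ ax xb (lexx _)))//.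
by rewrite ler_wpM2l// lerD2l lerN2 ltW.
Qed.

(** Bisecting halves the oscillation of h on each piece while the total mass
    stays the same. *)
Lemma cut_cvg_aux n a b eps : 0 < a -> a <= b -> lipschitz_on a b -> 0 < eps ->
  \forall N \near \oo, `|nu N (cut a b) - Lam (cut a b)| <=
    3 * K * (b - a) / 2 ^+ n * Lam (between a b) + eps.
Proof.
elim: n a b eps => [|n IH] a b eps a0 ab lip e0.
  have L0 : 0 <= Lam (between a b).
    by apply: levy_functional_ge0 => // ; exact: levy_class_between.
  pose q := `|h b| + K * (b - a) + 1.
  have Kab : 0 <= K * (b - a) by rewrite mulr_ge0// subr_ge0.
  have q0 : 0 < q by rewrite ltr_wpDl// addr_ge0.
  have eq : 0 < eps / q by rewrite divr_gt0.
  have /cvgrPdist_le/(_ _ eq) := between_cvg a0 ab.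
  apply: filterS => N hN.
  have d1 := cut_dist (nu_levy N) a0 ab lip.
  have d2 := cut_dist Lam_levy a0 ab lip.
  set u := nu N (cut a b) in d1 *; set v := nu N (between a b) in hN d1.
  set u' := Lam (cut a b) in d2 *; set v' := Lam (between a b) in hN d2 L0 *.
  have hv : q * `|v' - v| <= eps by rewrite -ler_pdivlMl// mulrC.
  have vle : K * (b - a) * v <= K * (b - a) * v' + K * (b - a) * `|v' - v|.
    by rewrite -mulrDr ler_wpM2l// -lerBlDl distrC ler_norm.
  have e3 : `|u - u'| <= `|u - h b * v| + (`|h b| * `|v' - v| + `|u' - h b * v'|).
    rewrite (_ : u - u' = (u - h b * v) + (- (h b * (v' - v)) - (u' - h b * v'))); last by ring.
    rewrite (le_trans (ler_normD _ _))// lerD// (le_trans (ler_normB _ _))//.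
    by rewrite normrN normrM.
  have dd : 0 <= `|v' - v| by [].
  rewrite expr0 divr1; move: hv; rewrite /q !mulrDl mul1r => hv.
  have Kv : 0 <= K * (b - a) * v' by rewrite mulr_ge0.
  rewrite -!mulrA [K * _]mulrA; lra.
pose m := (a + b) / 2.
have am : a <= m by rewrite /m; lra.
have mb : m <= b by rewrite /m; lra.
have m0 : 0 < m := lt_le_trans a0 am.
have e2 : 0 < eps / 2 by rewrite divr_gt0.
have lip1 : lipschitz_on a m by move=> x y ax xy ym; apply: lip => //; exact: le_trans mb.
have lip2 : lipschitz_on m b by move=> x y mx xy yb; apply: lip => //; exact: le_lt_trans mx.
apply: (filterS2 _ _ (IH a m _ a0 am lip1 e2) (IH m b _ m0 mb lip2 e2)) => N h1 h2.
have split mu : levy_functional mu -> mu (cut a b) = mu (cut a m) + mu (cut m b).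
  move=> [hD _ _]; rewrite -hD//; congr mu; apply/funext => x.
  by rewrite /cut (between_split x am mb) mulrDl.
have splitb : Lam (between a b) = Lam (between a m) + Lam (between m b).
  have [hD _ _] := Lam_levy; rewrite -hD; last 2 first.
  - exact: levy_class_between.
  - exact: levy_class_between.
  by congr Lam; apply/funext => x; exact: between_split.
rewrite !split// splitb opprD addrACA (le_trans (ler_normD _ _))//.
apply: (le_trans (lerD h1 h2)).
have -> : m - a = (b - a) / 2 by rewrite /m; field.
have -> : b - m = (b - a) / 2 by rewrite /m; field.
have two : 2 ^+ n != 0 :> R by rewrite expf_neq0.
rewrite exprS le_eqVlt; apply/orP; left; apply/eqP; field.
by rewrite two.
Qed.

(** The mesh of the bisection is sent to zero after the index N to infinity. *)
Lemma cut_cvg a b : 0 < a -> a <= b -> lipschitz_on a b ->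
  nu N (cut a b) @[N --> \oo] --> Lam (cut a b).
Proof.
move=> a0 ab lip; apply/cvgrPdist_le => eps e0.
have L0 : 0 <= Lam (between a b).
  by apply: levy_functional_ge0 => // ; exact: levy_class_between.
pose c := 3 * K * (b - a) * Lam (between a b).
have c0 : 0 <= c by rewrite !mulr_ge0// subr_ge0.
have e2 : 0 < eps / 2 by rewrite divr_gt0.
pose n := Num.bound (c / (eps / 2)).
have hn : c / 2 ^+ n <= eps / 2.
  have n2 : n%:R <= 2 ^+ n :> R by rewrite -natrX ler_nat ltnW// ltn_expl.
  rewrite ler_pdivrMr ?exprn_gt0// -ler_pdivrMl// mulrC (le_trans _ n2)//.
  by apply/ltW/archi_boundP; rewrite divr_ge0// ltW.
apply: filterS (cut_cvg_aux n a0 ab lip e2) => N hN.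
rewrite distrC (le_trans hN)// mulrAC -/c; lra.
Qed.

Context (small_nu : forall eps, 0 < eps -> exists2 a, 0 < a <= 1 &
  (\forall N \near \oo, nu N (fun x => between 0 a x * x ^+ 2) <= eps) /\
  Lam (fun x => between 0 a x * x ^+ 2) <= eps).
Context (large_Lam : forall eps, 0 < eps -> exists2 M, 1 <= M &
  Lam (fun x => (M < x)%R%:R) <= eps).
Context (lip01 : lipschitz_on 0 1) (lip1 : forall M, 1 <= M -> lipschitz_on 1 M).

(** Convergence of the tails, no mass escaping near zero for x^2 dx, and a
    test function that is regular except for a possible jump at one. *)
Lemma levy_functional_cvg : nu N h @[N --> \oo] --> Lam h.
Proof.
apply/cvgrPdist_le => eps e0.
have [mh [C hC]] := lh.
have C0 : 0 <= C.
  have := le_trans (normr_ge0 _) (hC 1).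
  by rewrite /levy_weight ltr01 expr1n minxx mulr1.
pose e := eps / (6 * C + 3).
have c6 : 0 < 6 * C + 3 by lra.
have ep : 0 < e by rewrite divr_gt0.
have [a /andP[a0 a1] [na la]] := small_nu ep.
have [M M1 lM] := large_Lam ep.
have M0 : 0 < M := lt_le_trans ltr01 M1.
have /cvgrPdist_le/(_ _ ep) tM := tails M0.
have lipa : lipschitz_on a 1.
  by move=> x y ax; apply: lip01; exact: lt_trans ax.
have /cvgrPdist_le/(_ _ ep) ca := cut_cvg a0 a1 lipa.
have /cvgrPdist_le/(_ _ ep) cM := cut_cvg ltr01 M1 (lip1 M1).
have lsq : levy_class (fun x => between 0 a x * x ^+ 2).
  split.
    by apply: measurable_funM; [have [] := bounded_measurable_between 0 a|exact: exprn_measurable].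
  exists 1 => x; rewrite mul1r /between /levy_weight.
  case: (ltP 0 x) => x0 /=; last by rewrite mul0r normr0.
  case: (leP x a) => xa /=; last by rewrite mul0r normr0 le_min sqr_ge0 ler01.
  rewrite mul1r ger0_norm ?sqr_ge0// le_min lexx/=.
  by rewrite expr_le1 ?(ltW x0)// (le_trans xa).
have lgt := levy_class_gt M0.
pose g x := cut a 1 x + cut 1 M x.
have lg : levy_class g by exact: levy_classD.
have lerr : levy_class (fun x => C * (between 0 a x * x ^+ 2) + C * (M < x)%R%:R).
  by apply: levy_classD; apply: levy_classZ.
have bnd mu : levy_functional mu -> `|mu h - (mu (cut a 1) + mu (cut 1 M))| <=
    C * mu (fun x => between 0 a x * x ^+ 2) + C * mu (fun x => (M < x)%R%:R).
  move=> hmu; have [hD hZ hle] := hmu.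
  rewrite -!hZ// -!hD//; try exact: levy_classZ.
  apply: levy_functional_dist => // x; rewrite /cut -mulrDl -between_split//.
  rewrite -[X in X - _]mul1r -mulrBl normrM.
  have w0 := levy_weight_ge0 x.
  rewrite /between; case: (leP x a) => ax /=.
    have -> : (M < x) = false by apply/negbTE; rewrite -leNgt; lra.
    rewrite !mulr0n mulr0 addr0 subr0 normr1 mul1r andbT.
    have := hC x; rewrite /levy_weight; case: (ltP 0 x) => x0 /=; last first.
      by rewrite mulr0n mulr0 mul0r mulr0.
    move=> /le_trans; rewrite mulr1n mul1r; apply.
    by rewrite ler_wpM2l// ge_min lexx.
  rewrite andbF mulr0n mul0r mulr0 add0r.
  case: (leP x M) => xM /=; first by rewrite mulr1n subrr normr0 mul0r mulr0n mulr0.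
  rewrite mulr0n subr0 normr1 mul1r mulr1n mulr1 (le_trans (hC x))//.
  by rewrite ler_piMr// levy_weight_le1.
have bL := bnd _ Lam_levy.
near=> N.
have bN := bnd _ (nu_levy N).
have h1 : nu N (fun x => between 0 a x * x ^+ 2) <= e by near: N.
have h2 : `|Lam (fun x => (M < x)%R%:R) - nu N (fun x => (M < x)%R%:R)| <= e by near: N.
have h3 : `|Lam (cut a 1) - nu N (cut a 1)| <= e by near: N.
have h4 : `|Lam (cut 1 M) - nu N (cut 1 M)| <= e by near: N.
have h2' : nu N (fun x => (M < x)%R%:R) <= 2 * e.
  by move: h2; rewrite ler_norml => /andP[]; lra.
have E : (6 * C + 3) * e = eps by rewrite mulrC divfK// gt_eqF.
have q1 : C * nu N (fun x => between 0 a x * x ^+ 2) <= C * e by rewrite ler_wpM2l.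
have q2 : C * nu N (fun x => (M < x)%R%:R) <= C * (2 * e) by rewrite ler_wpM2l.
have q3 : C * Lam (fun x => between 0 a x * x ^+ 2) <= C * e by rewrite ler_wpM2l.
have q4 : C * Lam (fun x => (M < x)%R%:R) <= C * e by rewrite ler_wpM2l.
have Ce : 0 <= C * e by rewrite mulr_ge0// ltW.
rewrite (_ : Lam h - nu N h = (Lam h - (Lam (cut a 1) + Lam (cut 1 M))) +
  ((Lam (cut a 1) - nu N (cut a 1)) + ((Lam (cut 1 M) - nu N (cut 1 M)) -
  (nu N h - (nu N (cut a 1) + nu N (cut 1 M)))))); last by ring.
rewrite (le_trans (ler_normD _ _))//.
have k1 := ler_normB (Lam (cut 1 M) - nu N (cut 1 M)) (nu N h - (nu N (cut a 1) + nu N (cut 1 M))).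
have k2 := ler_normD (Lam (cut a 1) - nu N (cut a 1)) ((Lam (cut 1 M) - nu N (cut 1 M)) -
  (nu N h - (nu N (cut a 1) + nu N (cut 1 M)))).
lra.
Unshelve. all: by end_near.
Qed.

End VagueConvergence.

(** * The one-sided stable Lévy measure *)

Section StableLevyMeasure.
Context {R : realType} (alpha : R) (halpha : 0 < alpha < 2).
Implicit Types (f g : R -> R) (a x : R).
Local Notation mu := (@lebesgue_measure R).

Definition stable_density x : R := alpha * x `^ (- (alpha + 1)).

(** Integration against the Lévy measure of the one-sided stable law. *)
Definition stable_levy f : R := \int[mu]_(x in `]0, +oo[) (f x * stable_density x).

Let alpha_gt0 : 0 < alpha. Proof. by have /andP[] := halpha. Qed.
Let alpha_lt2 : alpha < 2. Proof. by have /andP[] := halpha. Qed.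

Lemma stable_density_ge0 x : 0 <= stable_density x.
Proof. by rewrite mulr_ge0 ?powR_ge0// ltW. Qed.

Lemma is_derive_powR (p x : R) : 0 < x ->
  is_derive x 1 (fun y => y `^ p) (p * x `^ (p - 1)).
Proof. exact: is_derive1_powR. Qed.

Lemma continuous_powR_gt0 (p x : R) : 0 < x -> {for x, continuous (fun y => y `^ p)}.
Proof.
move=> x0; apply: differentiable_continuous; apply/derivable1_diffP.
by have [] := is_derive_powR p x0.
Qed.

Lemma measurable_stable_density : measurable_fun setT stable_density.
Proof. by exact: measurable_funM. Qed.

Lemma powRN_cvg0 (p : R) : 0 < p -> x `^ (- p) @[x --> +oo] --> (0 : R).
Proof.
move=> p0; apply/cvgrPdist_le => eps e0.
exists (eps `^ (- p^-1)); split; first exact: num_real.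
move=> x xe; have x0 : 0 < x by rewrite (lt_trans _ xe)// powR_gt0.
rewrite sub0r normrN ger0_norm ?powR_ge0//.
rewrite powRN -[leRHS]invrK lef_pV2 ?posrE ?invr_gt0 ?powR_gt0//.
have -> : eps^-1 = (eps `^ (- p^-1)) `^ p.
  by rewrite -powRrM mulNr mulVf ?gt_eqF// powR_inv1// ltW.
by rewrite ge0_ler_powR ?nnegrE ?powR_ge0 ?ltW.
Qed.

Lemma integral_stable_density_tail a : 0 < a ->
  (\int[mu]_(x in `]a, +oo[) (stable_density x)%:E = (a `^ (- alpha))%:E)%E.
Proof.
move=> a0; rewrite integral_itv_obnd_cbnd; last first.
  by apply/measurable_EFinP; exact: measurable_funTS measurable_stable_density.
have dF x : 0 < x -> is_derive x 1 (fun x => - (x `^ (- alpha))) (stable_density x).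
  move=> x0; have h := is_derive_powR (- alpha) x0.
  apply: (@is_derive_eq _ _ _ _ _ _ _ _ (is_deriveN h)).
  by rewrite mulNr opprK /stable_density opprD.
rewrite (@ge0_continuous_FTC2y _ _ (fun x => - (x `^ (- alpha))) _ 0).
- by rewrite sub0e EFinN oppeK.
- by move=> x _; exact: stable_density_ge0.
- apply: continuous_in_subspaceT => x; rewrite inE/= in_itv/= andbT => ax.
  apply: cvgM; first exact: cvg_cst.
  by apply: continuous_powR_gt0; exact: lt_le_trans ax.
- by rewrite -oppr0; apply: cvgN; exact: powRN_cvg0.
- by move=> x ax; have [] := dF x (lt_trans a0 ax).
- apply: cvg_at_right_filter; apply: cvgN; exact: continuous_powR_gt0.
- move=> x; rewrite in_itv/= andbT => ax.
  by rewrite derive1E (@derive_val _ _ _ _ _ _ _ (dF x (lt_trans a0 ax))).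
Qed.

Lemma integral_stable_density_sqr a : 0 < a ->
  (\int[mu]_(x in `]0%R, a]) (x ^+ 2 * stable_density x)%:E <=
   (alpha / (2 - alpha) * a `^ (2 - alpha))%:E)%E.
Proof.
move=> a0; have d0 : 0 < 2 - alpha by rewrite subr_gt0.
have mf D : measurable D -> measurable_fun D (fun x => (x ^+ 2 * stable_density x)%:E).
  move=> mD; apply/measurable_EFinP; apply: measurable_funTS.
  by apply: measurable_funM; [exact: exprn_measurable|exact: measurable_stable_density].
pose F k : set R := `[a / k.+2%:R, a]%classic.
have Fk k : a / k.+2%:R < a.
  by rewrite ltr_pdivrMr// ltr_pMr// ltr1n.
have ak k : 0 < a / k.+2%:R by rewrite divr_gt0.
have UF : \bigcup_k F k = `]0, a]%classic.
  apply/seteqP; split => x /=.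
    by move=> [k _]; rewrite /F /= !in_itv/= => /andP[h ->]; rewrite (lt_le_trans (ak k)).
  rewrite in_itv/= => /andP[x0 xa]; exists (Num.bound (a / x)) => //.
  rewrite /F /= in_itv/= xa andbT ler_pdivrMr// mulrC -ler_pdivrMr//.
  rewrite (le_trans (ltW (archi_boundP _))) ?divr_ge0 ?ltW// ltr_nat.
  by rewrite ltnW.
have nF : nondecreasing_seq F.
  move=> i j ij; apply/subsetPset => x; rewrite /F /= !in_itv/= => /andP[h ->].
  rewrite andbT (le_trans _ h)// ler_pM2l// lef_pV2 ?posrE//.
  by rewrite ler_nat !ltnS.
have mF i : measurable (F i) by exact: measurable_itv.
have cvgF : (\int[mu]_(x in F i) (x ^+ 2 * stable_density x)%:E @[i --> \oo] -->
   \int[mu]_(x in `]0%R, a]) (x ^+ 2 * stable_density x)%:E)%E.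
  rewrite -UF; apply: ge0_nondecreasing_set_cvg_integral => //.
    by move=> i; exact: mf.
  by move=> i x _; rewrite lee_fin mulr_ge0 ?sqr_ge0// stable_density_ge0.
rewrite -(cvg_lim _ cvgF)//; apply: lime_le; first by apply/cvg_ex; eexists; exact: cvgF.
apply: nearW => k.
have dG x : 0 < x -> is_derive x 1
    (fun x => alpha / (2 - alpha) * x `^ (2 - alpha)) (x ^+ 2 * stable_density x).
  move=> x0; have h := is_derive_powR (2 - alpha) x0.
  rewrite (_ : (fun x => _) = (alpha / (2 - alpha)) *: (fun x => x `^ (2 - alpha)))//.
  apply: is_derive_eq; rewrite /GRing.scale/= mulrA divfK ?gt_eqF//.
  rewrite /stable_density mulrCA; congr (_ * _).
  rewrite -powR_mulrn ?ltW// -powRD; last by apply/implyP => _; rewrite gt_eqF.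
  by congr (_ `^ _); ring.
rewrite /F (@continuous_FTC2 _ _ (fun x => alpha / (2 - alpha) * x `^ (2 - alpha)))//.
- by rewrite -EFinB lee_fin lerBlDr lerDl mulr_ge0 ?powR_ge0// divr_ge0 ?ltW.
- apply: continuous_in_subspaceT => x; rewrite inE/= in_itv/= => /andP[ax _].
  have x0 := lt_le_trans (ak k) ax.
  apply: cvgM; first by apply: exprn_continuous.
  by apply: cvgM; [exact: cvg_cst|exact: continuous_powR_gt0].
- have cG x : 0 < x -> {for x, continuous (fun x => alpha / (2 - alpha) * x `^ (2 - alpha))}.
    by move=> x0; apply: cvgM; [exact: cvg_cst|exact: continuous_powR_gt0].
  split=> [x||].
  + by rewrite in_itv/= => /andP[ax _]; have [] := dG x (lt_trans (ak k) ax).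
  + by apply: cvg_at_right_filter; exact: cG.
  + by apply: cvg_at_left_filter; exact: cG.
- move=> x; rewrite in_itv/= => /andP[ax _].
  by rewrite derive1E (@derive_val _ _ _ _ _ _ _ (dG x (lt_trans (ak k) ax))).
Qed.

Lemma levy_weight1 : levy_weight 1 = 1 :> R.
Proof. by rewrite /levy_weight ltr01 expr1n minxx. Qed.

Lemma levy_weight_le_sqr x : levy_weight x <= x ^+ 2.
Proof. by rewrite /levy_weight; case: ltP => _; rewrite ?sqr_ge0// ge_min lexx. Qed.

Lemma measurable_levy_weight : measurable_fun setT (@levy_weight R).
Proof.
apply: measurable_fun_ifT => //; first exact: measurable_gt.
by apply: measurable_minr => //; exact: exprn_measurable.
Qed.

#[local] Opaque stable_density levy_weight.

Lemma integrable_levy_class f : levy_class f ->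
  mu.-integrable `]0, +oo[ (EFin \o (fun x => f x * stable_density x)).
Proof.
move=> [mf [C hC]].
have C0 : 0 <= C.
  have := le_trans (normr_ge0 _) (hC 1).
  by rewrite levy_weight1 mulr1.
have mg : measurable_fun setT (fun x => C * levy_weight x * stable_density x).
  apply: measurable_funM; last exact: measurable_stable_density.
  by apply: measurable_funM => //; exact: measurable_levy_weight.
apply: (@le_integrable _ _ _ mu _ _ _ (EFin \o (fun x => C * levy_weight x * stable_density x))) => //.
- by apply/measurable_EFinP; apply: measurable_funTS; apply: measurable_funM => //; exact: measurable_stable_density.
- move=> x _ /=; rewrite lee_fin (normrM (f x)) (normrM (C * levy_weight x)).
  by rewrite ler_wpM2r// (le_trans (hC x))// ler_norm.
apply/integrableP; split.
  by apply/measurable_EFinP; exact: measurable_funTS.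
have g0 x : 0 <= C * levy_weight x * stable_density x.
  by apply: mulr_ge0; [exact: mulr_ge0 C0 (levy_weight_ge0 x)|exact: stable_density_ge0].
under eq_integral => x _ do rewrite /= ger0_norm//.
rewrite (@itv_bndbnd_setU _ _ (BRight 0) (BRight 1) (BInfty _ false)) ?bnd_simp//.
rewrite ge0_integral_setU//=; last 3 first.
- by apply/measurable_EFinP; exact: measurable_funTS.
- by move=> x _; rewrite lee_fin.
- apply/disj_setPS => x /=; rewrite !in_itv/= => -[/andP[_ x1]] /andP[+ _].
  by rewrite ltNge x1.
have up : (\int[mu]_(x in `]0%R, 1%R]) (C * levy_weight x * stable_density x)%:E <=
    C%:E * \int[mu]_(x in `]0%R, 1%R]) (x ^+ 2 * stable_density x)%:E)%E.
  rewrite -ge0_integralZl//=.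
  - apply: ge0_le_integral => //=.
    + by move=> x _; rewrite lee_fin.
    + by apply/measurable_EFinP; exact: measurable_funTS.
    + apply/measurable_EFinP; apply: measurable_funTS; apply: measurable_funM => //.
      by apply: measurable_funM; [exact: exprn_measurable|exact: measurable_stable_density].
    + move=> x; rewrite in_itv/= => /andP[x0 _].
      rewrite -EFinM lee_fin [leRHS]mulrA.
      apply: (ler_wpM2r (stable_density_ge0 x)); apply: (ler_wpM2l C0).
      exact: levy_weight_le_sqr.
  - apply/measurable_EFinP; apply: measurable_funTS.
    by apply: measurable_funM; [exact: exprn_measurable|exact: measurable_stable_density].
  - by move=> x _; rewrite lee_fin mulr_ge0 ?sqr_ge0 ?stable_density_ge0.
have lo : (\int[mu]_(x in `]1%R, +oo[) (C * levy_weight x * stable_density x)%:E <=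
    C%:E * \int[mu]_(x in `]1%R, +oo[) (stable_density x)%:E)%E.
  rewrite -ge0_integralZl//=.
  - apply: ge0_le_integral => //=.
    + by move=> x _; rewrite lee_fin.
    + by apply/measurable_EFinP; exact: measurable_funTS.
    + apply/measurable_EFinP; apply: measurable_funTS; apply: measurable_funM => //.
      exact: measurable_stable_density.
    + move=> x _; rewrite -EFinM lee_fin.
      apply: (ler_wpM2r (stable_density_ge0 x)).
      by rewrite ler_piMr// levy_weight_le1.
  - by apply/measurable_EFinP; apply: measurable_funTS; exact: measurable_stable_density.
  - by move=> x _; rewrite lee_fin stable_density_ge0.
apply: lte_add_pinfty.
  apply: (le_lt_trans up); rewrite lte_mul_pinfty//.
  by apply: (le_lt_trans (integral_stable_density_sqr ltr01)); rewrite ltry.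
apply: (le_lt_trans lo); rewrite lte_mul_pinfty//.
by rewrite integral_stable_density_tail// ltry.
Qed.

Lemma stable_levy_functional : levy_functional stable_levy.
Proof.
split=> [f g lf lg|c f lf|f g lf lg fg].
- rewrite /stable_levy -RintegralD//; try exact: integrable_levy_class.
  by apply: eq_Rintegral => x _; rewrite mulrDl.
- rewrite /stable_levy -RintegralZl//; try exact: integrable_levy_class.
  by apply: eq_Rintegral => x _; rewrite mulrA.
- apply: le_Rintegral => //; try exact: integrable_levy_class.
  by move=> x _; rewrite ler_wpM2r ?stable_density_ge0.
Qed.

Lemma stable_levy_gt a : 0 < a -> stable_levy (fun x => (a < x)%R%:R) = a `^ (- alpha).
Proof.
move=> a0; rewrite /stable_levy /Rintegral -[RHS]/(fine (a `^ (- alpha))%:E).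
congr fine; rewrite -integral_stable_density_tail//.
have -> : `]a, +oo[%classic = `]0, +oo[%classic `&` `]a, +oo[%classic.
  apply/seteqP; split => x /=; rewrite !in_itv/= !andbT; last by move=> [].
  by move=> ax; split=> //; exact: lt_trans ax.
rewrite integral_mkcondr; apply: eq_integral => x _.
rewrite /patch mem_setE in_itv/= andbT.
by case: (ltP a x) => _; rewrite ?mul1r ?mul0r.
Qed.

Lemma stable_levy_sqr_le a : 0 < a ->
  stable_levy (fun x => between 0 a x * x ^+ 2) <= alpha / (2 - alpha) * a `^ (2 - alpha).
Proof.
move=> a0; rewrite /stable_levy /Rintegral -[leRHS]/(fine (_%:E)).
have h := integral_stable_density_sqr a0.
have E : (\int[mu]_(x in `]0%R, a]) (x ^+ 2 * stable_density x)%:E =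
    \int[mu]_(x in `]0%R, +oo[) (between 0 a x * x ^+ 2 * stable_density x)%:E)%E.
  have -> : `]0, a]%classic = `]0, +oo[%classic `&` `]0, a]%classic.
    apply/seteqP; split => x /=; rewrite !in_itv/= ?andbT; last by move=> [].
    by move=> /andP[x0 ->]; rewrite x0.
  rewrite integral_mkcondr; apply: eq_integral => x _.
  rewrite /patch mem_setE in_itv/= /between.
  by case: (_ && _); rewrite ?mul1r ?mul0r.
rewrite -E; apply: fine_le => //.
rewrite ge0_fin_numE; first exact: le_lt_trans h (ltry _).
by apply: integral_ge0 => x _; rewrite lee_fin mulr_ge0 ?sqr_ge0// stable_density_ge0.
Qed.

End StableLevyMeasure.

(** * Regular variation *)

Section RegularVariation.
Context {R : realType} {d : measure_display} {T : measurableType d}.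
Context (P : probability T R) (X : T -> R) (mX : measurable_fun setT X).
Context (alpha : R) (halpha : 0 < alpha < 2).

Definition tail_mean (x : R) : R := mean P (fun w => (x < `|X w|)%R%:R).
Local Notation G := tail_mean.

Context (G_gt0 : forall x, 0 < x -> 0 < G x).
Context (G_ratio : forall t, 0 < t -> G (t * x) / G x @[x --> +oo] --> t `^ (- alpha)).

Lemma measurable_abs : measurable_fun setT (fun w => `|X w|).
Proof. exact: measurableT_comp. Qed.

Lemma bounded_measurable_tail x : bounded_measurable (fun w => (x < `|X w|)%R%:R : R).
Proof. by apply: bounded_measurable_pred; apply: measurable_fun_ltr => //; exact: measurable_abs. Qed.

Lemma tail_mean_nincr x y : x <= y -> G y <= G x.
Proof.
move=> xy; apply: le_mean; try exact: bounded_measurable_tail.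
move=> w; case: (ltP y `|X w|) => h; last by rewrite mulr0n.
by rewrite (le_lt_trans xy h).
Qed.

Lemma tail_mean_cvg0 eps : 0 < eps -> exists2 x, 0 < x & G x <= eps.
Proof.
move=> e0; have : G n.+1%:R @[n --> \oo] --> (0 : R).
  rewrite -(mean_cst P 0); apply: (@mean_dominated _ _ _ _ _ _ 1).
  - by move=> n; exact: bounded_measurable_tail.
  - exact: bounded_measurable_cst.
  - by move=> n w; case: (_ < _); rewrite ?normr1 ?normr0.
  move=> w; apply/cvgrPdist_le => e' e'0; near=> n.
  rewrite (_ : (_ < _) = false) ?mulr0n ?subrr ?normr0 ?ltW//.
  apply/negbTE; rewrite -leNgt (le_trans (ltW (archi_boundP (normr_ge0 (X w)))))// ler_nat.
  by near: n; exists (Num.bound `|X w|) => // n /= h; rewrite ltnW.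
move=> /cvgrPdist_le/(_ _ e0)[n _ /(_ n (leqnn n))]/=.
rewrite sub0r normrN => /(le_trans (ler_norm _)) h.
by exists n.+1%:R.
Unshelve. all: by end_near. Qed.

Lemma tail_mean_ratio s t : 0 < s -> 0 < t ->
  G (s * x) / G (t * x) @[x --> +oo] --> s `^ (- alpha) / t `^ (- alpha).
Proof.
move=> s0 t0.
have tp : t `^ (- alpha) != 0 by rewrite gt_eqF// powR_gt0.
have h : G (s * x) / G x * (G (t * x) / G x)^-1 @[x --> +oo] -->
    s `^ (- alpha) / t `^ (- alpha).
  by apply: cvgM; [exact: G_ratio|apply: cvgV => //; exact: G_ratio].
have E : \forall x \near +oo,
    G (s * x) / G x * (G (t * x) / G x)^-1 = G (s * x) / G (t * x).
  near=> x.
  have x0 : 0 < x by near: x; exact: nbhs_pinfty_gt.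
  have n1 : G x != 0 by rewrite gt_eqF// G_gt0.
  have n2 : G (t * x) != 0 by rewrite gt_eqF// G_gt0// mulr_gt0.
  by field; rewrite n1 n2.
by apply: cvg_trans h; exact: near_eq_cvg.
Unshelve. all: by end_near. Qed.

Context (a : nat -> R).
Context (a_above : forall k y, 0 < y -> a k < y -> k%:R * G y <= 1).
Context (a_below : forall k y, 0 < y -> y < a k -> 1 < k%:R * G y).

Lemma normalizer_cvgy : a k @[k --> \oo] --> +oo.
Proof.
apply/cvgryPge => A; near=> k.
pose B := Num.max A 1.
have B0 : 0 < B by rewrite lt_max ltr01 orbT.
apply: (@le_trans _ _ B); first by rewrite le_max lexx.
rewrite leNgt; apply/negP => /(a_above B0); apply/negP; rewrite -ltNge.
rewrite -ltr_pdivrMr ?G_gt0// mul1r.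
near: k; exact: nbhs_infty_gtr.
Unshelve. all: by end_near. Qed.

(** By definition k G(y) crosses 1 at y = a k; comparing with points slightly to
    the left and to the right of a k and using regular variation removes the
    possible jump. *)
Lemma tail_normalizer x : 0 < x -> k%:R * G (a k * x) @[k --> \oo] --> x `^ (- alpha).
Proof.
move=> x0; have [al0 al2] := andP halpha.
have hc c : 0 < c -> G (a k * x) / G (a k * c) @[k --> \oo] --> x `^ (- alpha) * c `^ alpha.
  move=> c0; have h := tail_mean_ratio x0 c0.
  rewrite powRN powRN invrK -powRN in h.
  have := cvg_comp _ _ normalizer_cvgy h.
  by under eq_fun do rewrite /= (mulrC x) (mulrC c).
apply/cvgrPdist_le => eps e0.
have e2 : 0 < eps / 2 by rewrite divr_gt0.
have cont : x `^ (- alpha) * c `^ alpha @[c --> (1 : R)] --> x `^ (- alpha) * 1 `^ alpha.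
  by apply: cvgM; [exact: cvg_cst|exact: continuous_powR_gt0].
rewrite powR1 mulr1 in cont.
have /cvgrPdist_le/(_ _ e2)[r /= r0 hr] := cont.
pose del := Num.min (r / 2) (2^-1).
have del0 : 0 < del by rewrite lt_min divr_gt0//= invr_gt0.
have delr : del < r by rewrite gt_min; apply/orP; left; lra.
have del1 : del < 1 by rewrite gt_min; apply/orP; right; lra.
have hp : `|x `^ (- alpha) - x `^ (- alpha) * (1 + del) `^ alpha| <= eps / 2.
  by apply: hr; rewrite /ball_ /= opprD addrA subrr sub0r normrN ger0_norm// ltW.
have hm : `|x `^ (- alpha) - x `^ (- alpha) * (1 - del) `^ alpha| <= eps / 2.
  by apply: hr; rewrite /ball_ /= opprB addrC subrK ger0_norm// ltW.
have c1 : 0 < 1 + del by lra.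
have c2 : 0 < 1 - del by lra.
have /cvgrPdist_le/(_ _ e2) near1 := hc _ c1.
have /cvgrPdist_le/(_ _ e2) near2 := hc _ c2.
near=> k.
have ak : 0 < a k.
  by near: k; have /cvgryPgt := normalizer_cvgy; apply.
have k1 : `|x `^ (- alpha) * (1 + del) `^ alpha - G (a k * x) / G (a k * (1 + del))| <= eps / 2.
  by near: k.
have k2 : `|x `^ (- alpha) * (1 - del) `^ alpha - G (a k * x) / G (a k * (1 - del))| <= eps / 2.
  by near: k.
have u1 : k%:R * G (a k * (1 + del)) <= 1.
  by apply: a_above; rewrite ?mulr_gt0// ltr_pMr//; lra.
have u2 : 1 < k%:R * G (a k * (1 - del)).
  by apply: a_below; rewrite ?mulr_gt0// gtr_pMr//; lra.
have g0 : 0 < G (a k * x) by rewrite G_gt0// mulr_gt0.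
have g1 : 0 < G (a k * (1 + del)) by rewrite G_gt0// mulr_gt0.
have g2 : 0 < G (a k * (1 - del)) by rewrite G_gt0// mulr_gt0.
have up : k%:R * G (a k * x) <= G (a k * x) / G (a k * (1 + del)).
  by rewrite ler_pdivlMr// mulrAC ler_piMl// ltW.
have lo : G (a k * x) / G (a k * (1 - del)) <= k%:R * G (a k * x).
  by rewrite ler_pdivrMr// mulrAC ler_peMl// ltW.
move: hp hm k1 k2; rewrite !ler_norml => /andP[? ?] /andP[? ?] /andP[? ?] /andP[? ?].
by apply/andP; split; lra.
Unshelve. all: by end_near. Qed.

Definition truncated_square (y : R) : R := mean P (fun w => between 0 y `|X w| * `|X w| ^+ 2).

Lemma bounded_measurable_square y :
  bounded_measurable (fun w => between 0 y `|X w| * `|X w| ^+ 2).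
Proof.
split.
  apply: measurable_funM.
    apply: measurableT_comp measurable_abs.
    by have [] := bounded_measurable_between 0 y.
  by apply: measurable_funX; exact: measurable_abs.
exists (y ^+ 2) => w; rewrite /between.
case: (ltP 0 `|X w|) => h0; last by rewrite mulr0n mul0r normr0 sqr_ge0.
case: (leP `|X w| y) => h1; last by rewrite mulr0n mul0r normr0 sqr_ge0.
rewrite mulr1n mul1r ger0_norm ?sqr_ge0// ler_sqr ?nnegrE//.
exact: le_trans h1.
Qed.

(** Karamata's estimate: dyadically, the truncated second moment is at most a
    geometric sum dominated by its last term, since the index is below two. *)
Lemma karamata : exists C x0, [/\ 0 < C, 0 < x0 & forall y, x0 <= y ->
  truncated_square y <= C * (y ^+ 2 * G y)].
Proof.
have [al0 al2] := andP halpha.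
have two4 : 2 `^ alpha < 4 :> R.
  have -> : 4 = 2 `^ 2%:R :> R by rewrite powR_mulrn// expr2; ring.
  by rewrite /powR pnatr_eq0/= ltr_expR ltr_pM2r// ln_gt0// ltr1n.
have two0 : 0 < 2 `^ alpha :> R by rewrite powR_gt0.
pose rho : R := (2 `^ alpha + 4) / 2.
have rho4 : rho < 4 by rewrite /rho; lra.
have rho0 : 0 < rho by rewrite /rho; lra.
have rho2 : 2 `^ alpha < rho by rewrite /rho; lra.
have h := G_ratio (ltac:(by rewrite invr_gt0) : 0 < 2^-1 :> R).
have half : 2^-1 `^ (- alpha) = 2 `^ alpha :> R.
  by rewrite -powR_inv1// -powRrM mulN1r opprK.
rewrite half in h.
have [x1 [_ hx1]] : \forall x \near +oo, G (2^-1 * x) / G x < rho by exact: cvgr_lt h _ rho2.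
pose x0 := Num.max x1 1 + 1.
have x00 : 0 < x0 by rewrite /x0 ltr_wpDl// le_max ler01 orbT.
have step y : x0 <= y -> G (y / 2) <= rho * G y.
  move=> y0; have yp : 0 < y := lt_le_trans x00 y0.
  rewrite -ler_pdivrMr ?G_gt0// mulrC -[y / 2]mulrC mulrC ltW// hx1//.
  by rewrite (lt_le_trans _ y0)// /x0 (@le_lt_trans _ _ (Num.max x1 1)) ?le_max ?lexx// ltrDl.
have Vstep y : 0 < y -> truncated_square y <= truncated_square (y / 2) + y ^+ 2 * G (y / 2).
  move=> y0; rewrite /truncated_square /tail_mean.
  have bt := bounded_measurable_tail (y / 2).
  rewrite -meanZ// -meanD//; try exact: bounded_measurable_square; try exact: bounded_measurableZ.
  apply: le_mean; try exact: bounded_measurable_square.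
    by apply: bounded_measurableD; [exact: bounded_measurable_square|exact: bounded_measurableZ].
  move=> w; rewrite /between; have n0 := normr_ge0 (X w).
  case: (ltP 0 `|X w|) => h0; last by rewrite !mulr0n !mul0r add0r mulr_ge0 ?sqr_ge0.
  case: (leP `|X w| y) => h1; last first.
    by rewrite mulr0n mul0r addr_ge0// mulr_ge0// sqr_ge0.
  case: (leP `|X w| (y / 2)) => h2; first by rewrite !mulr0n mulr0 addr0.
  by rewrite mulr0n mul0r add0r !mulr1n mul1r mulr1 ler_sqr// nnegrE ltW.
have Vle y : truncated_square y <= y ^+ 2.
  rewrite -[leRHS](mean_cst P); apply: le_mean.
  - exact: bounded_measurable_square.
  - exact: bounded_measurable_cst.
  - move=> w; rewrite /between.
    case: (ltP 0 `|X w|) => h0; last by rewrite mulr0n mul0r sqr_ge0.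
    case: (leP `|X w| y) => h1; last by rewrite mulr0n mul0r sqr_ge0.
    by rewrite mulr1n mul1r ler_sqr// nnegrE// (le_trans _ h1).
have g0 : 0 < G (2 * x0) by rewrite G_gt0// mulr_gt0.
have r4 : 0 < 1 - rho / 4 by lra.
pose C := 4 / G (2 * x0) + rho / (1 - rho / 4).
have C1 : 4 <= C * G (2 * x0).
  by rewrite /C mulrDl divfK ?gt_eqF// lerDl !mulr_ge0 ?invr_ge0 ?ltW.
have C2 : C * (rho / 4) + rho <= C.
  have : rho <= C * (1 - rho / 4).
    by rewrite /C mulrDl divfK ?gt_eqF// lerDr !mulr_ge0 ?invr_ge0 ?ltW.
  by rewrite mulrBr mulr1; lra.
have C0 : 0 < C by rewrite addr_gt0// divr_gt0.
exists C, x0; split=> // y x0y.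
have [n yn] : exists n, y <= 2 ^+ n.+1 * x0.
  exists (Num.bound (y / x0)); rewrite -ler_pdivrMr//.
  have yx : 0 <= y / x0 by rewrite divr_ge0 ?ltW// (lt_le_trans x00).
  rewrite (le_trans (ltW (archi_boundP yx)))// -natrX ler_nat.
  by rewrite (leq_trans (ltnW (ltn_expl _ (ltnSn 1))))// leq_exp2l.
elim: n y x0y yn => [|n IH] y x0y yn; have y0 := lt_le_trans x00 x0y.
  rewrite expr1 in yn.
  rewrite (le_trans (Vle y))// mulrCA ler_peMr ?sqr_ge0//.
  have : G (2 * x0) <= G y by exact: tail_mean_nincr.
  by move=> hG; have := ler_wpM2l (ltW C0) hG; lra.
have [y2|y2] := leP (2 * x0) y; last first.
  rewrite (le_trans (Vle y))// mulrCA ler_peMr ?sqr_ge0//.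
  have : G (2 * x0) <= G y by apply: tail_mean_nincr; exact: ltW.
  by move=> hG; have := ler_wpM2l (ltW C0) hG; lra.
have IHy : truncated_square (y / 2) <= C * ((y / 2) ^+ 2 * G (y / 2)).
  apply: IH; first by lra.
  by rewrite ler_pdivrMr// mulrAC -exprSr.
have sy := step y x0y.
have yy : 0 <= y ^+ 2 by exact: sqr_ge0.
apply: (le_trans (Vstep y y0)).
have e1 : C * ((y / 2) ^+ 2 * G (y / 2)) <= C * (rho / 4) * (y ^+ 2 * G y).
  have -> : (y / 2) ^+ 2 = y ^+ 2 / 4 by field.
  have := ler_wpM2l (mulr_ge0 (ltW C0) yy) sy.
  rewrite (_ : C * (y ^+ 2 / 4 * G (y / 2)) = C * y ^+ 2 * G (y / 2) / 4); last by field.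
  rewrite (_ : C * (rho / 4) * (y ^+ 2 * G y) = C * y ^+ 2 * (rho * G y) / 4); last by field.
  by rewrite ler_pM2r// invr_gt0.
have e2 : y ^+ 2 * G (y / 2) <= rho * (y ^+ 2 * G y).
  by rewrite mulrCA ler_wpM2l.
have yG : 0 <= y ^+ 2 * G y by rewrite mulr_ge0// ltW// G_gt0.
have := ler_wpM2r yG C2; rewrite mulrDl; lra.
Qed.

Lemma truncated_square_normalizer : exists2 C, 0 < C & forall eps, 0 < eps ->
  \forall k \near \oo, k%:R * (truncated_square (a k * eps) / a k ^+ 2) <=
    C * eps `^ (2 - alpha).
Proof.
have [C [x0 [C0 x00 hC]]] := karamata.
exists (2 * C); first by rewrite mulr_gt0.
move=> eps e0.
have ep : 0 < eps `^ (- alpha) by rewrite powR_gt0.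
have h2 : eps `^ (- alpha) < 2 * eps `^ (- alpha) by lra.
have ht := tail_normalizer e0.
near=> k.
have ak : x0 / eps <= a k.
  by near: k; have /cvgryPge := normalizer_cvgy; apply.
have ak0 : 0 < a k by rewrite (lt_le_trans _ ak)// divr_gt0.
have kG : k%:R * G (a k * eps) <= 2 * eps `^ (- alpha).
  by apply: ltW; near: k; exact: cvgr_lt ht _ h2.
have V := hC (a k * eps); rewrite -ler_pdivrMr// in V; have {}V := V ak.
have -> : eps `^ (2 - alpha) = eps ^+ 2 * eps `^ (- alpha).
  by rewrite powRD ?powR_mulrn ?ltW//; apply/implyP => _; rewrite gt_eqF.
apply: (@le_trans _ _ (C * eps ^+ 2 * (k%:R * G (a k * eps)))).
  rewrite mulrA ler_pdivrMr ?exprn_gt0//.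
  apply: (le_trans (ler_wpM2l _ V)); first by [].
  by rewrite exprMn le_eqVlt; apply/orP; left; apply/eqP; ring.
have Ce : 0 <= C * eps ^+ 2 by rewrite mulr_ge0 ?sqr_ge0// ltW.
by apply: (le_trans (ler_wpM2l Ce kG)); rewrite le_eqVlt; apply/orP; left; apply/eqP; ring.
Unshelve. all: by end_near. Qed.

End RegularVariation.

(** * Powers of characteristic functions *)

Local Open Scope complex_scope.

Section RealTrigonometry.
Context {R : realType}.
Implicit Types x y : R.

Lemma sin_le_id x : 0 <= x -> sin x <= x.
Proof.
move=> x0; rewrite -subr_ge0.
have := @ge0_of_derive R (fun x => x - sin x) (fun x => 1 - cos x).
by rewrite /= sin0 subr0; apply.
Qed.

Lemma abs_sin_le x : `|sin x| <= `|x|.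
Proof.
wlog x0 : x / 0 <= x.
  move=> h; have [/h//|/ltW xlt0] := leP 0 x.
  by rewrite -(normrN x) -(normrN (sin x)) -sinN h// oppr_ge0.
rewrite (ger0_norm x0) ler_norml sin_le_id// andbT.
have [x1|x1] := leP 1 x.
  by apply: (@le_trans _ _ (-1)); [rewrite lerN2|exact: sin_geN1].
apply: (@le_trans _ _ 0); first by rewrite oppr_le0.
by apply: sin_ge0_pi; have := @pi_ge2 R; lra.
Qed.

Lemma one_sub_cos_le x : 1 - cos x <= x ^+ 2 / 2.
Proof.
have -> : cos x = 1 - 2 * sin (x / 2) ^+ 2.
  have -> : cos x = cos (x / 2 + x / 2) by congr cos; field.
  by rewrite cosD -!expr2 cos2sin2; ring.
have := abs_sin_le (x / 2); rewrite -ler_sqr ?nnegrE//.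
by rewrite !real_normK ?num_real//; lra.
Qed.

Lemma one_sub_cos_le_abs x : 1 - cos x <= `|x|.
Proof.
have h1 := one_sub_cos_le x; have h2 := cos_geN1 x.
have : x ^+ 2 = `|x| ^+ 2 by rewrite real_normK ?num_real.
have [x2|x2] := leP `|x| 2; last by lra.
by have := normr_ge0 x; nra.
Qed.

Lemma sin_sub_id_le x : `|sin x - x| <= x ^+ 2 / 2.
Proof.
wlog x0 : x / 0 <= x.
  move=> h; have [/h//|/ltW xlt0] := leP 0 x.
  by have := h (- x); rewrite oppr_ge0 sinN sqrrN -opprD normrN; apply.
rewrite distrC ger0_norm ?subr_ge0 ?sin_le_id// -subr_ge0.
have := @ge0_of_derive R (fun x => 2^-1 * (x * x) - (x - sin x))
  (fun x => x - (1 - cos x)).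
rewrite /= sin0 mul0r mulr0 !subr0 => h.
have -> : x ^+ 2 / 2 - (x - sin x) = 2^-1 * (x * x) - (x - sin x) by rewrite expr2 mulrC.
apply: h => // y.
  have h1 := is_deriveM (is_derive_id y 1) (is_derive_id y (1 : R)).
  have h2 := is_deriveB (is_derive_id y 1) (is_derive_sin y).
  apply: (@is_derive_eq _ _ _ _ _ _ _ _ (is_deriveB (is_deriveZ (2^-1) h1) h2)).
  by rewrite /GRing.scale/= mulr1; field.
by move=> y0; rewrite subr_ge0 -[leRHS](ger0_norm y0) one_sub_cos_le_abs.
Qed.

Lemma cos_lip x y : `|cos x - cos y| <= `|x - y|.
Proof.
have -> : cos x - cos y = - 2 * (sin ((x + y) / 2) * sin ((x - y) / 2)).
  rewrite -[in cos x](_ : (x + y) / 2 + (x - y) / 2 = x); last by field.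
  rewrite -[in cos y](_ : (x + y) / 2 - (x - y) / 2 = y); last by field.
  by rewrite cosD cosB; ring.
rewrite !normrM normrN normr_nat.
have h := abs_sin_le ((x - y) / 2); rewrite normrM [`|2^-1|]ger0_norm// in h.
have h2 : `|sin ((x + y) / 2)| <= 1 by rewrite ler_norml sin_geN1 sin_le1.
have : `|sin ((x + y) / 2)| * `|sin ((x - y) / 2)| <= 1 * (`|x - y| / 2) by rewrite ler_pM.
lra.
Qed.

Lemma sin_lip x y : `|sin x - sin y| <= `|x - y|.
Proof.
have -> : sin x - sin y = 2 * (cos ((x + y) / 2) * sin ((x - y) / 2)).
  rewrite -[in sin x](_ : (x + y) / 2 + (x - y) / 2 = x); last by field.
  rewrite -[in sin y](_ : (x + y) / 2 - (x - y) / 2 = y); last by field.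
  by rewrite sinD sinB; ring.
rewrite !normrM normr_nat.
have h := abs_sin_le ((x - y) / 2); rewrite normrM [`|2^-1|]ger0_norm// in h.
have h2 : `|cos ((x + y) / 2)| <= 1 by rewrite ler_norml cos_geN1 cos_le1.
have : `|cos ((x + y) / 2)| * `|sin ((x - y) / 2)| <= 1 * (`|x - y| / 2) by rewrite ler_pM.
lra.
Qed.

Lemma expR_taylor1 x : x <= 0 -> `|expR x - 1 - x| <= x ^+ 2.
Proof.
move=> x0; have h1 := expR_ge1Dx x; have h2 := expR_ge1Dx (- x).
have e0 := expR_gt0 x; have ee := expRxMexpNx_1 x.
rewrite ger0_norm; last by lra.
have : expR x * (1 - x) <= 1 by rewrite -[leRHS]ee ler_wpM2l// ltW.
nra.
Qed.

End RealTrigonometry.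

Section ComplexExponential.
Context {R : realType}.
Implicit Types z w : R[i].

Definition modulus z : R := Num.sqrt (complex.Re z ^+ 2 + complex.Im z ^+ 2).

Lemma modulusE z : modulus z = Normc.normc z. Proof. by case: z. Qed.
Lemma modulusM z w : modulus (z * w) = modulus z * modulus w.
Proof. by rewrite !modulusE Normc.normcM. Qed.
Lemma modulusD z w : modulus (z + w) <= modulus z + modulus w.
Proof. by rewrite !modulusE le_normcD. Qed.
Lemma modulusN z : modulus (- z) = modulus z.
Proof. by rewrite !modulusE normcN. Qed.
Lemma modulus_ge0 z : 0 <= modulus z. Proof. exact: sqrtr_ge0. Qed.

Lemma modulusB z w : modulus (z - w) <= modulus z + modulus w.
Proof. by rewrite (le_trans (modulusD _ _))// modulusN. Qed.

Lemma modulusX z n : modulus (z ^+ n) = modulus z ^+ n.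
Proof.
elim: n => [|n IH]; last by rewrite !exprS modulusM IH.
by rewrite !expr0 modulusE Normc.normc1.
Qed.

Lemma abs_Re_le z : `|complex.Re z| <= modulus z.
Proof. by rewrite -sqrtr_sqr ler_wsqrtr// lerDl sqr_ge0. Qed.

Lemma abs_Im_le z : `|complex.Im z| <= modulus z.
Proof. by rewrite -sqrtr_sqr ler_wsqrtr// lerDr sqr_ge0. Qed.

Lemma modulus_le z : modulus z <= `|complex.Re z| + `|complex.Im z|.
Proof.
rewrite /modulus -[leRHS]ger0_norm ?addr_ge0// -sqrtr_sqr ler_wsqrtr//.
rewrite sqrrD !real_normK ?num_real//.
by rewrite addrAC lerDl mulrn_wge0// mulr_ge0.
Qed.

Lemma expCD z w : expC (z + w) = expC z * expC w.
Proof.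
case: z w => [a b] [c d]; rewrite /expC /= expRD cosD sinD.
by apply/eqP; rewrite eq_complex/=; apply/andP; split; apply/eqP; ring.
Qed.

Lemma expC0 : expC (0 : R[i]) = 1.
Proof. by rewrite /expC /= expR0 cos0 sin0 !mul1r. Qed.

Lemma expCMn z n : expC (n%:R * z) = expC z ^+ n.
Proof.
elim: n => [|n IH]; first by rewrite mul0r expC0.
by rewrite -addn1 natrD mulrDl mul1r expCD IH addn1 exprSr.
Qed.

Lemma modulus_expC z : modulus (expC z) = expR (complex.Re z).
Proof.
rewrite /modulus /expC /= !exprMn -mulrDr cos2Dsin2 mulr1.
by rewrite sqrtr_sqr ger0_norm// expR_ge0.
Qed.

Lemma expC_taylor1 z : complex.Re z <= 0 -> modulus (expC z - 1 - z) <= 4 * modulus z ^+ 2.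
Proof.
move=> z0; apply: (le_trans (modulus_le _)).
have hr := abs_Re_le z; have hi := abs_Im_le z; have m0 := modulus_ge0 z.
case: z z0 hr hi m0 => a b /=; set m := modulus _ => a0 hr hi m0.
have a2 : a ^+ 2 <= m ^+ 2 by rewrite -[leLHS]real_normK ?num_real// ler_sqr ?nnegrE.
have b2 : b ^+ 2 <= m ^+ 2 by rewrite -[leLHS]real_normK ?num_real// ler_sqr ?nnegrE.
have e1 : 0 <= expR a <= 1 by rewrite expR_ge0 expR_le1.
have ea : `|expR a - 1| <= `|a|.
  rewrite distrC ger0_norm ?subr_ge0; last by have /andP[] := e1.
  by rewrite ler0_norm//; have := expR_ge1Dx a; lra.
have re : `|expR a * cos b - 1 - a| <= m ^+ 2 + m ^+ 2 / 2.
  have -> : expR a * cos b - 1 - a = (expR a - 1 - a) - expR a * (1 - cos b) by ring.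
  rewrite (le_trans (ler_normB _ _))// lerD ?(le_trans (expR_taylor1 a0))//.
  have c0 : 0 <= 1 - cos b by rewrite subr_ge0 cos_le1.
  rewrite ger0_norm; last by rewrite mulr_ge0 ?expR_ge0.
  have := one_sub_cos_le b; have /andP[_ e2] := e1; nra.
have im : `|expR a * sin b - 0 - b| <= m ^+ 2 + m ^+ 2 / 2.
  have -> : expR a * sin b - 0 - b = (expR a - 1) * sin b + (sin b - b) by ring.
  rewrite (le_trans (ler_normD _ _))// lerD//.
    rewrite normrM expr2 ler_pM//; first exact: le_trans ea hr.
    exact: le_trans (abs_sin_le _) hi.
  by rewrite (le_trans (sin_sub_id_le _))//; lra.
by have := lerD re im; have := sqr_ge0 m; rewrite ?oppr0 ?addr0 ?subr0; lra.
Qed.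

Lemma modulus_exprB z w n : modulus z <= 1 -> modulus w <= 1 ->
  modulus (z ^+ n - w ^+ n) <= n%:R * modulus (z - w).
Proof.
move=> z1 w1; elim: n => [|n IH].
  by rewrite !expr0 subrr modulusE Normc.normc0 mul0r.
have -> : z ^+ n.+1 - w ^+ n.+1 = z ^+ n * (z - w) + (z ^+ n - w ^+ n) * w.
  by rewrite !exprSr; ring.
rewrite (le_trans (modulusD _ _))// !modulusM -addn1 natrD mulrDl mul1r addrC lerD//.
  by rewrite -[leRHS]mulr1 ler_pM ?modulus_ge0.
rewrite modulusX -[leRHS]mul1r ler_wpM2r ?modulus_ge0//.
by rewrite exprn_ile1// modulus_ge0.
Qed.

(** The centring m may be much larger than 1/n: after multiplication by
    exp (-i m) it only enters the error through n m^2. *)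
Lemma compound_le (n : nat) (c : R[i]) (m : R) : (0 < n)%N -> modulus c <= 1 ->
  complex.Re c <= 1 ->
  modulus ((c * expC (0 -i* m)) ^+ n - expC (n%:R * (c - 1 - (0 +i* m)))) <=
  8 * (n%:R * m ^+ 2 + modulus (n%:R * (c - 1 - (0 +i* m))) ^+ 2 / n%:R).
Proof.
move=> n0 c1 rc; set w : R[i] := 0 +i* m; set y := c - 1 - w.
have rw : complex.Re w = 0 by [].
have rey : complex.Re y <= 0.
  by rewrite /y /w; case: (c) rc => a b /= ab; rewrite ?subr0 ?oppr0 ?addr0; lra.
have ew : modulus (expC w) = 1 by rewrite modulus_expC rw expR0.
have eNw : modulus (expC (0 -i* m)) = 1 by rewrite modulus_expC expR0.
have ye1 : modulus (expC y) <= 1 by rewrite modulus_expC expR_le1.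
have n0' : 0 < n%:R :> R by rewrite ltr0n.
rewrite expCMn; apply: (le_trans (modulus_exprB n _ ye1)).
  by rewrite modulusM eNw mulr1.
have E : modulus (c * expC (0 -i* m) - expC y) = modulus (c - expC (w + y)).
  rewrite -[RHS]mul1r -eNw -modulusM mulrBr -expCD; congr (modulus (_ - expC _)).
    exact: mulrC.
  rewrite addrA [X in X + _](_ : _ = 0) ?add0r//.
  by apply/eqP; rewrite eq_complex /= addr0 addNr !eqxx.
rewrite E (_ : c - expC (w + y) = - (expC (w + y) - 1 - (w + y))); last by rewrite /y; ring.
rewrite modulusN.
have h : modulus (expC (w + y) - 1 - (w + y)) <= 4 * modulus (w + y) ^+ 2.
  apply: expC_taylor1; move: rey; rewrite /w; case: (y) => a b /=; lra.
have mw : modulus w = `|m| by rewrite /modulus /w /= expr0n/= add0r sqrtr_sqr.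
have h2 : modulus (w + y) ^+ 2 <= 2 * (m ^+ 2 + modulus y ^+ 2).
  have := modulusD w y; have := modulus_ge0 (w + y); have := modulus_ge0 y.
  rewrite mw => y0 wy0 h3.
  have : modulus (w + y) ^+ 2 <= (`|m| + modulus y) ^+ 2.
    by rewrite ler_sqr ?nnegrE ?addr_ge0.
  have := sqr_ge0 (`|m| - modulus y); have : `|m| ^+ 2 = m ^+ 2 by rewrite real_normK ?num_real.
  by nra.
have mn : modulus (n%:R * y) = n%:R * modulus y.
  rewrite modulusM; congr (_ * _); rewrite modulusE.
  have -> : (n%:R : R[i]) = (n%:R)%:C by rewrite rmorph_nat.
  by rewrite /Normc.normc/= expr0n/= addr0 sqrtr_sqr ger0_norm.
rewrite mn exprMn -[X in _ <= 8 * (_ + X)]mulrA [_ * n%:R^-1]mulrC.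
have -> : n%:R ^+ 2 * (n%:R^-1 * modulus y ^+ 2) = n%:R * modulus y ^+ 2.
  by field; rewrite gt_eqF.
rewrite -mulrDr mulrCA ler_pM2l//; lra.
Qed.

Definition cvgC (z_ : nat -> R[i]) z :=
  (complex.Re (z_ N) @[N --> \oo] --> complex.Re z) /\
  (complex.Im (z_ N) @[N --> \oo] --> complex.Im z).

Lemma cvgC_modulus (z_ w_ : nat -> R[i]) z : cvgC w_ z ->
  modulus (z_ N - w_ N) @[N --> \oo] --> (0 : R) -> cvgC z_ z.
Proof.
move=> [hr hi] h.
have sq (f g : nat -> R) (l : R) : (g N @[N --> \oo] --> l) ->
    (forall N, `|f N - g N| <= modulus (z_ N - w_ N)) -> f N @[N --> \oo] --> l.
  move=> hg fg; have d0 : f N - g N @[N --> \oo] --> (0 : R).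
    apply/cvgrPdist_le => eps e0; have /cvgrPdist_le/(_ _ e0) := h.
    apply: filterS => N; rewrite !sub0r !normrN => /(le_trans _); apply.
    by rewrite (le_trans (fg N))// ler_norm.
  have : f N - g N + g N @[N --> \oo] --> 0 + l by exact: cvgD.
  by rewrite add0r; under eq_fun do rewrite subrK.
split; [apply: sq hr _|apply: sq hi _] => N.
  apply: le_trans (abs_Re_le _); by case: (z_ N) (w_ N) => ? ? [].
apply: le_trans (abs_Im_le _); by case: (z_ N) (w_ N) => ? ? [].
Qed.

Lemma cvgC_expC (z_ : nat -> R[i]) z : cvgC z_ z -> cvgC (expC \o z_) (expC z).
Proof.
move=> [hr hi]; split; rewrite /expC /=.
- apply: cvgM; first exact: (continuous_cvg _ (@continuous_expR R _) hr).
  exact: (continuous_cvg _ (@continuous_cos R _) hi).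
- apply: cvgM; first exact: (continuous_cvg _ (@continuous_expR R _) hr).
  exact: (continuous_cvg _ (@continuous_sin R _) hi).
Qed.

Lemma cvgyV0 (f : nat -> R) : f N @[N --> \oo] --> +oo ->
  (f N)^-1 @[N --> \oo] --> (0 : R).
Proof.
move=> hf; have /cvgryPgt/(_ 0) h0 := hf.
by apply/gtr0_cvgV0.
Qed.

Lemma compound_cvg (n : nat -> nat) (c : nat -> R[i]) (m : nat -> R) (z : R[i]) :
  (forall N, modulus (c N) <= 1) -> (forall N, complex.Re (c N) <= 1) ->
  (n N)%:R @[N --> \oo] --> (+oo : set_system R) ->
  (n N)%:R * m N ^+ 2 @[N --> \oo] --> (0 : R) ->
  cvgC (fun N => (n N)%:R * (c N - 1 - (0 +i* m N))) z ->
  cvgC (fun N => (c N * expC (0 -i* m N)) ^+ n N) (expC z).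
Proof.
move=> c1 rc nn nm hz; apply: cvgC_modulus (cvgC_expC hz) _.
have hmod : modulus ((n N)%:R * (c N - 1 - (0 +i* m N))) @[N --> \oo] --> modulus z.
  have [hr hi] := hz; rewrite /modulus.
  apply: (continuous_cvg _ (@sqrt_continuous R _)).
  by apply: cvgD; rewrite -?expr2; apply: cvgM.
have lim0 : 8 * ((n N)%:R * m N ^+ 2 +
    modulus ((n N)%:R * (c N - 1 - (0 +i* m N))) ^+ 2 / (n N)%:R) @[N --> \oo] --> (0 : R).
  rewrite -[X in _ --> X](mulr0 8); apply: cvgM; first exact: cvg_cst.
  rewrite -[X in _ --> X](addr0 0); apply: cvgD => //.
  rewrite -[X in _ --> X](mulr0 (modulus z ^+ 2)); apply: cvgM.
    by rewrite expr2; apply: cvgM.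
  exact: cvgyV0.
apply/cvgrPdist_le => eps e0; have /cvgrPdist_le/(_ _ e0) h := lim0.
near=> N.
have nN : (0 < n N)%N.
  by rewrite -(ltr_nat R); near: N; have /cvgryPgt := nn; apply.
rewrite sub0r normrN ger0_norm ?modulus_ge0//.
apply: (le_trans (compound_le (m N) nN (c1 N) (rc N))).
have : `|0 - 8 * ((n N)%:R * m N ^+ 2 +
    modulus ((n N)%:R * (c N - 1 - (0 +i* m N))) ^+ 2 / (n N)%:R)| <= eps by near: N.
by rewrite sub0r normrN => /(le_trans (ler_norm _)).
Unshelve. all: by end_near. Qed.

End ComplexExponential.

Local Close Scope complex_scope.

(** * Discretisation of independent families *)

Local Open Scope complex_scope.

Section Grid.
Context {R : realType} (delta : R) (m : nat) (delta0 : 0 < delta).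
Implicit Types x y : R.

(** A point of the grid: a sign and a number of steps, at most m. *)
Definition grid_state : finType := (bool * 'I_m.+1)%type.

Definition grid_index (y : R) : nat := minn m (Num.truncn (y / delta)).

Definition to_grid x : grid_state := (x < 0, inord (grid_index `|x|)).

Definition grid_value (s : grid_state) : R := (-1) ^+ s.1 * (delta * s.2%:R).

(** Rounding towards zero, truncated at m steps. *)
Definition round x : R := grid_value (to_grid x).

Lemma roundE x : round x = (-1) ^+ (x < 0)%R * (delta * (grid_index `|x|)%:R).
Proof. by rewrite /round /grid_value /= inordK// ltnS geq_minl. Qed.

Lemma grid_index_le y : 0 <= y -> delta * (grid_index y)%:R <= y.
Proof.
move=> y0; have yd : 0 <= y / delta by rewrite divr_ge0// ltW.
have /andP[h _] := truncn_itv yd.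
by rewrite mulrC -ler_pdivlMr// (le_trans _ h)// ler_nat geq_minr.
Qed.

Lemma abs_round_le x : `|round x| <= `|x|.
Proof.
rewrite roundE normrM normr_sign mul1r ger0_norm ?grid_index_le//.
by rewrite mulr_ge0// ltW.
Qed.

Lemma roundN x : round (- x) = - round x.
Proof.
rewrite !roundE normrN; have [-> |xn0] := eqVneq x 0.
  rewrite normr0 /grid_index mul0r.
  have -> : Num.truncn (0 : R) = 0%N by rewrite truncn0.
  by rewrite minn0 !mulr0 oppr0.
rewrite oppr_lt0; case: ltgtP xn0 => // _ _.
  by rewrite expr1 mulN1r expr0 mul1r.
by rewrite expr1 mulN1r expr0 mul1r opprK.
Qed.

Lemma round_close x : `|x| <= m%:R * delta -> `|round x - x| <= delta.
Proof.
move=> xm; have x0 := normr_ge0 x.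
have yd : 0 <= `|x| / delta by rewrite divr_ge0// ltW.
have idx : grid_index `|x| = Num.truncn (`|x| / delta).
  apply/minn_idPr; rewrite -(ler_nat R).
  have /andP[h _] := truncn_itv yd.
  by rewrite (le_trans h)// ler_pdivrMr.
have -> : round x - x = (-1) ^+ (x < 0)%R * (delta * (grid_index `|x|)%:R - `|x|).
  rewrite roundE mulrBr; congr (_ - _).
  by rewrite -[LHS]mulr_sign_norm; congr ((-1) ^+ _ * _).
rewrite normrM normr_sign mul1r idx distrC.
have /andP[h1 h2] := truncn_itv yd.
set k := Num.truncn _ in h1 h2 *.
have k1 : delta * k%:R <= `|x| by rewrite mulrC -ler_pdivlMr.
have k2 : `|x| < delta * k%:R + delta by rewrite -[X in _ + X]mulr1 -mulrDr natr1 mulrC -ltr_pdivrMr.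
by rewrite ger0_norm; lra.
Qed.

Lemma measurable_to_grid (s : grid_state) : measurable [set x | to_grid x = s].
Proof.
have mi : measurable_fun setT (fun x : R => (grid_index `|x|)%:R : R).
  apply: (@measurableT_comp _ _ _ _ _ _ (fun y : R => (grid_index y)%:R : R) _ (fun x => `|x|)) => //.
  apply: nondecreasing_measurable => // x y xy; rewrite ler_nat /grid_index.
  by rewrite leq_min geq_minl/= (leq_trans (geq_minr _ _))// le_truncn// ler_pM2r ?invr_gt0.
have ms : measurable_fun setT (fun x : R => (x < 0) == s.1).
  have mb : measurable_fun setT (fun x : R => x < 0) by exact: measurable_fun_ltr.
  case: s.1; first by under eq_fun do rewrite eqb_id.
  by under eq_fun do rewrite eqbF_neg; exact: measurable_neg.
have mk : measurable_fun setT (fun x : R => (grid_index `|x|)%:R == (s.2%:R : R)).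
  exact: measurable_fun_eqr.
have := measurable_and ms mk => /(_ measurableT [set true] I).
rewrite setTI; congr measurable; apply/seteqP; split => x /=.
  move=> /andP[/eqP h1 /eqP h2]; case: s h1 h2 {ms mk} => b k /= h1 h2.
  rewrite /to_grid h1; congr (_, _); apply: val_inj => /=.
  by rewrite inordK ?ltnS ?geq_minl//; apply/eqP; rewrite -(eqr_nat R); apply/eqP.
by move=> <- /=; rewrite eqxx inordK ?ltnS ?geq_minl// eqxx.
Qed.

End Grid.

Section FiniteLaw.
Context {R : realType}.
Context {d : measure_display} {T : measurableType d} (Q : probability T R).
Context (I : finType) (D : {set I}) (Z : I -> T -> R).
Context (mZ : forall i, measurable_fun setT (Z i)).
Context (ind : mutually_independent Q D Z).
Context {d0 : measure_display} {T0 : measurableType d0} (P : probability T0 R).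
Context (X : T0 -> R) (mX : measurable_fun setT X).
Context (law : forall i, i \in D -> same_law Q (Z i) P X).
Context (S : finType) (st : R -> S) (mst : forall s, measurable [set x | st x = s]).

Local Notation E := {i : I | i \in D}.

Definition state_prob (s : S) : R := mean P (fun w => (st (X w) == s)%:R).

Lemma bounded_measurable_state d1 (T1 : measurableType d1) (Y : T1 -> R) s :
  measurable_fun setT Y -> bounded_measurable (fun w => (st (Y w) == s)%:R : R).
Proof.
move=> mY; rewrite (_ : (fun w => _) = \1_(Y @^-1` [set x | st x = s])).
  by apply: bounded_measurable_indic; rewrite -[X in measurable X]setTI; exact: mY.
apply/funext => w; rewrite indicE; congr (_%:R); congr nat_of_bool.
by apply/eqP/idP => [h|]; [rewrite inE|rewrite inE].
Qed.

Lemma state_prob_ge0 s : 0 <= state_prob s.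
Proof. by apply: mean_ge0 => w. Qed.

Lemma state_mean (g : S -> R) :
  \sum_s state_prob s * g s = mean P (fun w => g (st (X w))).
Proof.
transitivity (mean P (fun w => \sum_s g s * (st (X w) == s)%:R)).
  rewrite mean_sum => [|s]; last exact/bounded_measurableZ/bounded_measurable_state.
  by apply: eq_bigr => s _; rewrite meanZ 1?mulrC//; exact: bounded_measurable_state.
congr mean; apply/funext => w; rewrite (bigD1 (st (X w)))//= eqxx mulr1.
by rewrite big1 ?addr0// => s /negPf; rewrite eq_sym => ->; rewrite mulr0.
Qed.

Lemma bounded_measurable_of_state d1 (T1 : measurableType d1) (Y : T1 -> R) (g : S -> R) :
  measurable_fun setT Y -> bounded_measurable (fun w => g (st (Y w))).
Proof.
move=> mY; rewrite (_ : (fun w => _) = fun w => \sum_s g s * (st (Y w) == s)%:R).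
  by apply: bounded_measurable_sum => s; exact/bounded_measurableZ/bounded_measurable_state.
apply/funext => w; rewrite (bigD1 (st (Y w)))//= eqxx mulr1.
by rewrite big1 ?addr0// => s /negPf; rewrite eq_sym => ->; rewrite mulr0.
Qed.

Lemma state_prob_sum : \sum_s state_prob s = 1.
Proof.
rewrite -[RHS](mean_cst P) -(state_mean (fun=> 1)).
by apply: eq_bigr => s _; rewrite mulr1.
Qed.

Definition family_state (w : T) : {ffun E -> S} := [ffun e => st (Z (val e) w)].

Lemma family_state_prob (s : {ffun E -> S}) :
  bounded_measurable (fun w => (family_state w == s)%:R : R) /\
  mean Q (fun w => (family_state w == s)%:R) = product_weight state_prob s.
Proof.
pose B i : set R := if insub i is Some e then [set x | st x = s e] else setT.
have mB i : measurable (B i) by rewrite /B; case: insubP => [e _ _|_]; [exact: mst|].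
have BE (e : E) : B (val e) = [set x | st x = s e] by rewrite /B valK.
have eqs : [set w | family_state w == s] =
    \bigcap_(i in [set` D]) Z i @^-1` B i.
  apply/seteqP; split => w /=.
    move=> /eqP ws i iD; have := congr1 (fun f : {ffun E -> S} => f (Sub i iD)) ws.
    by have := BE (Sub i iD); rewrite ffunE /= => -> .
  move=> h; apply/eqP/ffunP => e; rewrite ffunE.
  by have := h (val e) (valP e); rewrite /= BE.
have meqs : measurable [set w | family_state w == s].
  rewrite eqs; apply: fin_bigcap_measurable => // i _.
  by rewrite -[X in measurable X]setTI; exact: mZ.
split.
  rewrite (_ : (fun w => _) = \1_[set w | family_state w == s]).
    exact: bounded_measurable_indic.
  by apply/funext => w; rewrite indicE mem_setE.
rewrite mean_pred// eqs (ind (subxx _) mB) big_sub/=.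
have pE (e : E) : Q (Z (val e) @^-1` B (val e)) = (state_prob (s e))%:E.
  rewrite (law (valP e))// BE /state_prob.
  rewrite (_ : (fun w => _) = \1_(X @^-1` [set x | st x = s e])); last first.
    apply/funext => w; rewrite indicE; congr (_%:R); congr nat_of_bool.
    by apply/eqP/idP => [h|]; [rewrite inE|rewrite inE].
  have mE : measurable (X @^-1` [set x | st x = s e]).
    by rewrite -[X in measurable X]setTI; exact: mX.
  rewrite mean_indic// fineK//.
  exact: fin_num_measure.
under eq_bigr do rewrite pE.
by rewrite prodEFin.
Qed.

(** Independence on a finite state space is a product formula for weights, so
    that means of functions of the whole family are finite sums. *)
Lemma finite_law (F : {ffun E -> S} -> R) :
  mean Q (fun w => F (family_state w)) = product_mean state_prob F.
Proof.
transitivity (mean Q (fun w => \sum_s F s * (family_state w == s)%:R)).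
  congr mean; apply/funext => w; rewrite (bigD1 (family_state w))//= eqxx mulr1.
  by rewrite big1 ?addr0// => s /negPf; rewrite eq_sym => ->; rewrite mulr0.
rewrite mean_sum => [|s]; last by apply: bounded_measurableZ; have [] := family_state_prob s.
apply: eq_bigr => s _; have [bs <-] := family_state_prob s.
by rewrite meanZ// mulrC.
Qed.

End FiniteLaw.

Section GridExists.
Context {R : realType}.
Context {d0 : measure_display} {T0 : measurableType d0} (P : probability T0 R).
Context (X : T0 -> R) (mX : measurable_fun setT X).

Lemma fine_grid (eps : R) : 0 < eps -> exists delta m, [/\ 0 < delta, delta <= eps &
  mean P (fun w => (m%:R * delta < `|X w|)%R%:R) <= eps].
Proof.
move=> e0; pose f (n : nat) w : R := (n%:R * eps < `|X w|)%R%:R.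
have : mean P (f n) @[n --> \oo] --> (0 : R).
  rewrite -(mean_cst P 0); apply: (@mean_dominated _ _ _ _ _ _ 1).
  - move=> n; apply: bounded_measurable_pred; apply: measurable_fun_ltr => //.
    exact: measurableT_comp.
  - exact: bounded_measurable_cst.
  - by move=> n w; rewrite /f; case: (_ < _); rewrite ?normr1 ?normr0.
  move=> w; apply/cvgrPdist_le => e' e'0; near=> n.
  rewrite /f (_ : (_ < _) = false) ?mulr0n ?subrr ?normr0 ?ltW//.
  apply/negbTE; rewrite -leNgt -ler_pdivrMr//.
  have h : 0 <= `|X w| / eps by rewrite divr_ge0// ltW.
  rewrite (le_trans (ltW (archi_boundP h)))// ler_nat.
  by near: n; exists (Num.bound (`|X w| / eps)).
move=> /cvgrPdist_le/(_ _ e0)[n _ /(_ n (leqnn n))]/=.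
rewrite sub0r normrN => /(le_trans (ler_norm _)) h.
by exists eps, n.
Unshelve. all: by end_near. Qed.

End GridExists.

Section CharacteristicSum.
Context {R : realType}.
Context {d : measure_display} {T : measurableType d} (Q : probability T R).
Context (I : finType) (D : {set I}) (Z : I -> T -> R).
Context (mZ : forall i, measurable_fun setT (Z i)).
Context (ind : mutually_independent Q D Z).
Context {d0 : measure_display} {T0 : measurableType d0} (P : probability T0 R).
Context (X : T0 -> R) (mX : measurable_fun setT X).
Context (law : forall i, i \in D -> same_law Q (Z i) P X).

Definition characteristic {d1 : measure_display} {T1 : measurableType d1}
    (Q1 : probability T1 R) (Y : T1 -> R) : R[i] :=
  (mean Q1 (fun w => cos (Y w))) +i* (mean Q1 (fun w => sin (Y w))).

Lemma bounded_measurable_cosY d1 (T1 : measurableType d1) (Y : T1 -> R) :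
  measurable_fun setT Y -> bounded_measurable (fun w => cos (Y w)).
Proof.
move=> mY; split; first exact: measurableT_comp measurable_cos mY.
by exists 1 => w; rewrite ler_norml cos_geN1 cos_le1.
Qed.

Lemma bounded_measurable_sinY d1 (T1 : measurableType d1) (Y : T1 -> R) :
  measurable_fun setT Y -> bounded_measurable (fun w => sin (Y w)).
Proof.
move=> mY; split; first exact: measurableT_comp measurable_sin mY.
by exists 1 => w; rewrite ler_norml sin_geN1 sin_le1.
Qed.

(** The modulus is bounded by duality with a rotation. *)
Lemma modulus_characteristic d1 (T1 : measurableType d1) (Q1 : probability T1 R)
  (Y : T1 -> R) : measurable_fun setT Y -> modulus (characteristic Q1 Y) <= 1.
Proof.
move=> mY; set c := characteristic Q1 Y; set r := modulus c.
have bc := bounded_measurable_cosY mY; have bs := bounded_measurable_sinY mY.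
have key : r ^+ 2 <= r.
  have -> : r ^+ 2 = mean Q1 (fun w => complex.Re c * cos (Y w) + complex.Im c * sin (Y w)).
    rewrite meanD; try exact: bounded_measurableZ.
    by rewrite !meanZ// /r sqr_sqrtr ?addr_ge0 ?sqr_ge0// !expr2.
  rewrite -[leRHS](mean_cst Q1); apply: le_mean.
  - by apply: bounded_measurableD; exact: bounded_measurableZ.
  - exact: bounded_measurable_cst.
  - move=> w; rewrite (le_trans (ler_norm _))// /r -sqrtr_sqr ler_wsqrtr//.
    rewrite -[leRHS]mulr1 -(cos2Dsin2 (Y w)).
    have := sqr_ge0 (complex.Re c * sin (Y w) - complex.Im c * cos (Y w)); lra.
rewrite leNgt; apply/negP => r1.
by move: key; rewrite expr2 leNgt => /negP; apply; rewrite ltr_pMl// (lt_trans _ r1).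
Qed.

Lemma characteristic_dist d1 (T1 : measurableType d1) (Q1 : probability T1 R)
  (Y Y' : T1 -> R) (h : T1 -> R) : measurable_fun setT Y -> measurable_fun setT Y' ->
  bounded_measurable h -> (forall w, Num.min 2 `|Y w - Y' w| <= h w) ->
  modulus (characteristic Q1 Y - characteristic Q1 Y') <= 2 * mean Q1 h.
Proof.
move=> mY mY' bh hle; apply: (le_trans (modulus_le _)) => /=.
have h2 (x y : R) : `|x| <= 1 -> `|y| <= 1 -> `|x - y| <= 2.
  by move=> x1 y1; rewrite (le_trans (ler_normB _ _))//; lra.
have n1c (x : R) : `|cos x| <= 1 by rewrite ler_norml cos_geN1 cos_le1.
have n1s (x : R) : `|sin x| <= 1 by rewrite ler_norml sin_geN1 sin_le1.
have -> : 2 * mean Q1 h = mean Q1 h + mean Q1 h by ring.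
apply: lerD.
  apply: mean_dist => //; try exact: bounded_measurable_cosY.
  by move=> w; rewrite (le_trans _ (hle w))// le_min h2// cos_lip.
apply: mean_dist => //; try exact: bounded_measurable_sinY.
by move=> w; rewrite (le_trans _ (hle w))// le_min h2// sin_lip.
Qed.

Lemma product_mean_expC {E S : finType} (p : S -> R) (th : S -> R) :
  (product_mean p (fun s : {ffun E -> S} => cos (\sum_e th (s e)))) +i*
  (product_mean p (fun s : {ffun E -> S} => sin (\sum_e th (s e)))) =
  ((\sum_x p x * cos (th x)) +i* (\sum_x p x * sin (th x))) ^+ #|E|.
Proof.
have hsum (J : finType) (f g : J -> R) :
    (\sum_j f j) +i* (\sum_j g j) = \sum_j (f j +i* g j).
  elim/big_rec3: _ => [|j u1 u2 u3 _ <-]; first by [].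
  by apply/eqP; rewrite eq_complex /= !eqxx.
rewrite /product_mean !hsum -prodr_const bigA_distr_bigA/=.
apply: eq_bigr => s _.
have -> : \prod_e ((p (s e) * cos (th (s e))) +i* (p (s e) * sin (th (s e)))) =
    (\prod_e p (s e))%:C * expC (0 +i* (\sum_e th (s e))).
  elim/big_rec3: _ => [|e u1 u2 u3 _ ->].
    by rewrite -[0 +i* 0]/(0 : R[i]) expC0 mulr1.
  have -> : 0 +i* (th (s e) + u1) = (0 +i* th (s e)) + (0 +i* u1) :> R[i].
    by apply/eqP; rewrite eq_complex /= addr0 !eqxx.
  rewrite expCD rmorphM mulrACA; congr (_ * _).
  by apply/eqP; rewrite eq_complex /= expR0 !mul1r !mul0r subr0 addr0 !eqxx.
by apply/eqP; rewrite eq_complex /= expR0 !mul1r !mul0r subr0 addr0 !eqxx.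
Qed.

(** Exact on the grid; the error made by rounding is arbitrarily small. *)
Lemma characteristic_sum (g : R -> R) (K : R) : 0 <= K -> measurable_fun setT g ->
  (forall x y, `|g x - g y| <= K * `|x - y|) ->
  characteristic Q (fun w => \sum_(i in D) g (Z i w)) =
  characteristic P (g \o X) ^+ #|D|.
Proof.
move=> K0 mg lip; pose n := #|D|.
have mgX : measurable_fun setT (g \o X) by exact: measurableT_comp.
have mgZ i : measurable_fun setT (fun w => g (Z i w)) by exact: measurableT_comp.
have mS : measurable_fun setT (fun w => \sum_(i in D) g (Z i w)).
  under eq_fun do rewrite big_mkcond/=.
  apply: measurable_sum => i; case: (i \in D) => //.
set c := characteristic Q _; set c1 := characteristic P _.
suff H eps : 0 < eps -> modulus (c - c1 ^+ n) <= eps.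
  have : modulus (c - c1 ^+ n) = 0.
    apply/eqP; rewrite eq_le modulus_ge0 andbT leNgt; apply/negP => h.
    have h2 : 0 < modulus (c - c1 ^+ n) / 2 by rewrite divr_gt0.
    by have := H _ h2; lra.
  by rewrite modulusE => /Normc.eq0_normc/eqP; rewrite subr_eq0 => /eqP.
move=> e0.
pose q := (4 * n%:R + 1) * (K + 2).
have q0 : 0 < q by rewrite mulr_gt0// ?ltr_wpDl// mulr_ge0.
have eq0 : 0 < eps / q by rewrite divr_gt0.
have [delta [m [d1 d2 d3]]] := fine_grid P mX eq0.
pose rd := round delta m.
have card_E : #|{: {i : I | i \in D}}| = n by rewrite card_sig; apply: eq_card.
pose err (x : R) : R := K * delta + 2 * (m%:R * delta < `|x|)%R%:R.
have errP x : Num.min 2 `|g x - g (rd x)| <= err x.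
  rewrite /err; case: (ltP (m%:R * delta) `|x|) => h.
    by rewrite mulr1n mulr1 ge_min lerDr mulr_ge0 ?(ltW d1)//.
  rewrite mulr0n mulr0 addr0 ge_min (le_trans (lip _ _)) ?orbT// ler_wpM2l// distrC.
  exact: round_close.
have berr d2' (T2 : measurableType d2') (Y : T2 -> R) : measurable_fun setT Y ->
    bounded_measurable (fun w => err (Y w)).
  move=> mY; apply: bounded_measurableD; first exact: bounded_measurable_cst.
  apply: bounded_measurableZ; apply: bounded_measurable_pred.
  by apply: measurable_fun_ltr => //; exact: measurableT_comp.
have merr : mean P (err \o X) <= (K + 2) * (eps / q).
  have bt : bounded_measurable (fun w => (m%:R * delta < `|X w|)%R%:R : R).
    by apply: bounded_measurable_pred; apply: measurable_fun_ltr => //; exact: measurableT_comp.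
  rewrite /err /comp meanD; [|exact: bounded_measurable_cst|exact: bounded_measurableZ].
  rewrite mean_cst meanZ// [leRHS]mulrDl; apply: lerD; exact: ler_wpM2l.
have mst := @measurable_to_grid R delta m d1.
pose th (s : grid_state m) : R := g (grid_value delta s).
pose c' := characteristic Q (fun w => \sum_(i in D) g (rd (Z i w))).
pose c1' := characteristic P (fun w => g (rd (X w))).
have exact' : c' = c1' ^+ n.
  rewrite /c' /c1' /characteristic.
  have E1 (f : R -> R) : mean P (fun w => f (g (rd (X w)))) =
      \sum_s state_prob P X (to_grid delta m) s * f (th s).
    by rewrite (state_mean P mX mst (fun s => f (th s))).
  rewrite !(E1 cos) !(E1 sin) -card_E -product_mean_expC.
  have E2 (f : R -> R) : mean Q (fun w => f (\sum_(i in D) g (rd (Z i w)))) =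
     product_mean (state_prob P X (to_grid delta m)) (fun s : {ffun {i : I | i \in D} -> grid_state m} => f (\sum_e th (s e))).
    rewrite -(finite_law mZ ind mX law mst (fun s => f (\sum_e th (s e)))).
    congr mean; apply/funext => w; rewrite big_sub/=; congr f.
    by apply: eq_bigr => e _; rewrite ffunE.
  by rewrite !(E2 cos) !(E2 sin).
have mrd : measurable_fun setT (fun x => g (rd x)).
  by have [] := bounded_measurable_of_state mst th (@measurable_id _ _ setT).
have d1c : modulus (c1 - c1') <= 2 * ((K + 2) * (eps / q)).
  apply: (le_trans (characteristic_dist P (h := err \o X) mgX _ _ _)) => //.
  - exact: (measurableT_comp mrd mX).
  - exact: berr.
  - by move=> w; exact: errP.
  - by rewrite ler_wpM2l.
have dc : modulus (c - c') <= 2 * (n%:R * ((K + 2) * (eps / q))).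
  have bsum : bounded_measurable (fun w => \sum_(i in D) err (Z i w)).
    under eq_fun do rewrite big_mkcond/=.
    apply: bounded_measurable_sum => i; case: (i \in D); first exact: berr.
    exact: bounded_measurable_cst.
  apply: (le_trans (characteristic_dist Q (h := fun w => \sum_(i in D) err (Z i w)) mS _ _ _)) => //.
  - under eq_fun do rewrite big_mkcond/=.
    apply: measurable_sum => i; case: (i \in D) => //.
    exact: measurableT_comp mrd (mZ i).
  - move=> w; rewrite -sumrB.
    have minsum (J : finType) (A : pred J) (u v : J -> R) : (forall j, 0 <= v j) ->
       (forall j, Num.min 2 `|u j| <= v j) ->
       Num.min 2 `|\sum_(j | A j) u j| <= \sum_(j | A j) v j.
      move=> v0 uv; elim/big_rec2: _ => [|j y1 y2 _ IH].
        by rewrite normr0 ge_min lexx orbT.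
      have y20 : 0 <= y2 + v j \/ True by right.
      have := uv j; have := v0 j; move: IH; rewrite !ge_min.
      have := ler_normD (u j) y2; have h1 := normr_ge0 (u j); have h2 := normr_ge0 y2.
      move=> h3 /orP[h4|h4] h5 /orP[h6|h6]; apply/orP.
      + by left; lra.
      + by left; lra.
      + by left; lra.
      + by right; lra.
    apply: minsum => i //; rewrite /err addr_ge0// mulr_ge0// ltW//.
  rewrite ler_wpM2l//.
  rewrite (_ : mean Q _ = \sum_(i in D) mean Q (fun w => err (Z i w))); last first.
    transitivity (mean Q (fun w => \sum_i (if i \in D then err (Z i w) else 0))).
      by congr mean; apply/funext => w; rewrite big_mkcond.
    rewrite [RHS]big_mkcond/= mean_sum => [|i]; last first.
      by case: (i \in D); [exact: berr|exact: bounded_measurable_cst].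
    by apply: eq_bigr => i _; case: (i \in D) => //; rewrite mean_cst.
  rewrite (eq_bigr (fun=> mean P (err \o X))) => [|i iD]; last first.
    have berr0 : bounded_measurable err by apply: (berr _ _ (fun x : R => x)).
    exact: (mean_same_law (mZ i) mX (law iD) berr0).
  by rewrite sumr_const -/n -[leLHS]mulr_natl; exact: ler_wpM2l.
have dn : modulus (c1 ^+ n - c1' ^+ n) <= n%:R * (2 * ((K + 2) * (eps / q))).
  apply: (le_trans (modulus_exprB n _ _)).
  - exact: modulus_characteristic.
  - by apply: modulus_characteristic; exact: measurableT_comp mrd mX.
  - by rewrite ler_wpM2l.
have -> : c - c1 ^+ n = (c - c') - (c1 ^+ n - c1' ^+ n) by rewrite exact'; ring.
apply: (le_trans (modulusB _ _)).
have E : (4 * n%:R + 1) * ((K + 2) * (eps / q)) = eps.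
  by rewrite mulrA -/q mulrC divfK// gt_eqF.
have pos : 0 <= (K + 2) * (eps / q) by rewrite mulr_ge0 ?addr_ge0// ltW.
lra.
Qed.

End CharacteristicSum.

Local Close Scope complex_scope.

(** * Scaling limits of the heavy-tailed variable *)

Section StableLimit.
Context {R : realType} {d : measure_display} {T : measurableType d}.
Context (P : probability T R) (X : T -> R) (mX : measurable_fun setT X).
Context (alpha : R) (halpha : 0 < alpha < 2).
Local Notation G := (tail_mean P X).
Context (G_gt0 : forall x, 0 < x -> 0 < G x).
Context (G_ratio : forall t, 0 < t -> G (t * x) / G x @[x --> +oo] --> t `^ (- alpha)).
Context (a : nat -> R).
Context (a_above : forall k y, 0 < y -> a k < y -> k%:R * G y <= 1).
Context (a_below : forall k y, 0 < y -> y < a k -> 1 < k%:R * G y).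

Lemma small_powR (p c eps : R) : 0 < p -> 0 < c -> 0 < eps ->
  exists2 s, 0 < s <= 1 & c * s `^ p <= eps.
Proof.
move=> p0 c0 e0; have ec : 0 < eps / c by rewrite divr_gt0.
have y0 : 0 < (eps / c) `^ p^-1 by rewrite powR_gt0.
exists (Num.min 1 ((eps / c) `^ p^-1)).
  by rewrite lt_min ltr01 y0/= ge_min lexx.
rewrite mulrC -ler_pdivlMr//.
rewrite -[leRHS](_ : ((eps / c) `^ p^-1) `^ p = _); last first.
  by rewrite -powRrM mulVf ?gt_eqF// powRr1// ltW.
apply: ge0_ler_powR; rewrite ?nnegrE ?le_min ?ge_min ?lexx ?orbT ?ler01 ?(ltW y0)//.
exact: ltW.
Qed.

Lemma mean_levy_functional (c : R) (xi : T -> R) : 0 <= c -> measurable_fun setT xi ->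
  levy_functional (fun f => c * mean P (f \o xi)).
Proof.
move=> c0 mxi.
have bl (f : R -> R) : levy_class f -> bounded_measurable (f \o xi).
  by move=> lf; apply: bounded_measurable_comp => //; exact: levy_class_bounded.
split.
- by move=> f g lf lg; rewrite -mulrDr -(meanD P (bl _ lf) (bl _ lg)).
- by move=> b f lf; rewrite mulrCA -(meanZ P _ (bl _ lf)).
- by move=> f g lf lg fg; apply: ler_wpM2l => //; apply: le_mean => //;
    [exact: bl|exact: bl|move=> w; exact: fg].
Qed.

Context (k : nat -> nat) (k_cvgy : k N @[N --> \oo] --> \oo).
Context (c : R) (c0 : 0 < c) (delta : nat -> R) (delta0 : delta N @[N --> \oo] --> (0 : R)).
Context (xi : nat -> T -> R) (mxi : forall N, measurable_fun setT (xi N)).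
Context (xi_ge0 : forall N w, 0 <= xi N w).
Context (xi_near : \forall N \near \oo, forall w,
  c * (`|X w| / a (k N)) - delta N <= xi N w <= c * (`|X w| / a (k N))).

Local Notation nu := (fun N (f : R -> R) => (k N)%:R * mean P (f \o xi N)).
Local Notation Lam := (fun f : R -> R => c `^ alpha * stable_levy alpha f).

Lemma a_gt0 : \forall N \near \oo, 0 < a (k N).
Proof.
have h : a (k N) @[N --> \oo] --> +oo.
  exact: (cvg_comp _ _ k_cvgy (normalizer_cvgy G_gt0 a_above)).
by move: h => /cvgryPgt/(_ 0).
Qed.

Lemma nu_levy N : levy_functional (nu N).
Proof. exact: mean_levy_functional. Qed.

Lemma Lam_levy : levy_functional Lam.
Proof.
have [hD hZ hle] := stable_levy_functional halpha; have c1 := powR_ge0 c alpha.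
split.
- by move=> f g lf lg; rewrite hD// mulrDr.
- by move=> b f lf; rewrite hZ// mulrCA.
- by move=> f g lf lg fg; rewrite ler_wpM2l// hle.
Qed.

Lemma tail_scaled x : 0 < x ->
  (k N)%:R * G (a (k N) * (x / c)) @[N --> \oo] --> c `^ alpha * x `^ (- alpha).
Proof.
move=> x0.
have -> : c `^ alpha * x `^ (- alpha) = (x / c) `^ (- alpha).
  rewrite powRM ?invr_ge0 ?ltW// mulrC; congr (_ * _).
  by rewrite -powR_inv1 ?ltW// -powRrM mulN1r opprK.
have := tail_normalizer halpha G_gt0 G_ratio a_above a_below (divr_gt0 x0 c0).
exact: (cvg_comp _ _ k_cvgy).
Qed.

(** The vanishing error is absorbed by the continuity of the limiting tail. *)
Lemma scaled_tails x : 0 < x ->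
  nu N (fun y => (x < y)%R%:R) @[N --> \oo] --> Lam (fun y => (x < y)%R%:R).
Proof.
move=> x0; rewrite /= (stable_levy_gt halpha x0).
apply/cvgrPdist_le => e e0; have e2 : 0 < e / 2 by rewrite divr_gt0.
have bt (f : T -> R) y : measurable_fun setT f ->
    bounded_measurable (fun w => (y < f w)%R%:R : R).
  by move=> mf; apply: bounded_measurable_pred; exact: measurable_fun_ltr.
have mabs := measurable_abs mX.
have cont : {for x, continuous (fun y : R => c `^ alpha * y `^ (- alpha))}.
  by apply: cvgM; [exact: cvg_cst|exact: continuous_powR_gt0].
have [y xy hy] : exists2 y, x < y &
    `|c `^ alpha * x `^ (- alpha) - c `^ alpha * y `^ (- alpha)| <= e / 2.
  have /cvgrPdist_le/(_ _ e2)/nbhs_ballP[r r0 hr] := cont.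
  exists (x + r / 2); first by rewrite ltrDl divr_gt0.
  apply: hr; rewrite /ball/= opprD addrA subrr sub0r normrN gtr0_norm ?divr_gt0//.
  by rewrite ltr_pdivrMr// ltr_pMr// (ltrDl _ 1).
have y0 := lt_trans x0 xy.
have h1 := tail_scaled x0; have h2 := tail_scaled y0.
move: h1 h2 => /cvgrPdist_le/(_ _ e2) h1 /cvgrPdist_le/(_ _ e2) h2.
have hd : \forall N \near \oo, delta N <= y - x.
  have yx : 0 < y - x by rewrite subr_gt0.
  move: delta0 => /cvgrPdist_le/(_ _ yx); apply: filterS => N.
  by rewrite sub0r normrN => /(le_trans (ler_norm _)).
near=> N.
have aN : 0 < a (k N) by near: N; exact: a_gt0.
have xiN : forall w, c * (`|X w| / a (k N)) - delta N <= xi N w <= c * (`|X w| / a (k N)).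
  by near: N; exact: xi_near.
have H1 : `|c `^ alpha * x `^ (- alpha) - (k N)%:R * G (a (k N) * (x / c))| <= e / 2.
  by near: N; exact: h1.
have H2 : `|c `^ alpha * y `^ (- alpha) - (k N)%:R * G (a (k N) * (y / c))| <= e / 2.
  by near: N; exact: h2.
have dN : delta N <= y - x by near: N; exact: hd.
have cmp z w : (a (k N) * (z / c) < `|X w|) = (z < c * (`|X w| / a (k N))).
  by rewrite mulrA ltr_pdivrMr// mulrA ltr_pdivlMr// [z * _]mulrC [c * _]mulrC.
have up : (k N)%:R * mean P ((fun y => (x < y)%R%:R) \o xi N) <=
    (k N)%:R * G (a (k N) * (x / c)).
  apply: ler_wpM2l => //; apply: le_mean; [exact: bt|exact: bt|move=> w /=].
  case: (ltP x (xi N w)) => h; last by rewrite mulr0n ler0n.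
  by rewrite cmp (lt_le_trans h)//; have /andP[] := xiN w.
have dn : (k N)%:R * G (a (k N) * (y / c)) <=
    (k N)%:R * mean P ((fun y => (x < y)%R%:R) \o xi N).
  apply: ler_wpM2l => //; apply: le_mean; [exact: bt|exact: bt|move=> w /=].
  rewrite cmp; case: (ltP y (c * _)) => h; last by rewrite mulr0n ler0n.
  rewrite (_ : (x < _) = true)//; have /andP[h2' _] := xiN w; lra.
move: hy H1 H2; rewrite !ler_norml => /andP[? ?] /andP[? ?] /andP[? ?].
by apply/andP; split; lra.
Unshelve. all: by end_near. Qed.

(** Karamata's estimate at the scale a_k, where k G(a_k) is bounded: no mass of
    x^2 accumulates at zero, because alpha < 2. *)
Lemma scaled_small eps : 0 < eps -> exists2 s, 0 < s <= 1 &
  (\forall N \near \oo, nu N (fun x => between 0 s x * x ^+ 2) <= eps) /\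
  Lam (fun x => between 0 s x * x ^+ 2) <= eps.
Proof.
move=> e0; have a2 : 0 < 2 - alpha by move: halpha; lra.
have [C C0 hC] := truncated_square_normalizer mX halpha G_gt0 G_ratio a_above a_below.
pose C1 := c ^+ 2 * C * (2 / c) `^ (2 - alpha).
pose C2 := c `^ alpha * (alpha / (2 - alpha)).
have C10 : 0 < C1 by rewrite !mulr_gt0 ?exprn_gt0 ?powR_gt0 ?divr_gt0.
have C20 : 0 < C2 by rewrite !mulr_gt0 ?invr_gt0 ?powR_gt0//; case/andP: halpha.
have [s s01 hs] := small_powR a2 (addr_gt0 C10 C20) e0.
have sp := powR_gt0 (2 - alpha) (proj1 (andP s01)).
have s0 : 0 < s by case/andP: s01.
exists s => //; split; last first.
  apply: (le_trans (ler_wpM2l (powR_ge0 _ _) (stable_levy_sqr_le halpha s0))).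
  rewrite mulrA -/C2 (le_trans _ hs)// mulrDl lerDr mulr_ge0 ?ltW//.
have sc0 : 0 < s * (2 / c) by rewrite mulr_gt0// divr_gt0.
have hk : \forall N \near \oo, (k N)%:R *
    (truncated_square P X (a (k N) * (s * (2 / c))) / a (k N) ^+ 2) <=
    C * (s * (2 / c)) `^ (2 - alpha) by exact: (k_cvgy (hC _ sc0)).
have hd : \forall N \near \oo, delta N <= s.
  move: delta0 => /cvgrPdist_le/(_ _ s0); apply: filterS => N.
  by rewrite sub0r normrN => /(le_trans (ler_norm _)).
near=> N.
have aN : 0 < a (k N) by near: N; exact: a_gt0.
have xiN : forall w, c * (`|X w| / a (k N)) - delta N <= xi N w <= c * (`|X w| / a (k N)).
  by near: N; exact: xi_near.
have dN : delta N <= s by near: N; exact: hd.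
have HN : (k N)%:R * (truncated_square P X (a (k N) * (s * (2 / c))) / a (k N) ^+ 2) <=
    C * (s * (2 / c)) `^ (2 - alpha) by near: N; exact: hk.
have lc : levy_class (fun x : R => between 0 s x * x ^+ 2).
  split.
    apply: measurable_funM; first by have [] := @bounded_measurable_between R 0 s.
    by apply: measurable_funX; exact: measurable_id.
  exists 1 => x; rewrite mul1r /levy_weight /between.
  case: (ltP 0 x) => x0 /=; last by rewrite mul0r normr0.
  case: (leP x s) => xs /=; last by rewrite mul0r normr0 le_min sqr_ge0 ler01.
  rewrite mul1r ger0_norm ?sqr_ge0// le_min lexx/= expr_le1 ?(ltW x0)//.
  by rewrite (le_trans xs)//; case/andP: s01.
have bsq := bounded_measurable_square mX (a (k N) * (s * (2 / c))).
apply: (@le_trans _ _ ((k N)%:R * (c ^+ 2 *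
   (truncated_square P X (a (k N) * (s * (2 / c))) / a (k N) ^+ 2)))).
  apply: ler_wpM2l => //.
  have -> : c ^+ 2 * (truncated_square P X (a (k N) * (s * (2 / c))) / a (k N) ^+ 2) =
     mean P (fun w => (c ^+ 2 / a (k N) ^+ 2) *
        (between 0 (a (k N) * (s * (2 / c))) `|X w| * `|X w| ^+ 2)).
    by rewrite meanZ// /truncated_square mulrCA mulrC.
  apply: le_mean.
  - by apply: bounded_measurable_comp => //; exact: levy_class_bounded.
  - exact: bounded_measurableZ.
  move=> w /=; have x0 := xi_ge0 N w.
  have rhs0 : 0 <= c ^+ 2 / a (k N) ^+ 2 *
     (between 0 (a (k N) * (s * (2 / c))) `|X w| * `|X w| ^+ 2).
    exact: (mulr_ge0 (divr_ge0 (sqr_ge0 _) (sqr_ge0 _)) (mulr_ge0 (between_ge0 _ _ _) (sqr_ge0 _))).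
  rewrite {1}/between; case: (ltP 0 (xi N w)) => xp /=; last by rewrite mul0r.
  case: (leP (xi N w) s) => xs /=; last by rewrite mul0r.
  have /andP[l1 l2] := xiN w.
  have Xa : c * (`|X w| / a (k N)) <= 2 * s by lra.
  have Xp : 0 < c * (`|X w| / a (k N)) by lra.
  have Xw : 0 < `|X w|.
    by rewrite lt_neqAle normr_ge0 andbT eq_sym; apply/eqP => h; move: Xp; rewrite h mul0r mulr0 ltxx.
  have Xb : `|X w| <= a (k N) * (s * (2 / c)).
    have -> : a (k N) * (s * (2 / c)) = 2 * s * (a (k N) / c) by ring.
    have -> : `|X w| = c * (`|X w| / a (k N)) * (a (k N) / c) by field; rewrite !gt_eqF.
    by apply: ler_wpM2r => //; rewrite divr_ge0// ltW.
  rewrite /between Xw Xb/= !mul1r.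
  have -> : c ^+ 2 / a (k N) ^+ 2 * `|X w| ^+ 2 = (c * (`|X w| / a (k N))) ^+ 2.
    by rewrite !exprMn exprVn; ring.
  by rewrite lerXn2r ?nnegrE// ltW.
rewrite mulrCA (le_trans (ler_wpM2l (sqr_ge0 c) HN))//.
have sc : 0 <= 2 / c by rewrite divr_ge0// ltW.
rewrite (powRM _ (ltW s0) sc); apply: (le_trans _ hs).
rewrite (_ : _ * (C * _) = C1 * s `^ (2 - alpha)); last by rewrite /C1; ring.
by rewrite ler_wpM2r ?ltW// ltrDl.
Unshelve. all: by end_near. Qed.

Lemma Lam_large eps : 0 < eps -> exists2 M : R, 1 <= M &
  Lam (fun x => (M < x)%R%:R) <= eps.
Proof.
move=> e0; have ca : 0 < c `^ alpha by rewrite powR_gt0.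
have a0 : 0 < alpha by case/andP: halpha.
have := powRN_cvg0 a0 => /cvgrPdist_le/(_ _ (divr_gt0 e0 ca)) h.
have : \forall M \near +oo, 1 <= M /\ `|0 - M `^ (- alpha)| <= eps / c `^ alpha.
  by near=> M; split; near: M => //; exact: nbhs_pinfty_ge.
move=> /filter_ex[M [M1 hM]]; exists M => //.
rewrite /= (stable_levy_gt halpha (lt_le_trans ltr01 M1)) mulrC -ler_pdivlMr//.
by move: hM; rewrite sub0r normrN => /(le_trans (ler_norm _)).
Unshelve. all: by end_near. Qed.

(** The variables c |X| / a_k, up to an error that vanishes uniformly. *)
Theorem stable_limit (h : R -> R) (K : R) : levy_class h -> 0 <= K ->
  lipschitz_on h K 0 1 -> (forall M, 1 <= M -> lipschitz_on h K 1 M) ->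
  (k N)%:R * mean P (h \o xi N) @[N --> \oo] --> c `^ alpha * stable_levy alpha h.
Proof.
move=> lh K0 h01 h1.
exact: (levy_functional_cvg nu_levy Lam_levy scaled_tails lh K0 scaled_small
  Lam_large h01 h1).
Qed.

(** Centring terms are negligible after squaring: below a small threshold use
    the second moment, above it the tail, whose square is of order k^-2. *)
Lemma truncated_mean_sqr_cvg0 :
  (k N)%:R * mean P (fun w => xi N w * (xi N w <= 1)%R%:R) ^+ 2 @[N --> \oo] --> (0 : R).
Proof.
have kV : ((k N)%:R : R)^-1 @[N --> \oo] --> (0 : R).
  apply: cvgyV0; apply: (cvg_comp _ _ k_cvgy); exact: cvgr_idn.
apply/cvgrPdist_le => e e0; have e4 : 0 < e / 4 by rewrite divr_gt0.
have [s /andP[s0 s1] [hs _]] := scaled_small e4.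
have ht := scaled_tails s0.
set L0 := Lam _ in ht.
have hq : (k N)%:R * mean P ((fun y => (s < y)%R%:R) \o xi N) ^+ 2 @[N --> \oo] --> (0 : R).
  have : ((k N)%:R * mean P ((fun y => (s < y)%R%:R) \o xi N)) ^+ 2 * (k N)%:R^-1
      @[N --> \oo] --> L0 ^+ 2 * 0.
    by apply: cvgM => //; rewrite expr2; apply: cvgM.
  rewrite mulr0; apply: cvg_trans; apply: near_eq_cvg.
  have k0 : \forall N \near \oo, (0 < k N)%N by exact: (k_cvgy (nbhs_infty_gt 0)).
  apply: filterS k0 => N kN; have kn : (k N)%:R != 0 :> R by rewrite pnatr_eq0 -lt0n.
  by rewrite exprMn mulrAC; congr (_ * _); rewrite expr2 mulfK.
move: hq => /cvgrPdist_le/(_ _ e4) hq.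
near=> N.
have HS : (k N)%:R * mean P ((fun x => between 0 s x * x ^+ 2) \o xi N) <= e / 4.
  by near: N; exact: hs.
have HQ : `|0 - (k N)%:R * mean P ((fun y => (s < y)%R%:R) \o xi N) ^+ 2| <= e / 4.
  by near: N; exact: hq.
have mt (u : R) : measurable_fun setT (fun w => (xi N w <= u)%R%:R : R).
  apply: (measurableT_comp (f := fun b : bool => b%:R : R)) => //.
  exact: measurable_fun_ler.
have bt : bounded_measurable (fun w => (s < xi N w)%R%:R : R).
  by apply: bounded_measurable_pred; exact: measurable_fun_ltr.
have bu (u : R) : 0 <= u -> bounded_measurable (fun w => xi N w * (xi N w <= u)%R%:R).
  move=> u0; split; first exact: measurable_funM.
  exists u => w; have := xi_ge0 N w; case: (leP (xi N w) u) => xu x0.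
    by rewrite mulr1n mulr1 ger0_norm.
  by rewrite mulr0n mulr0 normr0.
pose f w := xi N w * (xi N w <= s)%R%:R.
have bf : bounded_measurable f by apply: bu; exact: ltW.
have bf2 : bounded_measurable (fun w => f w ^+ 2).
  by under eq_fun do rewrite expr2; exact: bounded_measurableM.
have m0 : 0 <= mean P (fun w => xi N w * (xi N w <= 1)%R%:R).
  by apply: mean_ge0 => w; rewrite mulr_ge0.
have split1 : mean P (fun w => xi N w * (xi N w <= 1)%R%:R) <=
    mean P f + mean P ((fun y => (s < y)%R%:R) \o xi N).
  rewrite -meanD//; apply: le_mean.
  - exact: bu.
  - exact: bounded_measurableD.
  move=> w /=; rewrite /f; have := xi_ge0 N w.
  case: (leP (xi N w) 1) => x1; case: (leP (xi N w) s) => xs x0;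
    rewrite ?mulr1n ?mulr0n ?mulr1 ?mulr0 ?addr0 ?add0r//; lra.
have jensen : mean P f ^+ 2 <= mean P (fun w => f w ^+ 2).
  have : 0 <= mean P (fun w => f w ^+ 2 - (2 * mean P f) * f w + mean P f ^+ 2).
    by apply: mean_ge0 => w; have := sqr_ge0 (f w - mean P f); lra.
  rewrite meanD; [|by apply: bounded_measurableB => //; exact: bounded_measurableZ
                 |exact: bounded_measurable_cst].
  rewrite meanB//; last exact: bounded_measurableZ.
  by rewrite meanZ// mean_cst; lra.
have f2E : (fun w => f w ^+ 2) = (fun x => between 0 s x * x ^+ 2) \o xi N.
  apply/funext => w /=; rewrite /f /between; have := xi_ge0 N w.
  rewrite le_eqVlt => /predU1P[<-|x0]; first by rewrite mul0r expr0n/= mulr0.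
  by rewrite x0/=; case: (_ <= s); rewrite ?mulr1n ?mulr0n ?mulr1 ?mul1r ?mulr0 ?mul0r ?expr0n.
rewrite f2E in jensen.
have k0 : 0 <= (k N)%:R :> R by [].
have := ler_wpM2l k0 jensen.
set M1 := mean P f in split1 jensen *; set M2 := mean P (_ \o xi N) in split1 HQ.
set M0 := mean P (fun w => xi N w * _) in m0 split1 *.
have sq : M0 ^+ 2 <= 2 * M1 ^+ 2 + 2 * M2 ^+ 2.
  have : M0 ^+ 2 <= (M1 + M2) ^+ 2 by rewrite lerXn2r ?nnegrE// (le_trans m0).
  by have := sqr_ge0 (M1 - M2); lra.
have := ler_wpM2l k0 sq; move: HQ HS.
rewrite !sub0r !normrN (ger0_norm (mulr_ge0 _ _)) ?sqr_ge0//.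
by rewrite ger0_norm ?mulr_ge0 ?sqr_ge0//; lra.
Unshelve. all: by end_near. Qed.

End StableLimit.

(** * The complete graph *)

Section CompleteGraph.
Context {R : realType} (N : nat).

Definition edge : finType := {e : 'I_N * 'I_N | e \in upper_pairs N}.
Definition source (e : edge) : 'I_N := (val e).1.
Definition target (e : edge) : 'I_N := (val e).2.

Lemma source_target (e : edge) : source e != target e.
Proof.
have := valP e; rewrite inE /source /target => h.
by apply/eqP => hE; rewrite hE ltnn in h.
Qed.

Lemma sum_pairs (f : 'I_N -> 'I_N -> R) : (forall i j, f i j = f j i) ->
  \sum_i \sum_j f i j = 2 * (\sum_(e : edge) f (source e) (target e)) + \sum_i f i i.
Proof.
move=> fC.
rewrite -(big_sub _ (fun e : 'I_N * 'I_N => f e.1 e.2)) pair_big/=.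
rewrite (bigID (mem (upper_pairs N)))/= mulrC mulrDr mulr1 -addrA; congr (_ + _).
rewrite (bigID (fun e : 'I_N * 'I_N => (e.2 < e.1)%N))/=; congr (_ + _).
  rewrite (reindex_inj (h := fun e : 'I_N * 'I_N => (e.2, e.1)))/=; last first.
    by move=> [i j] [i' j'] /= [-> ->].
  apply: eq_big => [[i j]|[i j] _] /=; last exact: fC.
  by rewrite !inE/= -leqNgt; case: (ltnP i j) => h; rewrite ?andbT ?andbF// ltnW.
rewrite (reindex (fun i : 'I_N => (i, i)))/=.
  by apply: eq_bigl => i; rewrite !inE/= ltnn.
exists (fun e : 'I_N * 'I_N => e.1) => [i _|[i j]] //=.
rewrite !inE/= -!leqNgt => /andP[h1 h2]; congr (_, _); apply: val_inj => /=.
by apply/eqP; rewrite eqn_leq h1 h2.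
Qed.

Lemma card_edge : #|{: edge}| = 'C(N, 2).
Proof.
have := sum_pairs (fun i j => erefl (1 : R)).
rewrite !sumr_const card_ord => h.
have : (N * N = 2 * #|{: edge}| + N)%N.
  apply/eqP; rewrite -(eqr_nat R) natrD !natrM; apply/eqP; move: h.
  rewrite -mulrnA -[(1 *+ (N * N))]/((N * N)%N%:R) natrM => ->; ring.
rewrite bin2 -divn2; move: #|{: edge}| => c H.
have -> : (N * N.-1 = c * 2)%N by nia.
by rewrite mulnK.
Qed.

Lemma binomial2E : 'C(N, 2)%:R = N%:R * (N%:R - 1) / 2 :> R.
Proof.
have := sum_pairs (fun i j => erefl (1 : R)).
rewrite !sumr_const card_ord card_edge -mulrnA -[(1 *+ (N * N))]/((N * N)%N%:R) natrM.
by move=> E; rewrite mulrBr mulr1 E; field.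
Qed.

Lemma sum_edge_spin_le (sigma : {ffun 'I_N -> bool}) :
  \sum_e edge_spin source target sigma e <= (\sum_i @spin R N sigma i) ^+ 2 / 2.
Proof.
have := sum_pairs (f := fun i j => @spin R N sigma i * @spin R N sigma j)
  (fun i j => mulrC _ _).
rewrite -/(edge_spin _ _ _).
have -> : \sum_i \sum_j @spin R N sigma i * @spin R N sigma j = (\sum_i @spin R N sigma i) ^+ 2.
  by rewrite expr2 mulr_suml; apply: eq_bigr => i _; rewrite mulr_sumr.
move=> ->; have : 0 <= \sum_i @spin R N sigma i * @spin R N sigma i.
  by apply: sumr_ge0 => i _; rewrite -expr2 sqr_ge0.
by rewrite /edge_spin; lra.
Qed.

(** An edge meets at most 4 N others: each shares one of two ends, in one of
    two positions. *)
Lemma sum_adjacent_edges_le :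
  \sum_e \sum_e' (~~ disjoint_edges source target e e')%:R <= 4 * N%:R ^+ 3 :> R.
Proof.
have sub (F : 'I_N * 'I_N -> R) : (forall e, 0 <= F e) ->
    \sum_(e : edge) F (val e) <= \sum_i \sum_j F (i, j).
  move=> F0; rewrite -(big_sub _ F).
  have -> : \sum_i \sum_j F (i, j) = \sum_e F e.
    by rewrite pair_big/=; apply: eq_bigr => -[].
  rewrite [leRHS](bigID (mem (upper_pairs N)))/= lerDl.
  by apply: sumr_ge0.
have src (i : 'I_N) : \sum_(e : edge) (source e == i)%:R <= N%:R :> R.
  apply: (le_trans (sub (fun e => (e.1 == i)%:R) _)) => //=.
  rewrite (bigD1 i)//= eqxx sumr_const card_ord big1 ?addr0// => j /negPf ->.
  by rewrite big1.
have tgt (i : 'I_N) : \sum_(e : edge) (target e == i)%:R <= N%:R :> R.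
  apply: (le_trans (sub (fun e => (e.2 == i)%:R) _)) => //=.
  rewrite exchange_big/= (bigD1 i)//= eqxx sumr_const card_ord big1 ?addr0// => j /negPf ->.
  by rewrite big1.
have row (e : edge) : \sum_e' (~~ disjoint_edges source target e e')%:R <= 4 * N%:R :> R.
  apply: (@le_trans _ _ (\sum_(e' : edge) (((source e' == source e)%:R + (target e' == source e)%:R) +
     ((source e' == target e)%:R + (target e' == target e)%:R)))).
    apply: ler_sum => e' _; rewrite /disjoint_edges.
    rewrite ![source e == _]eq_sym ![target e == _]eq_sym.
    by do 4![case: (_ == _)]; rewrite /= ?mulr1n ?mulr0n; lra.
  rewrite !big_split/=; have := src (source e); have := src (target e).
  by have := tgt (source e); have := tgt (target e); lra.
apply: (le_trans (ler_sum _ (fun e _ => row e))).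
rewrite sumr_const -[leLHS]mulr_natl.
have -> : 4 * N%:R ^+ 3 = N%:R ^+ 2 * (4 * N%:R) :> R by ring.
apply: ler_wpM2r; first by rewrite mulr_ge0.
have := sum_pairs (fun i j => erefl (1 : R)).
rewrite !sumr_const card_ord -mulrnA -[(1 *+ (N * N))]/((N * N)%N%:R) natrM => h.
by have := ler0n R #|{: edge}|; have := ler0n R N; rewrite expr2 h; lra.
Qed.

End CompleteGraph.

Section LogReduced.
Context {R : realType} {N : nat} {E : finType} (a b : E -> 'I_N) (beta : R).
Context (beta0 : 0 <= beta).

Definition log_reduced (x : E -> R) : R :=
  ln (reduced_partition a b (fun e => tanh (beta * x e))).

(** Each factor 1 + tanh (beta x_e) sigma changes by at most the factor
    exp (2 beta |x_e - y_e|), uniformly in the spins. *)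
Lemma log_reduced_lip (x y : E -> R) :
  log_reduced x <= log_reduced y + 2 * beta * \sum_e `|x e - y e|.
Proof.
have [_ _ hZ hle] := @spin_mean_expectation R N.
have pos z : 0 < reduced_partition a b (fun e => tanh (beta * z e)).
  apply: spin_mean_gt0 => sigma; apply: prodr_gt0 => e _.
  by apply: one_add_tanh_gt0; exact: norm_edge_spin.
rewrite /log_reduced -[X in _ + X]expRK -lnM ?posrE ?expR_gt0//.
rewrite ler_ln ?posrE ?mulr_gt0 ?expR_gt0// mulrC /reduced_partition -hZ.
apply: hle => sigma.
rewrite mulr_sumr expR_sum -big_split/=; apply: ler_prod => e _; apply/andP; split.
  by apply: ltW; apply: one_add_tanh_gt0; exact: norm_edge_spin.
rewrite /edge_spin /spin -signr_addb (le_trans (one_add_tanh_le _ (beta * y e) _))//.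
by rewrite -mulrBr normrM (ger0_norm beta0) mulrA.
Qed.

Lemma measurable_log_reduced {d : measure_display} {T : measurableType d}
    (X : E -> T -> R) : (forall e, measurable_fun setT (X e)) ->
  measurable_fun setT (fun w => log_reduced (fun e => X e w)).
Proof.
move=> mX; apply: (measurableT_comp (f := @ln R)); first exact: measurable_ln.
rewrite /reduced_partition /product_mean; apply: measurable_sum => sigma.
apply: measurable_funM => //; apply: measurable_prod => e _.
apply: measurable_funD => //; apply: measurable_funM => //.
apply: (measurableT_comp (f := @tanh R)); first exact: measurable_tanh.
exact: measurable_funM.
Qed.

End LogReduced.

(** * Tail bounds for the reduced partition function *)

Section ReducedPartitionTails.
Context {R : realType} (N : nat).
Context {d : measure_display} {T : measurableType d} (Q : probability T R).
Context (J : 'I_N * 'I_N -> T -> R).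
Context (mJ : forall e, measurable_fun setT (J e)).
Context (ind : mutually_independent Q (upper_pairs N) J).
Context {d0 : measure_display} {T0 : measurableType d0} (P : probability T0 R).
Context (W : T0 -> R) (mW : measurable_fun setT W).
Context (W_sym : same_law P W P (fun w => - W w)).
Context (law : forall e, e \in upper_pairs N -> same_law Q (J e) P W).
Context (beta : R) (beta0 : 0 <= beta).

Local Notation E := (edge N).
Local Notation lnZ := (fun w => log_reduced (@source N) (@target N) beta
  (fun e : E => J (val e) w)).

Section Rounded.
Context (delta : R) (m : nat) (delta0 : 0 < delta).

Local Notation rd := (round delta m).
Local Notation st := (to_grid delta m).
Local Notation p := (state_prob P W st).

Definition scaled_grid_value (s : grid_state m) : R := beta * grid_value delta s.
Local Notation v := scaled_grid_value.

Let mst := @measurable_to_grid R delta m delta0.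

Lemma measurable_round : measurable_fun setT rd.
Proof.
by have [] := bounded_measurable_of_state mst (fun s => grid_value delta s) (@measurable_id _ _ setT).
Qed.

Lemma mean_odd (g : R -> R) : bounded_measurable g -> (forall x, g (- x) = - g x) ->
  mean P (g \o W) = 0.
Proof.
move=> bg og; have mNW : measurable_fun setT (fun w => - W w) by exact: measurableT_comp.
have := mean_same_law mW mNW W_sym bg.
have -> : g \o (fun w => - W w) = (fun w => (-1) * (g \o W) w).
  by apply/funext => w /=; rewrite og mulN1r.
rewrite meanZ; last exact: bounded_measurable_comp.
lra.
Qed.

Lemma p_ge0 s : 0 <= p s. Proof. exact: state_prob_ge0. Qed.
Lemma p_sum : \sum_s p s = 1. Proof. exact: state_prob_sum. Qed.

Lemma grid_odd_mean : \sum_s p s * tanh (v s) = 0.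
Proof.
rewrite (state_mean P mW mst (fun s => tanh (v s))).
apply: (mean_odd (g := fun x => tanh (beta * rd x))).
  exact: (bounded_measurable_of_state mst (fun s => tanh (v s)) (@measurable_id _ _ setT)).
by move=> x; rewrite roundN mulrN tanhN.
Qed.

Lemma grid_tanh_sqr_le :
  \sum_s p s * tanh (v s) ^+ 2 <= mean P (fun w => tanh (beta * W w) ^+ 2).
Proof.
rewrite (state_mean P mW mst (fun s => tanh (v s) ^+ 2)); apply: le_mean.
- exact: (bounded_measurable_of_state mst (fun s => tanh (v s) ^+ 2) mW).
- split.
    apply: measurable_funX; apply: (measurableT_comp (f := @tanh R)); first exact: measurable_tanh.
    exact: measurable_funM.
  by exists 1 => w; rewrite normrX expr_le1// ltW// tanh_lt1.
move=> w; have abs_tanh (x : R) : `|tanh x| = tanh `|x|.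
  by case: (ltrgtP 0 x) => [h|h|<-]; rewrite ?normr0 ?tanh0 ?normr0//;
    [rewrite !ger0_norm ?ge0_tanh ?ltW|
     rewrite [in RHS]ltr0_norm// tanhN -normrN ger0_norm// -tanhN ge0_tanh// oppr_ge0 ltW].
rewrite -[leLHS]real_normK ?num_real// -[leRHS]real_normK ?num_real//.
rewrite lerXn2r ?nnegrE// !abs_tanh; apply: tanh_homo.
rewrite /scaled_grid_value [leLHS]normrM [leRHS]normrM ler_wpM2l//.
exact: (@abs_round_le R delta m delta0 (W w)).
Qed.

Context (l : R) (l0 : 0 < l).

Definition small_state : pred (grid_state m) := [pred s | `|grid_value delta s| <= l].
Local Notation sm := small_state.

Local Notation q := (mean P (fun w => (l < `|W w|)%R%:R)).

Lemma bounded_measurable_q : bounded_measurable (fun w => (l < `|W w|)%R%:R : R).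
Proof. exact: bounded_measurable_tail. Qed.

Lemma grid_large_le : \sum_(s | ~~ sm s) p s <= q.
Proof.
rewrite big_mkcond/=.
have -> : \sum_s (if ~~ sm s then p s else 0) = \sum_s p s * (~~ sm s)%:R.
  by apply: eq_bigr => s _; case: (~~ _); rewrite ?mulr1 ?mulr0.
rewrite (state_mean P mW mst (fun s => (~~ sm s)%:R)); apply: le_mean.
- exact: (bounded_measurable_of_state mst (fun s => (~~ sm s)%:R) mW).
- exact: bounded_measurable_q.
move=> w /=; rewrite -/(rd (W w)) -ltNge.
case: (ltP l `|rd (W w)|) => h; last by rewrite ler0n.
by rewrite (_ : (l < `|W w|) = true)// (lt_le_trans h)// abs_round_le.
Qed.

Lemma grid_small_ge : q <= 2^-1 -> 2^-1 <= \sum_(s | sm s) p s.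
Proof.
move=> q2; have := grid_large_le; have := p_sum.
by rewrite (bigID sm)/=; lra.
Qed.

Lemma grid_odd_small : \sum_(s | sm s) p s * tanh (v s) = 0.
Proof.
rewrite big_mkcond/=.
have -> : \sum_s (if sm s then p s * tanh (v s) else 0) =
    \sum_s p s * ((sm s)%:R * tanh (v s)).
  by apply: eq_bigr => s _; case: (sm s); rewrite ?mul1r ?mul0r ?mulr0.
rewrite (state_mean P mW mst (fun s => (sm s)%:R * tanh (v s))).
apply: (mean_odd (g := fun x => (`|rd x| <= l)%R%:R * tanh (beta * rd x))).
  exact: (bounded_measurable_of_state mst (fun s => (sm s)%:R * tanh (v s)) (@measurable_id _ _ setT)).
by move=> x; rewrite roundN normrN mulrN tanhN mulrN.
Qed.

Definition truncated_variance : R :=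
  mean P (fun w => between 0 l `|W w| * `|W w| ^+ 2) + l ^+ 2 * q.

(** Rounding decreases absolute values, so the small grid values are bounded by
    the true value when it is small, and by l otherwise. *)
Lemma grid_small_mean_le : q <= 2^-1 ->
  small_mean p sm (fun s => v s ^+ 2) <= 2 * beta ^+ 2 * truncated_variance.
Proof.
move=> q2; rewrite /small_mean; have ps := grid_small_ge q2.
have p0 : 0 < \sum_(s | sm s) p s by lra.
have h : \sum_(s | sm s) p s * v s ^+ 2 <= beta ^+ 2 * truncated_variance.
  rewrite big_mkcond/=.
  have -> : \sum_s (if sm s then p s * v s ^+ 2 else 0) =
      \sum_s p s * ((sm s)%:R * v s ^+ 2).
    by apply: eq_bigr => s _; case: (sm s); rewrite ?mul1r ?mul0r ?mulr0.
  rewrite (state_mean P mW mst (fun s => (sm s)%:R * v s ^+ 2)) /truncated_variance.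
  have bq := bounded_measurable_q; have bs := bounded_measurable_square mW l.
  rewrite -(meanZ _ (l ^+ 2) bq) -meanD//; last exact: bounded_measurableZ.
  rewrite -meanZ; last by apply: bounded_measurableD => //; exact: bounded_measurableZ.
  apply: le_mean.
  - exact: (bounded_measurable_of_state mst (fun s => (sm s)%:R * v s ^+ 2) mW).
  - by apply: bounded_measurableZ; apply: bounded_measurableD => //; exact: bounded_measurableZ.
  move=> w; rewrite /scaled_grid_value -/(rd (W w)) exprMn mulrCA ler_wpM2l ?sqr_ge0//.
  have hr := abs_round_le m delta0 (W w); have rr := normr_ge0 (rd (W w)).
  rewrite /= -/(rd (W w)) -[rd (W w) ^+ 2]real_normK ?num_real//.
  have -> : sm (st (W w)) = (`|rd (W w)| <= l) by [].
  have [rl|rl] := leP `|rd (W w)| l; last first.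
    rewrite mulr0n mul0r addr_ge0//; apply: mulr_ge0 => //; exact: sqr_ge0.
  rewrite mulr1n mul1r /between; have [lW|Wl] := ltP l `|W w|.
    rewrite andbF mulr0n mul0r add0r mulr1n mulr1.
    by rewrite lerXn2r ?nnegrE// ltW.
  rewrite andbT mulr0n mulr0 addr0; have [W0|W0] := ltP 0 `|W w|.
    by rewrite mulr1n mul1r lerXn2r ?nnegrE.
  by rewrite (_ : `|rd (W w)| = 0) ?expr0n ?mulr0n ?mul0r//; apply/eqP; rewrite eq_le rr andbT; lra.
have tv0 : 0 <= \sum_(s | sm s) p s * v s ^+ 2.
  by apply: sumr_ge0 => s _; apply: mulr_ge0; [exact: p_ge0|exact: sqr_ge0].
have -> : 2 * beta ^+ 2 * truncated_variance = 2 * (beta ^+ 2 * truncated_variance) by ring.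
apply: ler_pM => //; first by rewrite invr_ge0 ltW.
by rewrite -[leRHS]invrK lef_pV2 ?posrE ?invr_gt0.
Qed.

Lemma family_state_log_reduced w :
  log_reduced (@source N) (@target N) beta (fun e : E => rd (J (val e) w)) =
  ln (random_partition (@source N) (@target N) v (family_state (upper_pairs N) J st w)).
Proof.
rewrite /log_reduced /random_partition; congr ln; congr reduced_partition.
by apply/funext => e; rewrite ffunE.
Qed.

End Rounded.

(** The law of the couplings is replaced by its rounding to a grid so fine that
    the logarithm moves by at most 1, except when a coupling leaves the grid. *)
Lemma mean_rounded (eps : R) : 0 < eps -> exists delta m, 0 < delta /\
  forall y z : R,
  mean Q (fun w => (y + 1 < lnZ w)%R%:R) <= eps +
    mean Q (fun w => (y < log_reduced (@source N) (@target N) beta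
       (fun e : E => round delta m (J (val e) w)))%R%:R) /\
  mean Q (fun w => (lnZ w < z - 1)%R%:R) <= eps +
    mean Q (fun w => (log_reduced (@source N) (@target N) beta
       (fun e : E => round delta m (J (val e) w)) < z)%R%:R).
Proof.
move=> e0; pose n : R := #|{: E}|%:R.
have n0 : 0 <= n by exact: ler0n.
have c1 : 0 < eps / (n + 1) by rewrite divr_gt0// ltr_wpDl.
have bn0 : 0 <= 2 * beta * n by rewrite !mulr_ge0.
have c2 : 0 < (2 * beta * n + 1)^-1 by rewrite invr_gt0 ltr_wpDl.
have c0 : 0 < Num.min (eps / (n + 1)) (2 * beta * n + 1)^-1 by rewrite lt_min c1.
have [delta [m [d1 d2 d3]]] := fine_grid P mW c0.
exists delta, m; split => //.
have {}d2 : 2 * beta * n * delta <= 1.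
  have : delta <= (2 * beta * n + 1)^-1 by rewrite (le_trans d2)// ge_min lexx orbT.
  rewrite -[leRHS]div1r ler_pdivlMr ?ltr_wpDl// => h.
  by rewrite (le_trans _ h)// mulrC mulrDr mulr1 lerDl ltW.
have {}d3 : n * mean P (fun w => (m%:R * delta < `|W w|)%R%:R) <= eps.
  have : mean P (fun w => (m%:R * delta < `|W w|)%R%:R) <= eps / (n + 1).
    by rewrite (le_trans d3)// ge_min lexx.
  rewrite ler_pdivlMr ?ltr_wpDl// => h; rewrite (le_trans _ h)// mulrC mulrDr mulr1 lerDl.
  by apply: mean_ge0.
pose ov w : R := \sum_(e : E) (m%:R * delta < `|J (val e) w|)%R%:R.
have bt d' (T' : measurableType d') (f : T' -> R) : measurable_fun setT f ->
    bounded_measurable (fun w => (m%:R * delta < `|f w|)%R%:R : R).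
  by move=> mf; apply: bounded_measurable_pred; apply: measurable_fun_ltr => //; exact: measurableT_comp.
have bov : bounded_measurable ov by apply: bounded_measurable_sum => e; exact: bt.
have mov : mean Q ov <= eps.
  rewrite /ov mean_sum => [|e]; last exact: bt.
  rewrite (eq_bigr (fun=> mean P (fun w => (m%:R * delta < `|W w|)%R%:R))) => [|e _].
    by rewrite sumr_const -[leLHS]mulr_natl.
  exact: (mean_same_law (h := fun x => (m%:R * delta < `|x|)%R%:R) (mJ (val e)) mW
    (law (valP e)) (bt _ _ _ (@measurable_id _ _ setT))).
have close w : ov w < 1 -> \sum_(e : E) `|J (val e) w - round delta m (J (val e) w)| <= n * delta.
  move=> ow; rewrite /n mulr_natl -sumr_const; apply: ler_sum => e _.
  rewrite distrC round_close// leNgt; apply/negP => h; move: ow; rewrite ltNge => /negP; apply.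
  rewrite /ov (bigD1 e)//= h mulr1n lerDl; exact: sumr_ge0.
have ov0 w : 0 <= ov w by apply: sumr_ge0.
pose lr w := log_reduced (@source N) (@target N) beta
  (fun e : E => round delta m (J (val e) w)).
have mlr : measurable_fun setT lr.
  apply: measurable_log_reduced => e; apply: measurableT_comp => //.
  exact: measurable_round.
have mlz : measurable_fun setT lnZ by apply: measurable_log_reduced => e; exact: mJ.
have dist w : ov w < 1 -> lnZ w <= lr w + 1 /\ lr w <= lnZ w + 1.
  move=> ow; have := close w ow; set s := \sum_(e : E) _ => hs.
  have hb : 2 * beta * s <= 1.
    by rewrite (le_trans _ d2)// -[leRHS]mulrA ler_wpM2l// mulr_ge0.
  have le1 u v : u <= v + 2 * beta * s -> u <= v + 1.
    by move=> /le_trans; apply; rewrite lerD2l.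
  split; apply: le1; first exact: log_reduced_lip.
  rewrite /s (eq_bigr (fun e : E => `|round delta m (J (val e) w) - J (val e) w|)).
    exact: log_reduced_lip.
  by move=> e _; exact: distrC.
have bl (f g : T -> R) : measurable_fun setT f -> measurable_fun setT g ->
    bounded_measurable (fun w => (f w < g w)%R%:R : R).
  by move=> mf mg; apply: bounded_measurable_pred; exact: measurable_fun_ltr.
move=> y z; rewrite -/lr; split.
  rewrite [leRHS]addrC; apply: (@le_trans _ _ (mean Q (fun w => (y < lr w)%R%:R + ov w))); last first.
    by rewrite meanD//; [rewrite lerD2l|exact: bl].
  apply: le_mean; [exact: bl|by apply: bounded_measurableD => //; exact: bl|move=> w].
  have := ov0 w; case: (ltP (y + 1) (lnZ w)) => h1; case: (ltP y (lr w)) => h2;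
    rewrite ?mulr1n ?mulr0n ?add0r ?lerDl// => o0; last by rewrite addr_ge0.
  by rewrite leNgt; apply/negP => /dist[h3 h4]; move: h1 h2 h3; lra.
rewrite [leRHS]addrC; apply: (@le_trans _ _ (mean Q (fun w => (lr w < z)%R%:R + ov w))); last first.
  by rewrite meanD//; [rewrite lerD2l|exact: bl].
apply: le_mean; [exact: bl|by apply: bounded_measurableD => //; exact: bl|move=> w].
have := ov0 w; case: (ltP (lnZ w) (z - 1)) => h1; case: (ltP (lr w) z) => h2;
  rewrite ?mulr1n ?mulr0n ?add0r ?lerDl// => o0; last by rewrite addr_ge0.
by rewrite leNgt; apply/negP => /dist[h3 h4]; move: h1 h2 h3 h4; lra.
Qed.

Lemma log_reduced_upper_tail (y eps : R) : 0 < eps ->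
  mean Q (fun w => (y + 1 < lnZ w)%R%:R) <= eps + expR (- y).
Proof.
move=> e0; have [delta [m [d0' H]]] := mean_rounded e0.
have [h _] := H y 0; apply: (le_trans h); rewrite lerD2l.
rewrite (_ : (fun w => _) = fun w => (y < ln (random_partition (@source N) (@target N)
    (@scaled_grid_value delta m) (family_state (upper_pairs N) J (to_grid delta m) w)))%R%:R); last first.
  by apply/funext => w; rewrite family_state_log_reduced.
rewrite (finite_law mJ ind mW law (@measurable_to_grid R delta m d0') (fun s =>
  (y < ln (random_partition (@source N) (@target N) (@scaled_grid_value delta m) s))%R%:R)).
by apply: random_partition_upper_tail; [exact: p_ge0|exact: p_sum|exact: grid_odd_mean].
Qed.

Lemma log_reduced_lower_tail (l r eps x : R) : 0 < l -> 0 < eps -> 0 < x ->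
  mean P (fun w => (l < `|W w|)%R%:R) <= 2^-1 ->
  N%:R * mean P (fun w => tanh (beta * W w) ^+ 2) <= r -> r < 1 ->
  let V := 32 * beta ^+ 2 * ('C(N, 2)%:R * truncated_variance l) in
  4 * (expR (2^-1 * (r / (1 - r))) / eps) * V < x ^+ 2 ->
  mean Q (fun w => (lnZ w < - ln 2 - 2 * x - 1)%R%:R) <=
  eps + (V / x ^+ 2 + 4 * N%:R ^+ 3 * mean P (fun w => (l < `|W w|)%R%:R) ^+ 2 + eps).
Proof.
move=> l0 e0 x0 q2 Nr r1 V Vx; have [delta [m [d0' H]]] := mean_rounded e0.
have [_ h] := H 0 (- ln 2 - 2 * x); apply: (le_trans h); rewrite lerD2l.
rewrite (_ : (fun w => _) = fun w => (ln (random_partition (@source N) (@target N)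
    (@scaled_grid_value delta m) (family_state (upper_pairs N) J (to_grid delta m) w)) <
    - ln 2 - 2 * x)%R%:R); last first.
  by apply/funext => w; rewrite family_state_log_reduced.
rewrite (finite_law mJ ind mW law (@measurable_to_grid R delta m d0') (fun s =>
  (ln (random_partition (@source N) (@target N) (@scaled_grid_value delta m) s) < - ln 2 - 2 * x)%R%:R)).
set p := state_prob _ _ _; set sm := @small_state delta m l.
have sp : 0 < \sum_(s | sm s) p s by have := @grid_small_ge delta m d0' l q2; rewrite -/p -/sm; lra.
set V' := #|{: E}|%:R * (16 * small_mean p sm (fun s => @scaled_grid_value delta m s ^+ 2)).
have VV : V' <= V.
  have -> : V = 'C(N, 2)%:R * (16 * (2 * beta ^+ 2 * truncated_variance l)) by rewrite /V; ring.
  rewrite /V' (@card_edge R); do 2![apply: ler_wpM2l => //].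
  exact: (@grid_small_mean_le delta m d0' l l0 q2).
have c0 : 0 <= 4 * (expR (2^-1 * (r / (1 - r))) / eps).
  by rewrite mulr_ge0// divr_ge0 ?expR_ge0 ?ltW.
have := random_partition_lower_tail (@source_target N) (@sum_edge_spin_le R N)
  (@p_ge0 delta m) (@p_sum delta m d0') (@grid_odd_mean delta m d0') sp (@grid_odd_small delta m d0' l)
  (@sum_adjacent_edges_le R N) (le_trans (ler_wpM2l (ler0n R N) (@grid_tanh_sqr_le delta m d0')) Nr)
  r1 e0 x0 (le_lt_trans (ler_wpM2l c0 VV) Vx).
move=> /le_trans; apply; rewrite -/V' lerD2r lerD//.
  by rewrite ler_wpM2r// invr_ge0 sqr_ge0.
rewrite ler_wpM2l// ?mulr_ge0 ?exprn_ge0//.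
rewrite lerXn2r ?nnegrE//; first by apply: sumr_ge0 => s _; exact: p_ge0.
  exact: mean_ge0.
exact: grid_large_le.
Qed.

End ReducedPartitionTails.

(** * The normalizing sequence *)

Lemma binomial2_cvgy : 'C(N, 2) @[N --> \oo] --> \oo.
Proof.
apply/cvgnyPge => m; near=> N; have N3 : (m + 3 <= N)%N by near: N; exact: nbhs_infty_ge.
rewrite bin2 -divn2 leq_divRL//.
have h : (m * 2 <= (m + 3) * (m + 2))%N by nia.
by apply: (leq_trans h); apply: leq_mul => //; lia.
Unshelve. all: by end_near. Qed.

Lemma near_binomial2 (Q : nat -> Prop) :
  (\forall k \near \oo, Q k) -> \forall N \near \oo, Q 'C(N, 2).
Proof. by move=> h; exact: (binomial2_cvgy h). Qed.

Section Normalizer.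
Context {R : realType} (alpha : R) (halpha : 0 < alpha < 2).
Context {d : measure_display} {T : measurableType d} (P : probability T R).
Context (X : {RV P >-> R}) (L : R -> R) (hLpos : forall x : R, 0 < x -> 0 < L x).
Context (hL : slowly_varying L).
Context (htail : forall x : R, 0 < x -> tail P X x = (L x / x `^ alpha)%:E).

Lemma measurable_X : measurable_fun setT X. Proof. exact: measurable_funPT. Qed.

Lemma tail_tail_mean x : tail P X x = (tail_mean P X x)%:E.
Proof.
have mt : measurable [set w | x < `|X w|].
  have := measurable_fun_ltr (@measurable_cst _ _ T R setT x) (measurable_abs measurable_X).
  move=> /(_ measurableT [set true] I); rewrite setTI; congr measurable.
by rewrite /tail_mean mean_pred// fineK// fin_num_measure.
Qed.

Lemma tail_meanE x : 0 < x -> tail_mean P X x = L x / x `^ alpha.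
Proof. by move=> x0; apply: EFin_inj; rewrite -htail// tail_tail_mean. Qed.

Lemma tail_mean_gt0 x : 0 < x -> 0 < tail_mean P X x.
Proof. by move=> x0; rewrite tail_meanE// divr_gt0 ?hLpos ?powR_gt0. Qed.

Lemma tail_mean_regular t : 0 < t ->
  tail_mean P X (t * x) / tail_mean P X x @[x --> +oo] --> t `^ (- alpha).
Proof.
move=> t0; have h : L (t * x) / L x * t `^ (- alpha) @[x --> +oo] --> 1 * t `^ (- alpha).
  by apply: cvgM; [exact: hL|exact: cvg_cst].
rewrite mul1r in h; apply: cvg_trans h; apply: near_eq_cvg; near=> x.
have x0 : 0 < x by near: x; exact: nbhs_pinfty_gt.
rewrite !tail_meanE ?mulr_gt0// powRM ?ltW// powRN.
have xa := powR_gt0 alpha x0; have ta := powR_gt0 alpha t0; have Lx := hLpos x0.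
by field; rewrite !gt_eqF.
Unshelve. all: by end_near. Qed.

Local Notation a := (normalizer P X).
Local Notation S k := [set x : R | 0 < x /\ (k%:R%:E * tail P X x <= 1)%E].

Lemma normalizer_setE k x : (k%:R%:E * tail P X x <= 1)%E = (k%:R * tail_mean P X x <= 1).
Proof. by rewrite tail_tail_mean -EFinM lee_fin. Qed.

Lemma has_inf_normalizer k : has_inf (S k).
Proof.
split; last by exists 0 => x [/ltW].
have k1 : 0 < (k%:R + 1 : R)^-1 by rewrite invr_gt0 ltr_wpDl.
have [x x0 hx] := tail_mean_cvg0 P measurable_X k1.
exists x; split => //; rewrite normalizer_setE.
apply: (le_trans (ler_wpM2l (ler0n R k) hx)).
by rewrite ler_pdivrMr ?ltr_wpDl// mul1r lerDl.
Qed.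

Lemma normalizer_ge0 k : 0 <= a k.
Proof.
apply: lb_le_inf; first by have [] := has_inf_normalizer k.
by move=> x [/ltW].
Qed.

Lemma normalizer_above k y : 0 < y -> a k < y -> k%:R * tail_mean P X y <= 1.
Proof.
move=> y0 ay; have e0 : 0 < y - a k by rewrite subr_gt0.
have [x [x0 hx] xy] := inf_adherent e0 (has_inf_normalizer k).
rewrite -/(a k) addrC subrK in xy.
rewrite normalizer_setE in hx; apply: le_trans hx; apply: ler_wpM2l => //.
apply: tail_mean_nincr; [exact: measurable_X|exact: ltW].
Qed.

Lemma normalizer_below k y : 0 < y -> y < a k -> 1 < k%:R * tail_mean P X y.
Proof.
move=> y0 ya; rewrite ltNge -normalizer_setE; apply/negP => h.
move: ya; rewrite ltNge => /negP; apply.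
by apply: ge_inf; [by have [] := has_inf_normalizer k|split].
Qed.

Lemma normalizer_gt0 : \forall k \near \oo, 0 < a k.
Proof.
have h : a k @[k --> \oo] --> +oo := normalizer_cvgy tail_mean_gt0 normalizer_above.
by move: h => /cvgryPgt/(_ 0).
Qed.

Lemma normalizer_binomial_gt0 : \forall N \near \oo, 0 < a 'C(N, 2).
Proof. exact: (binomial2_cvgy normalizer_gt0). Qed.

(** At the scale M a_N there are of order N^2 * N^-1 exceedances among the
    'C(N, 2) couplings, so a_'C(N, 2) lies beyond every multiple of a_N. *)
Lemma bscale_cvgy : bscale P X N @[N --> \oo] --> +oo.
Proof.
apply/cvgryPge => M0; pose M := Num.max 1 M0.
have M1 : 0 < M by rewrite (lt_le_trans ltr01)// le_max lexx.
suff : \forall N \near \oo, M <= bscale P X N.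
  by apply: filterS => N; apply: le_trans; rewrite le_max lexx orbT.
have := tail_normalizer halpha tail_mean_gt0 tail_mean_regular normalizer_above
  normalizer_below M1.
have p0 : 0 < M `^ (- alpha) / 2 by rewrite divr_gt0// powR_gt0.
move=> /cvgrPdist_le/(_ _ p0) h.
near=> N.
have aN : 0 < a N by near: N; exact: normalizer_gt0.
have hN : `|M `^ (- alpha) - N%:R * tail_mean P X (a N * M)| <= M `^ (- alpha) / 2.
  by near: N; exact: h.
rewrite /bscale mulrC ler_pdivlMr// mulrC leNgt; apply/negP => lt.
have := normalizer_above (mulr_gt0 aN M1) lt.
have N1 : 2 / (M `^ (- alpha) / 2) + 2 <= N%:R by near: N; exact: nbhs_infty_ger.
set q := tail_mean P X _ in hN *.
have hq : M `^ (- alpha) / 2 <= N%:R * q by move: hN; rewrite ler_norml; lra.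
have N2 : 2 / (M `^ (- alpha) / 2) + 1 <= N%:R - 1 by lra.
have : (2 / (M `^ (- alpha) / 2) + 1) * (M `^ (- alpha) / 2) <= (N%:R - 1) * (N%:R * q).
  apply: ler_pM => //; last exact: ltW.
  by rewrite addr_ge0// divr_ge0// ltW.
rewrite mulrDl divfK ?gt_eqF// mul1r.
by rewrite binomial2E; lra.
Unshelve. all: by end_near. Qed.

End Normalizer.

(** * The test functions *)

Section TestFunctions.
Context {R : realType} (alpha : R) (halpha : 0 < alpha < 2).

Lemma levy_class_bound (f : R -> R) (A : R) : measurable_fun setT f -> 0 <= A ->
  (forall x, x <= 0 -> f x = 0) -> (forall x, 0 < x -> `|f x| <= A * x ^+ 2) ->
  (forall x, 0 < x -> `|f x| <= A) -> levy_class f.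
Proof.
move=> mf A0 f0 f1 f2; split => //; exists A => x; rewrite /levy_weight.
have [x0|x0] := ltP 0 x; last by rewrite f0// normr0 mulr0.
by case: (leP (x ^+ 2) 1) => _; rewrite ?mulr1; [exact: f1|exact: f2].
Qed.

Definition cos_test u (x : R) : R := if 0 < x then cos (u * x) - 1 else 0.
Definition sin_test u (x : R) : R :=
  if 0 < x then sin (u * x) - u * x * (x <= 1)%R%:R else 0.
Definition tanh_test (x : R) : R := if 0 < x then tanh x ^+ 2 else 0.

Lemma measurable_pos : measurable_fun setT (fun x : R => 0 < x).
Proof. exact: measurable_gt. Qed.

Lemma levy_class_cos u : levy_class (cos_test u).
Proof.
have A0 : 0 <= u ^+ 2 / 2 + 2 :> R by rewrite addr_ge0// divr_ge0// sqr_ge0.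
apply: (levy_class_bound _ A0) => [|x x0|x x0|x x0]; rewrite /cos_test ?x0 1?ltNge ?x0//.
- apply: measurable_fun_ifT => //; first exact: measurable_pos.
  apply: measurable_funB => //; apply: (measurableT_comp measurable_cos).
  exact: measurable_funM.
- rewrite distrC ger0_norm ?subr_ge0 ?cos_le1// (le_trans (one_sub_cos_le _))//.
  by rewrite exprMn mulrAC ler_wpM2r ?sqr_ge0// lerDl.
- rewrite distrC ger0_norm ?subr_ge0 ?cos_le1//.
  have := cos_geN1 (u * x); have : 0 <= u ^+ 2 / 2 by rewrite divr_ge0// sqr_ge0.
  lra.
Qed.

Lemma levy_class_sin u : levy_class (sin_test u).
Proof.
have A0 : 0 <= u ^+ 2 / 2 + 1 :> R by rewrite addr_ge0// divr_ge0// sqr_ge0.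
have u2 : 0 <= u ^+ 2 / 2 by rewrite divr_ge0// sqr_ge0.
have b1 x : 0 < x -> x <= 1 -> `|sin (u * x) - u * x * (x <= 1)%R%:R| <= u ^+ 2 / 2 * x ^+ 2.
  move=> x0 x1; rewrite x1 mulr1n mulr1 (le_trans (sin_sub_id_le _))//.
  by rewrite exprMn mulrAC.
have b2 x : 1 < x -> `|sin (u * x) - u * x * (x <= 1)%R%:R| <= 1.
  by move=> x1; rewrite (leNgt x 1) x1 mulr0n mulr0 subr0 ler_norml sin_geN1 sin_le1.
apply: (levy_class_bound _ A0) => [|x x0|x x0|x x0]; rewrite /sin_test ?x0 1?ltNge ?x0//.
- apply: measurable_fun_ifT => //; first exact: measurable_pos.
  apply: measurable_funB.
    by apply: (measurableT_comp measurable_sin); exact: measurable_funM.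
  apply: measurable_funM; first exact: measurable_funM.
  by case: (@bounded_measurable_pred R _ _ _ (@measurable_le R 1)).
- have [x1|x1] := leP x 1.
    have := b1 x x0 x1; rewrite x1 => /le_trans; apply.
    by rewrite ler_wpM2r ?sqr_ge0// lerDl.
  have := b2 x x1; rewrite (leNgt x 1) x1 => /le_trans; apply.
  have : 1 <= x ^+ 2 by rewrite exprn_ege1// ltW.
  by move=> h; rewrite mulrDl mul1r ler_wpDl// mulr_ge0 ?sqr_ge0.
- have [x1|x1] := leP x 1.
    have := b1 x x0 x1; rewrite x1 => /le_trans; apply.
    rewrite -[leRHS]mulr1; apply: ler_pM; rewrite ?sqr_ge0 ?lerDl//.
    by rewrite expr_le1// ltW.
  by have := b2 x x1; rewrite (leNgt x 1) x1 => /le_trans; apply; rewrite lerDr.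
Qed.

Lemma levy_class_tanh : levy_class tanh_test.
Proof.
apply: (levy_class_bound (A := 1)) => // [|x x0|x x0|x x0];
  rewrite /tanh_test ?x0 1?ltNge ?x0//.
- apply: measurable_fun_ifT => //; first exact: measurable_pos.
  by apply: measurable_funX; exact: measurable_tanh.
- rewrite mul1r normrX -[leRHS]real_normK ?num_real//.
  by rewrite lerXn2r ?nnegrE// tanh_le.
- by rewrite normrX expr_le1// ltW// tanh_lt1.
Qed.

Lemma lipschitz_cos u a b : 0 <= a -> lipschitz_on (cos_test u) (2 * `|u|) a b.
Proof.
move=> a0 x y ax xy yb; rewrite /cos_test.
rewrite (le_lt_trans a0 ax) (lt_le_trans (le_lt_trans a0 ax) xy).
have -> : cos (u * x) - 1 - (cos (u * y) - 1) = cos (u * x) - cos (u * y) by ring.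
rewrite (le_trans (cos_lip _ _))// -mulrBr normrM [`|x - y|]distrC (@ger0_norm _ (y - x)) ?subr_ge0//.
have : 0 <= `|u| * (y - x) by rewrite mulr_ge0// subr_ge0.
lra.
Qed.

Lemma lipschitz_sin u a b : (a = 0 /\ b = 1) \/ 1 <= a ->
  lipschitz_on (sin_test u) (2 * `|u|) a b.
Proof.
move=> ab x y ax xy yb; rewrite /sin_test.
have x0 : 0 < x by case: ab => [[<-]//|a1]; rewrite (lt_trans _ ax)// (lt_le_trans _ a1).
rewrite x0 (lt_le_trans x0 xy).
have h1 : `|sin (u * x) - sin (u * y)| <= `|u| * (y - x).
  by rewrite (le_trans (sin_lip _ _))// -mulrBr normrM [`|x - y|]distrC (@ger0_norm _ (y - x)) ?subr_ge0.
case: ab => [[_ b1]|a1]; last first.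
  have x1 := le_lt_trans a1 ax; rewrite (leNgt x 1) x1 (leNgt y 1) (lt_le_trans x1 xy) !mulr0n !mulr0 !subr0.
  have : 0 <= `|u| * (y - x) by rewrite mulr_ge0// subr_ge0.
  by move: h1; lra.
rewrite b1 in yb; rewrite yb (le_trans xy yb) !mulr1n !mulr1.
have -> : sin (u * x) - u * x - (sin (u * y) - u * y) =
  (sin (u * x) - sin (u * y)) + u * (y - x) by ring.
rewrite (le_trans (ler_normD _ _))// normrM (@ger0_norm _ (y - x)) ?subr_ge0//; lra.
Qed.

Lemma lipschitz_tanh a b : 0 <= a -> lipschitz_on tanh_test 4 a b.
Proof.
move=> a0 x y ax xy yb; rewrite /tanh_test.
rewrite (le_lt_trans a0 ax) (lt_le_trans (le_lt_trans a0 ax) xy) subr_sqr normrM.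
have -> : 4 * (y - x) = (2 * `|x - y|) * 2 by rewrite distrC ger0_norm ?subr_ge0//; ring.
apply: ler_pM => //; first exact: tanh_lip.
by rewrite (le_trans (ler_normD _ _))//; have := tanh_lt1 x; have := tanh_lt1 y; lra.
Qed.

Lemma limit_charfunE u : limit_charfun alpha u =
  expC ((stable_levy alpha (cos_test u)) +i* (stable_levy alpha (sin_test u)))%C.
Proof.
rewrite /limit_charfun; congr expC; rewrite /integralC /stable_levy.
congr (_ +i* _)%C; apply: eq_Rintegral => x; rewrite inE/= in_itv/= andbT => x0.
  by rewrite /cos_test x0 /stable_density expR0 mul1r subr0 mulr0 subr0.
rewrite /sin_test x0 /stable_density expR0 mulr0 add0r; congr (_ * _).
rewrite mul1r subr0.
congr (_ - _ * _); rewrite indicE; congr (_%:R); congr nat_of_bool.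
by apply/idP/idP; rewrite inE.
Qed.

(** The definition of beta_crit, solved for the integral. *)
Lemma subcritical (beta : R) : 0 < beta < beta_crit alpha ->
  beta `^ alpha * stable_levy alpha tanh_test < 1.
Proof.
have a0 : 0 < alpha by case/andP: halpha.
have I0 : 0 <= stable_levy alpha tanh_test.
  apply: (levy_functional_ge0 (stable_levy_functional halpha) levy_class_tanh).
  by move=> x; rewrite /tanh_test; case: ifP; rewrite ?sqr_ge0.
have IE : alpha * (\int[lebesgue_measure]_(x in `]0, +oo[) (tanh x ^+ 2 / x `^ (alpha + 1))) =
   stable_levy alpha tanh_test.
  rewrite [X in alpha * X](_ : _ = alpha^-1 * stable_levy alpha tanh_test).
    by rewrite mulrA divff ?mul1r// gt_eqF.
  rewrite /stable_levy -RintegralZl//; last exact: (integrable_levy_class halpha levy_class_tanh).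
  apply: eq_Rintegral => x; rewrite inE/= in_itv/= andbT => x0.
  rewrite /tanh_test x0 /stable_density powRN; field.
  by rewrite !gt_eqF// powR_gt0.
rewrite /beta_crit IE => /andP[b0 bc].
move: I0; rewrite le_eqVlt => /predU1P[<-|I0]; first by rewrite mulr0.
rewrite -ltr_pdivlMr// div1r.
have -> : (stable_levy alpha tanh_test)^-1 =
    (stable_levy alpha tanh_test `^ (- alpha^-1)) `^ alpha.
  by rewrite -powRrM mulNr mulVf ?gt_eqF// powR_inv1// ltW.
by apply: gt0_ltr_powR; rewrite ?nnegrE ?powR_ge0// ltW.
Qed.

End TestFunctions.

(** * Decomposition of the free energy *)

Local Open Scope complex_scope.

Section Decomposition.
Context {R : realType} (N : nat) (beta : R).

Local Notation lnZ := (fun J : 'I_N * 'I_N -> R =>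
  log_reduced (@source N) (@target N) beta (fun e => J (val e))).

Lemma ln_partition_function (J : 'I_N * 'I_N -> R) :
  ln (partition_function beta J) =
  N%:R * ln 2 + \sum_(e in upper_pairs N) ln (cosh (beta * J e)) + lnZ J.
Proof.
have pos : 0 < reduced_partition (@source N) (@target N) (fun e => tanh (beta * J (val e))).
  apply: spin_mean_gt0 => sigma; apply: prodr_gt0 => e _.
  by apply: one_add_tanh_gt0; exact: norm_edge_spin.
have two : (2 : R) ^+ N \is Num.pos by rewrite posrE exprn_gt0.
rewrite /log_reduced.
rewrite [in RHS](_ : N%:R * ln 2 = ln (2 ^+ N)); last by rewrite lnXn// mulr_natl.
rewrite -[X in _ + X + _]expRK -lnM ?posrE ?expR_gt0// -lnM ?posrE//; last first.
  by rewrite mulr_gt0 ?expR_gt0.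
congr ln; rewrite /reduced_partition spin_meanE.
have cancel (c x y : R) : c != 0 -> c * x * (c^-1 * y) = x * y by move=> ?; field.
rewrite cancel ?gt_eqF ?exprn_gt0// mulr_sumr; apply: eq_bigr => s _.
have sub (F : 'I_N * 'I_N -> R) :
    \sum_(e in upper_pairs N) F e = \sum_(e : edge N) F (val e) by rewrite big_sub.
rewrite /hamiltonian opprK mulr_sumr !sub !expR_sum -big_split/=.
apply: eq_bigr => e _.
rewrite lnK ?posrE ?cosh_gt0// /edge_spin /spin -signr_addb -mulrA -signr_addb.
by rewrite mulrA mulrC expR_pm1 [tanh _ * _]mulrC.
Qed.

End Decomposition.

(** * Convergence of the fluctuations *)

Lemma adjacency_error_le {R : realType} (N : nat) (q B e : R) : 0 <= q -> 0 < B ->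
  0 < e -> 'C(N, 2)%:R * q <= B -> 32 * B ^+ 2 / e + 2 <= N%:R ->
  4 * N%:R ^+ 3 * q ^+ 2 <= e.
Proof.
move=> q0 B0 e0 Hq HN; set u := 'C(N, 2)%:R * q in Hq.
have u0 : 0 <= u by rewrite mulr_ge0.
have u2 : u ^+ 2 <= B ^+ 2 by rewrite lerXn2r ?nnegrE// ltW.
have D0 : 0 < 32 * B ^+ 2 / e by rewrite divr_gt0// mulr_gt0// exprn_gt0.
have N1 : 32 * B ^+ 2 / e <= N%:R - 1 by lra.
have N2 : N%:R <= 2 * (N%:R - 1) :> R by lra.
have Npos : 0 < N%:R - 1 :> R by lra.
rewrite ler_pdivrMr// in N1.
have E : 4 * N%:R ^+ 3 * q ^+ 2 * (N%:R - 1) ^+ 2 = 16 * N%:R * u ^+ 2.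
  by rewrite /u binomial2E; field.
rewrite -(ler_pM2r (exprn_gt0 2 Npos)) E [(N%:R - 1) ^+ 2]expr2 [leRHS]mulrA.
apply: (@le_trans _ _ (16 * (2 * (N%:R - 1)) * B ^+ 2)).
  apply: ler_pM; [by rewrite mulr_ge0|exact: sqr_ge0| |by []].
  by rewrite ler_wpM2l.
have -> : 16 * (2 * (N%:R - 1)) * B ^+ 2 = (32 * B ^+ 2) * (N%:R - 1) by ring.
by apply: ler_wpM2r; [exact: ltW|rewrite [leRHS]mulrC].
Qed.

Section Fluctuations.
Context {R : realType} (alpha beta : R) (halpha : 0 < alpha < 2) (beta0 : 0 < beta).
Context {d : measure_display} {T : measurableType d} (P : probability T R).
Context (X : {RV P >-> R}) (L : R -> R) (hsym : symmetric_law P X).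
Context (hLpos : forall x : R, 0 < x -> 0 < L x) (hL : slowly_varying L).
Context (htail : forall x : R, 0 < x -> tail P X x = (L x / x `^ alpha)%:E).

Local Notation a := (normalizer P X).
Local Notation b := (bscale P X).
Local Notation W := (coupling P X).
Let mX := measurable_X X.
Let G0 := tail_mean_gt0 hLpos htail.
Let Gr := tail_mean_regular hLpos hL htail.
Let aa := @normalizer_above _ _ _ P X.
Let ab := @normalizer_below _ _ _ P X.

Lemma measurable_coupling N : measurable_fun setT (W N).
Proof. by apply: measurable_funM; [exact: measurable_cst|exact: mX]. Qed.

Lemma coupling_sym N : same_law P (W N) P (fun w => - W N w).
Proof.
move=> B mB; pose B' : set R := [set x | B ((a N)^-1 * x)].
have mB' : measurable B'.
  rewrite -[B']setTI; have : measurable_fun setT (fun x : R => (a N)^-1 * x).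
    exact: measurable_funM.
  by apply.
have -> : W N @^-1` B = X @^-1` B' by [].
rewrite hsym//; congr (P _); apply/seteqP; split => w;
  by rewrite /B' /= /coupling mulrN.
Qed.

Lemma abs_coupling N w : `|W N w| = `|X w| / a N.
Proof. by rewrite /coupling normrM ger0_norm ?invr_ge0 ?normalizer_ge0// mulrC. Qed.

Lemma normalizers_gt0 : \forall N \near \oo, 0 < a N /\ 0 < a 'C(N, 2).
Proof.
near=> N; split; near: N; first exact: (normalizer_gt0 hLpos htail).
exact: (normalizer_binomial_gt0 hLpos htail).
Unshelve. all: by end_near. Qed.

Lemma bscale_gt0 N : 0 < a N -> 0 < a 'C(N, 2) -> 0 < b N.
Proof. by move=> h1 h2; rewrite /bscale mulr_gt0// invr_gt0. Qed.

Lemma bscale_ge0 N : 0 <= b N.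
Proof. by rewrite /bscale mulr_ge0 ?invr_ge0 ?normalizer_ge0. Qed.

Lemma b_cvgy : b N @[N --> \oo] --> +oo.
Proof. exact: (bscale_cvgy halpha hLpos hL htail). Qed.

Lemma mean_tanh_sqr_cvg :
  N%:R * mean P (fun w => tanh (beta * W N w) ^+ 2) @[N --> \oo] -->
  beta `^ alpha * stable_levy alpha (@tanh_test R).
Proof.
have H := @stable_limit _ _ _ P X mX alpha halpha G0 Gr a aa ab id (fun A h => h)
  beta beta0 (fun=> 0) (cvg_cst 0) (fun N w => beta * `|W N w|).
have /H{}H : forall N, measurable_fun setT (fun w => beta * `|W N w|).
  by move=> N; apply: measurable_funM => //; apply: measurableT_comp => //; exact: measurable_coupling.
have /H{}H : forall N w, 0 <= beta * `|W N w|.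
  by move=> N w; rewrite mulr_ge0// ltW.
have /H{}H : \forall N \near \oo, forall w,
    beta * (`|X w| / a (id N)) - 0 <= beta * `|W N w| <= beta * (`|X w| / a (id N)).
  by apply: nearW => N w; rewrite subr0 abs_coupling lexx.
have {}H := H _ 4 (@levy_class_tanh R) _ (@lipschitz_tanh R 0 1 (lexx 0))
  (fun M M1 => lipschitz_tanh (b := M) ler01).
have {}H := H (ler0n _ _).
rewrite (_ : (fun N => _) = fun N => (id N)%:R * mean P (@tanh_test R \o (fun w => beta * `|W N w|)));
  first exact: H.
apply/funext => N; congr (_ * mean P _); apply/funext => w /=; rewrite /tanh_test.
have [h|h] := ltP 0 (beta * `|W N w|).
  have [w0|w0] := leP 0 (W N w); first by rewrite ger0_norm.
  by rewrite ltr0_norm// mulrN tanhN sqrrN.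
have -> : W N w = 0.
  by apply/eqP; rewrite -normr_le0 -(pmulr_rle0 _ beta0).
by rewrite mulr0 tanh0 expr0n.
Qed.

(** One coupling measured in the scale of the largest ones. *)
Definition log_weight N (x : R) : R := ln (cosh (beta * x)) / (beta * b N).

Lemma log_weight_ge0 N x : 0 <= log_weight N x.
Proof. by rewrite divr_ge0 ?ln_cosh_ge0// mulr_ge0 ?bscale_ge0// ltW. Qed.

Lemma measurable_log_weight N : measurable_fun setT (log_weight N).
Proof.
apply: measurable_funM => //; apply: (measurableT_comp (@measurable_ln_cosh R)).
exact: measurable_funM.
Qed.

Let xi N w : R := log_weight N (W N w).

Let mxi N : measurable_fun setT (xi N).
Proof. exact: (measurableT_comp (measurable_log_weight N) (measurable_coupling N)). Qed.

Let xi_ge0 N w : 0 <= xi N w. Proof. exact: log_weight_ge0. Qed.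

Let delta N : R := ln 2 / (beta * b N).

Let delta0 : delta N @[N --> \oo] --> (0 : R).
Proof.
have h := cvgyV0 b_cvgy.
have : (ln 2 / beta) * (b N)^-1 @[N --> \oo] --> (ln 2 / beta) * 0.
  by apply: cvgM => //; exact: cvg_cst.
by rewrite mulr0; apply: cvg_trans; apply: near_eq_cvg; apply: nearW => N;
  rewrite /delta [in RHS]invfM !mulrA.
Qed.

Let xi_near : \forall N \near \oo, forall w,
  1 * (`|X w| / a 'C(N, 2)) - delta N <= xi N w <= 1 * (`|X w| / a 'C(N, 2)).
Proof.
apply: filterS normalizers_gt0 => N [aN an] w; rewrite mul1r.
have bN := bscale_gt0 aN an; have bb : 0 < beta * b N by rewrite mulr_gt0.
have E : `|X w| / a 'C(N, 2) = `|beta * W N w| / (beta * b N).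
  rewrite normrM (gtr0_norm beta0) abs_coupling /bscale; field.
  by rewrite !gt_eqF.
rewrite E /xi /log_weight /delta -mulrBl !ler_pM2r ?invr_gt0//.
by rewrite ln_cosh_ge ln_cosh_le.
Qed.

Let limit h K := @stable_limit _ _ _ P X mX alpha halpha G0 Gr a aa ab
  (fun N => 'C(N, 2)) binomial2_cvgy 1 ltr01 delta delta0 xi mxi xi_ge0 xi_near h K.

Definition truncated_weight N : R := mean P (fun w => xi N w * (xi N w <= 1)%R%:R).

Lemma truncated_weight_sqr_cvg0 :
  'C(N, 2)%:R * truncated_weight N ^+ 2 @[N --> \oo] --> (0 : R).
Proof.
exact: (@truncated_mean_sqr_cvg0 _ _ _ P X mX alpha halpha G0 Gr a aa ab
  (fun N => 'C(N, 2)) binomial2_cvgy 1 ltr01 delta delta0 xi mxi xi_ge0 xi_near).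
Qed.

Lemma weight_characteristic_cvg u :
  cvgC (fun N => 'C(N, 2)%:R * (characteristic P (fun w => u * xi N w) - 1 -
     (0 +i* (u * truncated_weight N))))
    ((stable_levy alpha (cos_test u)) +i* (stable_levy alpha (sin_test u))).
Proof.
have ReM (k : nat) (z : R[i]) : complex.Re (k%:R * z) = k%:R * complex.Re z.
  by rewrite -(rmorph_nat (@real_complex R)); case: z => x y /=; rewrite mul0r subr0.
have ImM (k : nat) (z : R[i]) : complex.Im (k%:R * z) = k%:R * complex.Im z.
  by rewrite -(rmorph_nat (@real_complex R)); case: z => x y /=; rewrite mul0r addr0.
have K0 : 0 <= 2 * `|u| by rewrite mulr_ge0.
have hc := limit (levy_class_cos u) K0 (@lipschitz_cos R u 0 1 (lexx 0))
  (fun M M1 => @lipschitz_cos R u 1 M ler01).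
have hs := limit (levy_class_sin u) K0
  (@lipschitz_sin R u 0 1 (or_introl (conj erefl erefl)))
  (fun M M1 => @lipschitz_sin R u 1 M (or_intror (lexx 1))).
rewrite powR1 mul1r in hc; rewrite powR1 mul1r in hs.
have muxi N : measurable_fun setT (fun w => u * xi N w) by exact: measurable_funM.
have bc N := bounded_measurable_cosY (muxi N).
have bs N := bounded_measurable_sinY (muxi N).
have bt N : bounded_measurable (fun w => xi N w * (xi N w <= 1)%R%:R).
  split.
    apply: measurable_funM; first exact: mxi.
    apply: (measurableT_comp (f := fun b : bool => b%:R : R)) => //.
    exact: measurable_fun_ler.
  exists 1 => w; have := xi_ge0 N w; case: (leP (xi N w) 1) => x1 x0.
    by rewrite mulr1n mulr1 ger0_norm.
  by rewrite mulr0n mulr0 normr0.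
split => /=.
  apply: cvg_trans hc; apply: near_eq_cvg; apply: nearW => N.
  rewrite ReM /=; congr (_ * _); rewrite subr0.
  rewrite -[X in _ - X](mean_cst P 1) -meanB//; last exact: bounded_measurable_cst.
  congr mean; apply/funext => w /=; rewrite /cos_test; case: ifPn => //.
  rewrite -leNgt => h; have -> : xi N w = 0 by apply/eqP; rewrite eq_le h xi_ge0.
  by rewrite mulr0 cos0 subrr.
apply: cvg_trans hs; apply: near_eq_cvg; apply: nearW => N.
rewrite ImM /=; congr (_ * _); rewrite subr0 /truncated_weight -meanZ// -meanB//; last first.
  exact: bounded_measurableZ.
congr mean; apply/funext => w /=; rewrite /sin_test mulrA; case: ifPn => //.
rewrite -leNgt => h; have -> : xi N w = 0 by apply/eqP; rewrite eq_le h xi_ge0.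
by rewrite mulr0 sin0 mul0r subrr.
Qed.

Lemma truncated_lncosh_meanE N : 0 < b N ->
  truncated_lncosh_mean P X beta N = beta * b N * truncated_weight N.
Proof.
move=> bN; have bb : 0 < beta * b N by rewrite mulr_gt0.
rewrite /truncated_lncosh_mean unlock /truncated_weight -meanZ; last first.
  split.
    apply: measurable_funM; first exact: mxi.
    apply: (measurableT_comp (f := fun b : bool => b%:R : R)) => //.
    exact: measurable_fun_ler.
  exists 1 => w; have := xi_ge0 N w; case: (leP (xi N w) 1) => x1 x0.
    by rewrite mulr1n mulr1 ger0_norm.
  by rewrite mulr0n mulr0 normr0.
rewrite /mean /Rintegral; congr fine; apply: eq_integral => w _; congr EFin.
have E : ln (cosh (beta * W N w)) = beta * b N * xi N w.
  by rewrite /xi /log_weight [RHS]mulrC divfK// gt_eqF.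
rewrite mulrA -E; congr (_ * _); rewrite indicE; congr (_%:R); congr nat_of_bool.
have E2 : (ln (cosh (beta * W N w)) <= beta * b N) = (xi N w <= 1).
  by rewrite E -[X in _ <= X]mulr1 ler_pM2l.
by apply/idP/idP => [/set_mem /=|h]; [rewrite E2|apply/mem_set; rewrite /= E2].
Qed.

Context (dN : nat -> measure_display) (TN : forall N : nat, measurableType (dN N)).
Context (PN : forall N : nat, probability (TN N) R).
Context (J : forall N : nat, 'I_N * 'I_N -> {RV (PN N) >-> R}).
Arguments J : clear implicits.
Context (hindep : forall N : nat,
  mutually_independent (PN N) (upper_pairs N) (fun e w => J N e w)).
Context (hlaw : forall (N : nat) (e : 'I_N * 'I_N), e \in upper_pairs N ->
  same_law (PN N) (J N e) P (coupling P X N)).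

Let mJ N (e : 'I_N * 'I_N) : measurable_fun setT (J N e).
Proof. exact: measurable_funPT. Qed.

Definition leading_term N (w : TN N) : R :=
  \sum_(e in upper_pairs N) log_weight N (J N e w) - 'C(N, 2)%:R * truncated_weight N.

Definition log_remainder N (w : TN N) : R :=
  log_reduced (@source N) (@target N) beta (fun e => J N (val e) w).

Lemma measurable_sum_log_weight N :
  measurable_fun setT (fun w => \sum_(e in upper_pairs N) log_weight N (J N e w)).
Proof.
under eq_fun do rewrite big_mkcond/=.
apply: measurable_sum => e; case: (e \in _) => //.
exact: (measurableT_comp (measurable_log_weight N) (mJ e)).
Qed.

Lemma measurable_leading_term N : measurable_fun setT (@leading_term N).
Proof. by apply: measurable_funB => //; exact: measurable_sum_log_weight. Qed.

Lemma measurable_log_remainder N : measurable_fun setT (@log_remainder N).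
Proof. by apply: measurable_log_reduced => e; exact: mJ. Qed.

Lemma card_upper_pairs N : #|upper_pairs N| = 'C(N, 2).
Proof. by rewrite -(@card_edge R) card_sig; apply: eq_card. Qed.

Lemma leading_term_cvg u :
  cvgC (fun N => characteristic (PN N) (fun w => u * leading_term w))
    (limit_charfun alpha u).
Proof.
rewrite limit_charfunE.
have n_cvgy : ('C(N, 2))%:R @[N --> \oo] --> (+oo : set_system R).
  exact: (cvg_comp _ _ binomial2_cvgy (@cvgr_idn R)).
have muxi N : measurable_fun setT (fun w => u * xi N w) by exact: measurable_funM.
have m1 N : modulus (characteristic P (fun w => u * xi N w)) <= 1.
  exact: modulus_characteristic.
have H := @compound_cvg R (fun N => 'C(N, 2))
  (fun N => characteristic P (fun w => u * xi N w)) (fun N => u * truncated_weight N) _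
  m1 (fun N => le_trans (ler_norm _) (le_trans (abs_Re_le _) (m1 N))) n_cvgy _
  (weight_characteristic_cvg u).
have h0 : ('C(N, 2))%:R * (u * truncated_weight N) ^+ 2 @[N --> \oo] --> (0 : R).
  have : u ^+ 2 * ('C(N, 2)%:R * truncated_weight N ^+ 2) @[N --> \oo] --> u ^+ 2 * 0.
    by apply: cvgM; [exact: cvg_cst|exact: truncated_weight_sqr_cvg0].
  rewrite mulr0; apply: cvg_trans; apply: near_eq_cvg; apply: nearW => N.
  by rewrite exprMn mulrCA.
have {}H := H h0; rewrite (_ : (fun N => _) = fun N =>
  (characteristic P (fun w => u * xi N w) *
    expC (0 -i* (u * truncated_weight N))) ^+ 'C(N, 2)); first exact: H.
apply/funext => N; rewrite exprMn -expCMn.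
have K0 : 0 <= `|u| * (`|(beta * b N)^-1| * beta).
  by rewrite mulr_ge0// mulr_ge0// ltW.
have mg : measurable_fun setT (fun x => u * log_weight N x).
  by apply: measurable_funM => //; exact: measurable_log_weight.
have lip (x y : R) : `|u * log_weight N x - u * log_weight N y| <=
    `|u| * (`|(beta * b N)^-1| * beta) * `|x - y|.
  rewrite -mulrBr normrM -[leRHS]mulrA ler_wpM2l// /log_weight -mulrBl normrM mulrC.
  rewrite -[leRHS]mulrA ler_wpM2l// (le_trans (ln_cosh_lip _ _))//.
  by rewrite -mulrBr normrM (gtr0_norm beta0).
pose S w := \sum_(e in upper_pairs N) u * log_weight N (J N e w).
have -> : characteristic P (fun w => u * xi N w) ^+ 'C(N, 2) = characteristic (PN N) S.
  rewrite -card_upper_pairs; apply: esym.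
  exact: (characteristic_sum (Z := fun e w => J N e w) (@mJ N) (@hindep N)
    (measurable_coupling N) (@hlaw N) K0 mg lip).
have -> : 'C(N, 2)%:R * (0 -i* (u * truncated_weight N)) =
    0 -i* ('C(N, 2)%:R * (u * truncated_weight N)) :> R[i].
  by rewrite -(rmorph_nat (@real_complex R)); apply/eqP; rewrite eq_complex /= !mul0r !mulr0 ?subr0 ?addr0 ?mulrN !eqxx.
set c := 'C(N, 2)%:R * _.
have SE (w : TN N) : u * leading_term w = S w - c.
  by rewrite /leading_term mulrBr mulr_sumr mulrCA.
have mS : measurable_fun setT S.
  rewrite (_ : S = fun w => u * \sum_(e in upper_pairs N) log_weight N (J N e w)).
    by apply: measurable_funM => //; exact: measurable_sum_log_weight.
  by apply/funext => w; rewrite mulr_sumr.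
have bc := bounded_measurable_cosY mS; have bs := bounded_measurable_sinY mS.
under [X in characteristic _ X]eq_fun do rewrite SE.
apply/eqP; rewrite eq_complex /= expR0 !mul1r cosN sinN; apply/andP; split; apply/eqP.
  transitivity (mean (PN N) (fun w => cos c * cos (S w) + sin c * sin (S w))).
    by congr mean; apply/funext => w; rewrite cosB; ring.
  by rewrite meanD ?meanZ//; [ring|exact: bounded_measurableZ|exact: bounded_measurableZ].
transitivity (mean (PN N) (fun w => cos c * sin (S w) + (- sin c) * cos (S w))).
  by congr mean; apply/funext => w; rewrite sinB; ring.
by rewrite meanD ?meanZ//; [ring|exact: bounded_measurableZ|exact: bounded_measurableZ].
Qed.

Lemma fluctuationE N (w : TN N) : 0 < b N ->
  free_energy_fluctuation P X beta (fun e => J N e w) =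
  beta * leading_term w + (b N)^-1 * log_remainder w.
Proof.
move=> bN; rewrite /free_energy_fluctuation ln_partition_function truncated_lncosh_meanE//.
rewrite /leading_term /log_weight -mulr_suml /log_remainder.
by field; rewrite !gt_eqF.
Qed.

Lemma measurable_fluctuation N : measurable_fun setT
  (fun w => free_energy_fluctuation P X beta (fun e => J N e w)).
Proof.
rewrite /free_energy_fluctuation; apply: measurable_funM => //.
apply: measurable_funB => //; apply: measurable_funB => //.
under eq_fun do rewrite ln_partition_function.
apply: measurable_funD; last exact: measurable_log_remainder.
apply: measurable_funD => //; under eq_fun do rewrite big_mkcond/=.
apply: measurable_sum => e; case: (e \in _) => //.
apply: (measurableT_comp (@measurable_ln_cosh R)).
by apply: measurable_funM => //; exact: mJ.
Qed.

Context (hbeta : beta < beta_crit alpha).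

Lemma scaled_lt N eta x : 0 < a N -> (eta * b N < x / a N) = (a 'C(N, 2) * eta < x).
Proof.
move=> aN; rewrite /bscale ltr_pdivlMr// (_ : _ * a N = a 'C(N, 2) * eta)//.
by field; rewrite gt_eqF.
Qed.

Lemma scaled_tail_mean N eta : 0 < a N ->
  mean P (fun w => (eta * b N < `|W N w|)%R%:R) = tail_mean P X (a 'C(N, 2) * eta).
Proof.
by move=> aN; congr mean; apply/funext => w; rewrite abs_coupling scaled_lt.
Qed.

Lemma scaled_truncated_square N eta : 0 < a N -> 0 < a 'C(N, 2) ->
  mean P (fun w => between 0 (eta * b N) `|W N w| * `|W N w| ^+ 2) =
  b N ^+ 2 * (truncated_square P X (a 'C(N, 2) * eta) / a 'C(N, 2) ^+ 2).
Proof.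
move=> aN an; have -> : b N ^+ 2 * (truncated_square P X (a 'C(N, 2) * eta) / a 'C(N, 2) ^+ 2) =
    (a N)^-1 ^+ 2 * truncated_square P X (a 'C(N, 2) * eta).
  by rewrite /bscale; field; rewrite !gt_eqF.
rewrite /truncated_square -(meanZ P _ (bounded_measurable_square mX _)).
congr mean; apply/funext => w; rewrite abs_coupling /between leNgt scaled_lt// -leNgt.
have -> : (0 < `|X w| / a N) = (0 < `|X w|) by rewrite pmulr_lgt0 ?invr_gt0.
by rewrite exprMn; ring.
Qed.

Lemma binomial_tail_le eta : 0 < eta -> \forall N \near \oo,
  'C(N, 2)%:R * tail_mean P X (a 'C(N, 2) * eta) <= 2 * eta `^ (- alpha).
Proof.
move=> eta0; have p0 : 0 < eta `^ (- alpha) by rewrite powR_gt0.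
have H := tail_normalizer halpha G0 Gr aa ab eta0.
have h2 : \forall k \near \oo, k%:R * tail_mean P X (a k * eta) <= 2 * eta `^ (- alpha).
  move: H => /cvgrPdist_le/(_ _ p0); apply: filterS => k.
  by rewrite ler_norml => /andP[h3 _]; move: h3; set u := _ * _; lra.
exact: (near_binomial2 h2).
Qed.

(** Subcriticality provides the second moment bound, through r < 1.  The
    threshold eta b_N between small and large couplings is chosen after theta, so
    that the conditional variance, of order eta^(2 - alpha) b_N^2, is small
    against (theta b_N)^2; the probability that two large couplings share a
    vertex is of order N^3 n^-2, hence vanishes. *)
Lemma log_remainder_small (theta eps : R) : 0 < theta -> 0 < eps ->
  \forall N \near \oo,
    mean (PN N) (fun w => (theta * b N < `|log_remainder w|)%R%:R) <= eps.
Proof.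
move=> th0 eps0; have a2 : 0 < 2 - alpha by move: halpha; lra.
set I := beta `^ alpha * stable_levy alpha (@tanh_test R).
have I1 : I < 1 by apply: subcritical => //; rewrite beta0.
pose r := (I + 1) / 2; have [Ir r1] : I < r /\ r < 1 by rewrite /r; split; lra.
pose Cr := expR (2^-1 * (r / (1 - r))).
pose e := eps / 8; have e0 : 0 < e by rewrite divr_gt0.
have [C C0 hC] := truncated_square_normalizer mX halpha G0 Gr aa ab.
pose D := 32 * beta ^+ 2 * (C + 2) * (4 * (Cr / e) + e^-1).
have Cr0 : 0 < Cr by exact: expR_gt0.
have b20 : 0 < 32 * beta ^+ 2 * (C + 2) by rewrite !mulr_gt0 ?exprn_gt0// addr_gt0.
have D0 : 0 < D.
  by rewrite mulr_gt0// addr_gt0 ?invr_gt0// mulr_gt0// divr_gt0.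
have th2 : 0 < theta ^+ 2 / 32 by rewrite divr_gt0// exprn_gt0.
(* D eta^(2 - alpha) bounds 4 (Cr / e) kappa + kappa / e, where V <= kappa b_N^2;
   both have to stay below x^2 / b_N^2 = theta^2 / 16 *)
have [eta /andP[eta0 _] hD] := small_powR a2 D0 th2.
pose B := 2 * eta `^ (- alpha).
have B0 : 0 < B by rewrite mulr_gt0// powR_gt0.
have hq := binomial_tail_le eta0.
have hs : \forall N \near \oo, 'C(N, 2)%:R *
    (truncated_square P X (a 'C(N, 2) * eta) / a 'C(N, 2) ^+ 2) <= C * eta `^ (2 - alpha).
  exact: (near_binomial2 (hC _ eta0)).
have ht : \forall N \near \oo, N%:R * mean P (fun w => tanh (beta * W N w) ^+ 2) <= r.
  have rI : 0 < r - I by rewrite subr_gt0.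
  have := mean_tanh_sqr_cvg => /cvgrPdist_le/(_ _ rI); apply: filterS => N.
  by rewrite -/I ler_norml; lra.
have n_cvgy : ('C(N, 2))%:R @[N --> \oo] --> (+oo : set_system R).
  exact: (cvg_comp _ _ binomial2_cvgy (@cvgr_idn R)).
have hn : \forall N \near \oo, 2 * B <= 'C(N, 2)%:R by move: n_cvgy => /cvgryPge/(_ (2 * B)).
have hb : \forall N \near \oo, 4 * (ln 2 + 1) / theta + 4 / eps / theta <= b N.
  by move: b_cvgy => /cvgryPge/(_ (4 * (ln 2 + 1) / theta + 4 / eps / theta)).
near=> N.
have [aN an] : 0 < a N /\ 0 < a 'C(N, 2) by near: N; exact: normalizers_gt0.
have Hq : 'C(N, 2)%:R * tail_mean P X (a 'C(N, 2) * eta) <= B by near: N; exact: hq.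
have Hs : 'C(N, 2)%:R * (truncated_square P X (a 'C(N, 2) * eta) / a 'C(N, 2) ^+ 2) <=
  C * eta `^ (2 - alpha) by near: N; exact: hs.
have Ht : N%:R * mean P (fun w => tanh (beta * W N w) ^+ 2) <= r by near: N; exact: ht.
have Hn : 2 * B <= 'C(N, 2)%:R by near: N; exact: hn.
have Hb : 4 * (ln 2 + 1) / theta + 4 / eps / theta <= b N by near: N; exact: hb.
have HN : 32 * B ^+ 2 / e + 2 <= N%:R by near: N; exact: nbhs_infty_ger.
have bN := bscale_gt0 aN an.
have ln2 : 0 < ln 2 :> R by rewrite ln_gt0// ltr1n.
have {Hb} [Hb1 Hb2] : 4 * (ln 2 + 1) <= theta * b N /\ 4 / eps <= theta * b N.
  have : (4 * (ln 2 + 1) / theta + 4 / eps / theta) * theta <= b N * theta by rewrite ler_wpM2r// ltW.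
  rewrite mulrDl !divfK ?gt_eqF// [b N * _]mulrC => h.
  have h1 : 0 < 4 / eps by rewrite divr_gt0.
  move: h h1 ln2; set u := ln 2; set v := 4 / eps; set z := theta * b N => h h1 h2.
  by split; lra.
have bl (f g : TN N -> R) : measurable_fun setT f -> measurable_fun setT g ->
    bounded_measurable (fun w => (f w < g w)%R%:R : R).
  by move=> mf mg; apply: bounded_measurable_pred; exact: measurable_fun_ltr.
have mr := @measurable_log_remainder N.
have ms : measurable_fun setT (fun w => `|@log_remainder N w|) by exact: measurableT_comp.
(* 2 x is half of theta b_N; the other half absorbs ln 2 + 1 *)
set x := theta * b N / 4; have x0 : 0 < x by rewrite divr_gt0// mulr_gt0.
apply: (@le_trans _ _ (mean (PN N) (fun w => (theta * b N - 1 + 1 < log_remainder w)%R%:R +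
    (log_remainder w < - ln 2 - 2 * x - 1)%R%:R))).
  apply: le_mean; [exact: bl|by apply: bounded_measurableD; exact: bl|move=> w].
  case: (ltP (theta * b N) `|log_remainder w|) => h; last by rewrite mulr0n addr_ge0.
  move: h; rewrite subrK lter_normr => /orP[->|h]; first by rewrite mulr1n lerDl.
  rewrite [X in _ + X](_ : _ = 1) ?lerDr//.
  rewrite (_ : (_ < _) = true)//; rewrite /x; lra.
rewrite meanD; [|exact: bl|exact: bl].
have up : mean (PN N) (fun w => (theta * b N - 1 + 1 < log_remainder w)%R%:R) <= e + eps / 4.
  apply: (le_trans (log_reduced_upper_tail (@mJ N) (@hindep N) (measurable_coupling N)
    (@coupling_sym N) (@hlaw N) (ltW beta0) _ e0)); rewrite lerD2l expRN.
  have h1 := expR_ge1Dx (theta * b N - 1).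
  have h2 : 4 / eps <= expR (theta * b N - 1) by lra.
  have h3 : 0 < 4 / eps by rewrite divr_gt0.
  have -> : eps / 4 = (4 / eps)^-1 by rewrite invf_div.
  by rewrite lef_pV2 ?posrE ?expR_gt0.
pose V : R := 32 * beta ^+ 2 * ('C(N, 2)%:R * truncated_variance P (W N) (eta * b N)).
pose kappa := 32 * beta ^+ 2 * (C + 2) * eta `^ (2 - alpha).
have k0 : 0 < kappa by rewrite mulr_gt0// powR_gt0.
have etaE : eta ^+ 2 * B = 2 * eta `^ (2 - alpha).
  rewrite /B mulrCA; congr (2 * _).
  by rewrite -powR_mulrn ?ltW// -powRD ?(gt_eqF eta0) ?implybT.
have VE : V = b N ^+ 2 * (32 * beta ^+ 2 *
    ('C(N, 2)%:R * (truncated_square P X (a 'C(N, 2) * eta) / a 'C(N, 2) ^+ 2) +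
     eta ^+ 2 * ('C(N, 2)%:R * tail_mean P X (a 'C(N, 2) * eta)))).
  by rewrite /V /truncated_variance scaled_truncated_square// scaled_tail_mean//; ring.
have Vk : V <= b N ^+ 2 * kappa.
  have -> : kappa = 32 * beta ^+ 2 * (C * eta `^ (2 - alpha) + eta ^+ 2 * B).
    by rewrite etaE /kappa; ring.
  have b32 : 0 <= 32 * beta ^+ 2 by exact: (mulr_ge0 (ler0n R 32) (sqr_ge0 beta)).
  rewrite VE; apply: (ler_wpM2l (sqr_ge0 _)); apply: (ler_wpM2l b32).
  by apply: lerD => //; exact: (ler_wpM2l (sqr_ge0 _)).
have Dk : D * eta `^ (2 - alpha) = 4 * (Cr / e) * kappa + kappa / e.
  by rewrite /D /kappa; ring.
rewrite Dk in hD.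
have c4 : 0 < 4 * (Cr / e) by apply: mulr_gt0 => //; exact: divr_gt0.
have k1 : 0 < 4 * (Cr / e) * kappa by exact: mulr_gt0.
have k2 : 0 < kappa / e by rewrite divr_gt0.
have b2 : 0 < b N ^+ 2 by rewrite exprn_gt0.
have xE : x ^+ 2 = b N ^+ 2 * (theta ^+ 2 / 16) by rewrite /x; field.
have cond : 4 * (Cr / e) * V < x ^+ 2.
  apply: (@le_lt_trans _ _ (b N ^+ 2 * (4 * (Cr / e) * kappa))).
    by rewrite [leRHS]mulrCA; exact: (ler_wpM2l (ltW c4) Vk).
  rewrite xE ltr_pM2l//; move: hD k2; set u := kappa / e; set v := _ * kappa; lra.
have Vx : V / x ^+ 2 <= e.
  rewrite ler_pdivrMr ?exprn_gt0// (le_trans Vk)// xE [leRHS]mulrCA.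
  apply: (ler_wpM2l (ltW b2)); rewrite [leRHS]mulrC -ler_pdivrMr//.
  by move: hD k1 k2; set u := kappa / e; set v := _ * kappa; lra.
set q := tail_mean P X _ in Hq VE.
have n0 : 0 < 'C(N, 2)%:R :> R by lra.
have q0 : 0 <= q by apply: mean_ge0.
have q2 : q <= 2^-1.
  by rewrite -(ler_pM2l n0); lra.
have third := adjacency_error_le q0 B0 e0 Hq HN.
have l0 : 0 < eta * b N by rewrite mulr_gt0.
have q2' : mean P (fun w => (eta * b N < `|W N w|)%R%:R) <= 2^-1.
  by rewrite scaled_tail_mean.
have lo := log_reduced_lower_tail (@mJ N) (@hindep N) (measurable_coupling N)
  (@coupling_sym N) (@hlaw N) (ltW beta0) l0 e0 x0 q2' Ht r1 cond.
rewrite scaled_tail_mean// -/q -/V in lo.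
have {}lo : mean (PN N) (fun w => (log_remainder w < - ln 2 - 2 * x - 1)%R%:R) <= 4 * e.
  by apply: (le_trans lo); lra.
by move: up lo; rewrite /e; lra.
Unshelve. all: by end_near. Qed.

(** The sine and cosine are 1-Lipschitz and bounded, so that a remainder that is
    small in probability does not change the limit. *)
Lemma fluctuation_cvg (t : R) :
  cvgC (fun N => characteristic (PN N)
      (fun w => t * free_energy_fluctuation P X beta (fun e => J N e w)))
    (limit_charfun alpha (t * beta)).
Proof.
apply: cvgC_modulus (leading_term_cvg (t * beta)) _.
apply/cvgrPdist_le => eps eps0.
pose theta := eps / (4 * (`|t| + 1)).
have t0 : 0 < `|t| + 1 by rewrite ltr_wpDl.
have th0 : 0 < theta by rewrite divr_gt0// mulr_gt0.
have e8 : 0 < eps / 8 by rewrite divr_gt0.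
near=> N.
have [aN an] : 0 < a N /\ 0 < a 'C(N, 2) by near: N; exact: normalizers_gt0.
have hN : mean (PN N) (fun w => (theta * b N < `|log_remainder w|)%R%:R) <= eps / 8.
  by near: N; exact: log_remainder_small.
have bN := bscale_gt0 aN an.
have bi : bounded_measurable (fun w => (theta * b N < `|@log_remainder N w|)%R%:R : R).
  apply: bounded_measurable_pred; apply: measurable_fun_ltr => //.
  by apply: measurableT_comp => //; exact: measurable_log_remainder.
pose h w : R := `|t| * theta + 2 * (theta * b N < `|@log_remainder N w|)%R%:R.
have bh : bounded_measurable h.
  by apply: bounded_measurableD; [exact: bounded_measurable_cst|exact: bounded_measurableZ].
have mh : mean (PN N) h <= eps / 2.
  rewrite meanD; [|exact: bounded_measurable_cst|exact: bounded_measurableZ].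
  rewrite mean_cst meanZ//.
  have : `|t| * theta <= eps / 4.
    have -> : `|t| * theta = `|t| / (`|t| + 1) * (eps / 4).
      by rewrite /theta; field; rewrite gt_eqF.
    by apply: ler_piMl; [rewrite divr_ge0// ltW|rewrite ler_pdivrMr// mul1r lerDl].
  lra.
have mF : measurable_fun setT
    (fun w => t * free_energy_fluctuation P X beta (fun e => J N e w)).
  by apply: measurable_funM => //; exact: measurable_fluctuation.
have mL : measurable_fun setT (fun w => t * beta * @leading_term N w).
  by apply: measurable_funM => //; exact: measurable_leading_term.
rewrite sub0r normrN ger0_norm ?modulus_ge0//.
apply: (le_trans (characteristic_dist (PN N) mF mL bh _)); last by lra.
move=> w; rewrite fluctuationE// /h.
have -> : t * (beta * leading_term w + (b N)^-1 * log_remainder w) - t * beta * leading_term w =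
   t * (log_remainder w / b N) by ring.
have bi0 : 0 <= (b N)^-1 by rewrite invr_ge0 ltW.
rewrite normrM normrM (ger0_norm bi0).
case: (ltP (theta * b N) `|log_remainder w|) => hw.
  by rewrite mulr1n mulr1 ge_min lerDr mulr_ge0// ltW.
rewrite mulr0n mulr0 addr0 ge_min; apply/orP; right.
by rewrite ler_wpM2l// ler_pdivrMr.
Unshelve. all: by end_near. Qed.

End Fluctuations.

Local Close Scope complex_scope.

(** * Convergence in distribution *)

Unset Implicit Arguments.
Set Strict Implicit.
Set Printing Implicit Defensive.

Theorem theorem2p2 (R : realType) (alpha beta : R)
  (halpha : 0 < alpha < 2)
  (hbeta : 0 < beta < beta_crit alpha)
  (* the variable X and its tail *)
  (d : measure_display) (T : measurableType d) (P : probability T R)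
  (X : {RV P >-> R}) (L : R -> R)
  (hsym : symmetric_law P X)
  (hLpos : forall x : R, 0 < x -> 0 < L x)
  (hL : slowly_varying L)
  (htail : forall x : R, 0 < x -> tail P X x = (L x / x `^ alpha)%:E)
  (* for each N, i.i.d. copies (J_ij)_{i<j} of J = X / a_N *)
  (dN : nat -> measure_display) (TN : forall N : nat, measurableType (dN N))
  (PN : forall N : nat, probability (TN N) R)
  (J : forall N : nat, 'I_N * 'I_N -> {RV (PN N) >-> R})
  (hindep : forall N : nat,
     mutually_independent (PN N) (upper_pairs N) (fun e w => J N e w))
  (hlaw : forall (N : nat) (e : 'I_N * 'I_N), e \in upper_pairs N ->
     same_law (PN N) (J N e) P (coupling P X N))
  (* the limiting variable Y_alpha *)
  (d' : measure_display) (T' : measurableType d') (P' : probability T' R)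
  (Y : {RV P' >-> R})
  (hY : forall t : R, charfun P' Y t = limit_charfun alpha t) :
  cvg_in_distribution PN
    (fun N w => free_energy_fluctuation P X beta (fun e => J N e w))
    P' (fun w => beta * Y w).
Proof.
have [beta0 hbeta1] := andP hbeta.
have mbY : measurable_fun setT (fun w => beta * Y w).
  by apply: measurable_funM => //; exact: measurable_funPT.
have cvg t := fluctuation_cvg halpha beta0 hsym hLpos hL htail hindep hlaw hbeta1 t.
apply: levy_continuity => // [N|t|t].
- exact: measurable_fluctuation.
- have [hRe _] := cvg t; rewrite -hY /= in hRe; rewrite /mean_cvg.
  rewrite (_ : mean P' _ = \int[P']_x (expR 0 * cos (t * beta * Y x))); first exact: hRe.
  by apply: eq_Rintegral => w _; rewrite /= expR0 mul1r mulrA.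
- have [_ hIm] := cvg t; rewrite -hY /= in hIm; rewrite /mean_cvg.
  rewrite (_ : mean P' _ = \int[P']_x (expR 0 * sin (t * beta * Y x))); first exact: hIm.
  by apply: eq_Rintegral => w _; rewrite /= expR0 mul1r mulrA.
Qed.
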